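(* Let $(G,H,\alpha,\tau)$ be a Lie crossed module, $\pi:P\to M$ a principal $G$-bundle and $\bar A$ a connection form on it. Let $C_0$ be an $L(G)$-valued $1$-form, $C_1$ an $L(H)$-valued $1$-form, $B_0$ an $L(G)$-valued $2$-form and $B_1$ an $L(H)$-valued $2$-form on $P$, all equivariant and horizontal (as defined in the context). Let $C^L=C^L_0+C^L_1$ and $C^R=C^R_0+C^R_1$, where $C^L_0=C^R_0=C_0$, and let $B=B_0+B_1$. For $\bar\gamma\in\mathcal{P}_{\bar A}P$ with domain $[t_0,t_1]$ let $t\mapsto h_{\bar\gamma}(t)\in H$ be the solution of $$h_{\bar\gamma}'(t)h_{\bar\gamma}(t)^{-1}=-C_1\big(\bar\gamma'(t)\big),\qquad h_{\bar\gamma}(t_0)=e,$$ and put $g_{\bar\gamma}(t)=\tau(h_{\bar\gamma}(t))$, $h^*(\bar\gamma)=h_{\bar\gamma}(t_1)$, $g^*(\bar\gamma)=\tau(h^*(\bar\gamma))$. On the decorated bundle $\mathcal{P}^{\rm dec}_{\bar A}P=\mathcal{P}_{\bar A}P\times H\to\mathcal{P}M$ consider the connection form $$\hat\Omega_{(\bar\gamma,h)}(\bar v+X)=\mathrm{Ad}(h^{-1})\Big[\bar A\big(\bar v(t_0)\big)+\mathrm{Ad}\big(g^*(\bar\gamma)^{-1}\big)C^R|_{\bar\gamma(t_1)}\big(\bar v(t_1)\big)-C^L|_{\bar\gamma(t_0)}\big(\bar v(t_0)\big)+\int_{t_0}^{t_1}\mathrm{Ad}\big(g_{\bar\gamma}(t)^{-1}\big)B_{\bar\gamma(t)}\big(\bar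 v(t),\bar\gamma'(t)\big)\,dt+Xh^{-1}\Big]$$ for $\bar\gamma\in\mathcal{P}_{\bar A}P$, $h\in H$, $\bar v\in T_{\bar\gamma}\mathcal{P}_{\bar A}P$, $X\in T_hH$. Suppose that $$C^L_1=C^R_1=-C_1,\qquad B_1=-\Big(dC_1+\tfrac12[C_1,C_1]\Big).$$ Then parallel transport by $\hat\Omega$ carries elements of the form $\big(\bar\gamma,h^*(\bar\gamma)^{-1}\big)$ to elements of the same form: if $[s_0,s_1]\to\mathcal{P}^{\rm dec}_{\bar A}P$, $s\mapsto(\hat\Gamma_s,x_s)$, is an $\hat\Omega$-horizontal path with $x_{s_0}=h^*(\hat\Gamma_{s_0})^{-1}$, then $x_s=h^*(\hat\Gamma_s)^{-1}$ for all $s\in[s_0,s_1]$.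
   Context: A Lie crossed module $(G,H,\alpha,\tau)$ consists of Lie groups $G,H$, a smooth homomorphism $\tau:H\to G$ and a homomorphism $\alpha:G\to\mathrm{Aut}(H)$ with $(g,h)\mapsto\alpha(g)(h)$ smooth, such that $\tau(\alpha(g)(h))=g\tau(h)g^{-1}$ and $\alpha(\tau(h))(h')=hh'h^{-1}$. The semidirect product $H\rtimes_\alpha G$ has product $(h_1,g_1)(h_2,g_2)=(h_1\alpha(g_1)(h_2),g_1g_2)$; $G$ and $H$ are identified with subgroups. $L(H\rtimes_\alpha G)=L(H)\oplus L(G)$ as a vector space, and $\mathrm{Ad}$ denotes the adjoint action of $H\rtimes_\alpha G$ on it; $\mathrm{Ad}(g)$ for $g\in G$ restricts to $d\alpha(g)|_e$ on $L(H)$. For $v\in T_pP$ and $g\in G$, $vg\in T_{pg}P$ is the image of $v$ under the derivative of $p\mapsto pg$. A vector is vertical if $\pi_*$ maps it to $0$. A form $\Theta$ on $P$ of degree $k$ ($k=1,2$) with values in $L(G)$ or $L(H)$ is equivariant if $\Theta_{pg}(v_1g,\dots,v_kg)=\mathrm{Ad}(g^{-1})\Theta_p(v_1,\dots,v_k)$ for all $g\in G$, and horizontal if it is $0$ whenever one of its arguments is vertical. The $2$-form $[C_1,C_1]$ is given by $[C_1,C_1](v,w)=2[C_1(v),C_1(w)]$, and $dC_1(v,w)=v(C_1(w))-w(C_1(v))-C_1([v,w])$ for vector fields $v,w$. $\mathcal{P}M$ is the set of $C^\infty$ paths $[t_0,t_1]\to M$ constant near $t_0$ and near $t_1$, with paths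 differing by a time translation identified. $\mathcal{P}_{\bar A}P$ is the set of $C^\infty$ paths $\bar\gamma:[t_0,t_1]\to P$, constant near $t_0$ and $t_1$, with $\bar A(\bar\gamma'(t))=0$ for all $t$, with the same identification. $T_{\bar\gamma}\mathcal{P}_{\bar A}P$ is the vector space of $C^\infty$ vector fields $\bar v$ along $\bar\gamma$, constant near $t_0$ and $t_1$, with $\frac{\partial}{\partial t}\bar A(\bar v(t))=F^{\bar A}(\bar\gamma'(t),\bar v(t))$, where $F^{\bar A}$ is the curvature of $\bar A$. The projection is $(\bar\gamma,h)\mapsto\pi\circ\bar\gamma$, and $T_{(\bar\gamma,h)}\mathcal{P}^{\rm dec}_{\bar A}P=T_{\bar\gamma}\mathcal{P}_{\bar A}P\oplus T_hH$, with elements written $\bar v+X$; $Xh^{-1}\in L(H)$ is the right translate of $X\in T_hH$. A path $s\mapsto(\hat\Gamma_s,x_s)$ on $\mathcal{P}^{\rm dec}_{\bar A}P$ is given by a $C^\infty$ map $[t_0,t_1]\times[s_0,s_1]\to P$, $(t,s)\mapsto\hat\Gamma_s(t)$, with each $\hat\Gamma_s\in\mathcal{P}_{\bar A}P$, and a $C^\infty$ map $s\mapsto x_s\in H$; it is assumed that for $\Gamma_s=\pi\circ\hat\Gamma_s$ there is $\epsilon>0$ such that for each $s$ the point $\Gamma_s(t)$ is constant for $t$ within $\epsilon$ of $t_0$, and for $t$ within $\epsilon$ of $t_1$, and for each $t$ it is constant for $s$ within $\epsilon$ of $s_0$, and for $s$ within $\epsilon$ of $s_1$. It is $\hat\Omega$-horizontal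 if $\hat\Omega$ vanishes on its tangent vector $\partial_s\hat\Gamma_s+\dot x_s$ for every $s$, where $\partial_s\hat\Gamma_s$ is the vector field $t\mapsto\partial_s\hat\Gamma_s(t)$ along $\hat\Gamma_s$. Parallel transport by $\hat\Omega$ along $s\mapsto\Gamma_s$ sends $(\hat\Gamma_{s_0},x_{s_0})$ to $(\hat\Gamma_s,x_s)$ along such a horizontal path lying over $s\mapsto\Gamma_s$. *)

(* Defs.v *)
From HB Require Import structures.
From mathcomp Require Import all_boot all_order all_algebra.
From mathcomp Require Import all_classical all_reals all_analysis.

Set Implicit Arguments.
Unset Strict Implicit.
Unset Printing Implicit Defensive.

Import Order.TTheory GRing.Theory Num.Theory.
Import numFieldNormedType.Exports.

Local Open Scope classical_set_scope.
Local Open Scope ring_scope.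

(* C^k on the open set U; the clause for k.+1 is the usual one (all directional
   derivatives are C^k) because the spaces used below are finite-dimensional. *)
Fixpoint Ck (R : realType) (E F : normedModType R) (k : nat) (U : set E)
    (f : E -> F) : Prop :=
  match k with
  | 0 => forall x, U x -> {for x, continuous f}
  | k'.+1 => (forall x, U x -> differentiable f x) /\
             (forall v : E, Ck k' U (fun x => 'D_v f x))
  end.

Definition Cinf (R : realType) (E F : normedModType R) (U : set E)
    (f : E -> F) : Prop := forall k, Ck k U f.

(* The data of a space with an atlas: dom p, chart p and chartV p are the domain,
   the chart and its inverse for a chart chosen around p, and the atlas consists
   of these charts.  The tangent space at p is the model space E: the vector
   v : E stands for the tangent vector at p whose coordinates in the chart
   chosen at p are v.  So a vector field is a function point -> E, whose value
   at x is to be read in the chart chosen at x. *)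
Record charted (R : realType) (E : normedModType R) := Charted {
  point :> topologicalType;
  dom : point -> set point;
  chart : point -> point -> E;
  chartV : point -> E -> point
}.

Definition vect (R : realType) (E : normedModType R) : charted E :=
  @Charted R E E (fun _ => setT) (fun _ => id) (fun _ => id).

Definition prod_charted (R : realType) (E F : normedModType R)
    (M : charted E) (N : charted F) : charted (E * F)%type :=
  @Charted R (E * F)%type (M * N)%type
    (fun p => dom p.1 `*` dom p.2)
    (fun p x => (chart p.1 x.1, chart p.2 x.2))
    (fun p y => (chartV p.1 y.1, chartV p.2 y.2)).

Section Maps.
Context {R : realType} {E F : normedModType R}.

Definition in_coord (M : charted E) (N : charted F) (f : M -> N) (p : M) (q : N)
    : E -> F := fun y => chart q (f (chartV p y)).

Definition smooth_at (M : charted E) (N : charted F) (f : M -> N) (p : M) :=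
  {for p, continuous f} /\
  exists2 W : set E, open_nbhs (chart p p) W & Cinf W (in_coord f p (f p)).

Definition smooth_on (M : charted E) (N : charted F) (U : set M) (f : M -> N) :=
  forall p, U p -> smooth_at f p.

(* Smoothness on an arbitrary (e.g. closed) subset: f is a smooth extension of
   its restriction to A to an open neighbourhood of A.  Below, A is an interval
   or a rectangle with nonempty interior, so that the derivatives at points of
   A depend only on the restriction of f to A. *)
Definition smooth_near (M : charted E) (N : charted F) (A : set M) (f : M -> N) :=
  exists2 U : set M, open U /\ A `<=` U & smooth_on U f.

(* The derivative T_p M -> T_(f p) N. *)
Definition mderiv (M : charted E) (N : charted F) (f : M -> N) (p : M) (v : E)
    : F := 'd (in_coord f p (f p)) (chart p p) v.

End Maps.

Arguments smooth_at {R E F} M N f p.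
Arguments smooth_on {R E F} M N U f.
Arguments smooth_near {R E F} M N A f.
Arguments mderiv {R E F} M N f p v.

Definition velocity (R : realType) (E : normedModType R) (M : charted E)
    (c : R -> M) (t : R) : E := mderiv (vect R^o) M c t 1.

Record is_manifold (R : realType) (E : normedModType R) (M : charted E) : Prop := {
  mfd_hausdorff : hausdorff_space M;
  mfd_countable : @second_countable M;
  mfd_dom : forall p : M, open_nbhs p (dom p);
  mfd_img : forall p : M, open (chart p @` dom p);
  mfd_chartK : forall p x : M, dom p x -> chartV p (chart p x) = x;
  mfd_chart_cont : forall p x : M, dom p x -> {for x, continuous (chart p)};
  mfd_chartV_cont : forall (p : M) (y : E),
    (chart p @` dom p) y -> {for y, continuous (chartV p)};
  mfd_transition : forall p q : M,
    Cinf (chart p @` (dom p `&` dom q)) (fun y => chart q (chartV p y))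
}.

Record manifold (R : realType) (n : nat) := Manifold {
  mfd_charted :> charted 'rV[R]_n;
  mfd_axioms : is_manifold mfd_charted
}.

Section Fields.
Context {R : realType} {E V : normedModType R} (M : charted E).

(* The vector field v in the chart at p. *)
Definition field_coord (v : M -> E) (p : M) : E -> E :=
  fun y => mderiv M (vect E) (chart p) (chartV p y) (v (chartV p y)).

Definition smooth_field (U : set M) (v : M -> E) :=
  forall p, U p ->
  exists2 W : set E, open_nbhs (chart p p) W & Cinf W (field_coord v p).

Definition vbracket (v w : M -> E) (p : M) : E :=
  'd (field_coord w p) (chart p p) (v p) - 'd (field_coord v p) (chart p p) (w p).

(* A tangent vector at the point with coordinates y in the chart at p, with
   coordinates u in that chart. *)
Definition coord_vec (p : M) (y u : E) : E := mderiv (vect E) M (chartV p) y u.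

Record form1 (T : M -> E -> V) : Prop := {
  form1_linear : forall p, linear (T p);
  form1_smooth : forall p u,
    Cinf (chart p @` dom p) (fun y => T (chartV p y) (coord_vec p y u))
}.

Record form2 (T : M -> E -> E -> V) : Prop := {
  form2_linearl : forall p v, linear (fun u => T p u v);
  form2_linearr : forall p u, linear (T p u);
  form2_alt : forall p u, T p u u = 0;
  form2_smooth : forall p u v,
    Cinf (chart p @` dom p)
         (fun y => T (chartV p y) (coord_vec p y u) (coord_vec p y v))
}.

(* The function dT(v, w) for vector fields v and w. *)
Definition ext_deriv (T : M -> E -> V) (v w : M -> E) (p : M) : V :=
  mderiv M (vect V) (fun x => T x (w x)) p (v p)
  - mderiv M (vect V) (fun x => T x (v x)) p (w p)
  - T p (vbracket v w p).

End Fields.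

Record is_lie_group (R : realType) (n : nat) (G : manifold R n)
    (e : G) (mul : G -> G -> G) (inv : G -> G) : Prop := {
  lg_mulA : associative mul;
  lg_mul1 : left_id e mul;
  lg_mulr1 : right_id e mul;
  lg_mulV : left_inverse e inv mul;
  lg_mulrV : right_inverse e inv mul;
  lg_mul_smooth :
    smooth_on (prod_charted G G) G setT (fun x => mul x.1 x.2);
  lg_inv_smooth : smooth_on G G setT inv
}.

Record lie_group (R : realType) (n : nat) := LieGroup {
  lg_mfd :> manifold R n;
  lg1 : lg_mfd;
  lgM : lg_mfd -> lg_mfd -> lg_mfd;
  lgV : lg_mfd -> lg_mfd;
  lg_axioms : is_lie_group lg1 lgM lgV
}.

Arguments lg1 {R n} l.
Arguments lgM {R n l}.
Arguments lgV {R n l}.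

Section LieGroups.
Context {R : realType} {n : nat} (G : lie_group R n).

Definition Ad (g : G) (X : 'rV[R]_n) : 'rV[R]_n :=
  mderiv G G (fun x => lgM (lgM g x) (lgV g)) (lg1 G) X.

Definition left_field (X : 'rV[R]_n) (g : G) : 'rV[R]_n :=
  mderiv G G (lgM g) (lg1 G) X.

Definition lie_bracket (X Y : 'rV[R]_n) : 'rV[R]_n :=
  vbracket (left_field X) (left_field Y) (lg1 G).

(* X g^-1 for X in T_g G. *)
Definition rtranslate (g : G) (X : 'rV[R]_n) : 'rV[R]_n :=
  mderiv G G (fun x => lgM x (lgV g)) g X.

(* The 2-form [C, C]. *)
Definition form_bracket (E : normedModType R) (M : charted E)
    (C : M -> E -> 'rV[R]_n) (p : M) (v w : E) : 'rV[R]_n :=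
  2 *: lie_bracket (C p v) (C p w).

End LieGroups.

Record crossed_module (R : realType) (nG nH : nat) (G : lie_group R nG)
    (H : lie_group R nH) (alpha : G -> H -> H) (tau : H -> G) : Prop := {
  cm_tau_smooth : smooth_on H G setT tau;
  cm_tauM : {morph tau : h h' / lgM h h' >-> lgM h h'};
  cm_alpha_morph : forall g, {morph alpha g : h h' / lgM h h'};
  cm_alpha1 : forall h, alpha (lg1 G) h = h;
  cm_alphaM : forall g g' h, alpha (lgM g g') h = alpha g (alpha g' h);
  cm_alpha_smooth :
    smooth_on (prod_charted G H) H setT (fun x => alpha x.1 x.2);
  cm_equivariant : forall g h, tau (alpha g h) = lgM (lgM g (tau h)) (lgV g);
  cm_peiffer : forall h h', alpha (tau h) h' = lgM (lgM h h') (lgV h)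
}.

Section Semidirect.
Context {R : realType} {nG nH : nat} {G : lie_group R nG} {H : lie_group R nH}.
Variable alpha : G -> H -> H.

Definition sd_mul (a b : H * G) : H * G :=
  (lgM a.1 (alpha a.2 b.1), lgM a.2 b.2).

Definition sd_inv (a : H * G) : H * G :=
  (alpha (lgV a.2) (lgV a.1), lgV a.2).

Definition inG (g : G) : H * G := (lg1 H, g).
Definition inH (h : H) : H * G := (h, lg1 G).

(* The semidirect product is H * G as a manifold, so its Lie algebra is
   L(H) (+) L(G), with the component in L(H) first. *)
Definition sd_Ad (k : H * G) (Z : 'rV[R]_nH * 'rV[R]_nG) : 'rV[R]_nH * 'rV[R]_nG :=
  mderiv (prod_charted H G) (prod_charted H G)
    (fun x : H * G => sd_mul (sd_mul k x) (sd_inv k)) (lg1 H, lg1 G) Z.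

Definition dalpha (g : G) (X : 'rV[R]_nH) : 'rV[R]_nH :=
  mderiv H H (alpha g) (lg1 H) X.

End Semidirect.

Record principal_bundle (R : realType) (nG nP nM : nat) (G : lie_group R nG)
    (P : manifold R nP) (M : manifold R nM) (pi : P -> M) (act : P -> G -> P)
    : Prop := {
  pb_pi_smooth : smooth_on P M setT pi;
  pb_act_smooth : smooth_on (prod_charted P G) P setT (fun x => act x.1 x.2);
  pb_act1 : forall p, act p (lg1 G) = p;
  pb_actM : forall p g g', act p (lgM g g') = act (act p g) g';
  pb_pi_act : forall p g, pi (act p g) = pi p;
  (* phi : U x G -> pi^-1(U) is an equivariant diffeomorphism over U, with
     inverse p |-> (pi p, chi p). *)
  pb_triv : forall m : M, exists (U : set M) (phi : M * G -> P) (chi : P -> G),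
    [/\ open_nbhs m U,
        smooth_on (prod_charted M G) P (U `*` setT) phi,
        smooth_on P G (pi @^-1` U) chi,
        forall p, U (pi p) -> phi (pi p, chi p) = p &
        forall x g, U x ->
          [/\ pi (phi (x, g)) = x, chi (phi (x, g)) = g &
              forall g', phi (x, lgM g g') = act (phi (x, g)) g']]
}.

Section BundleForms.
Context {R : realType} {nG nP nM : nat} {G : lie_group R nG}.
Context {P : manifold R nP} {M : manifold R nM}.
Variables (pi : P -> M) (act : P -> G -> P).

Definition vertical (p : P) (v : 'rV[R]_nP) := mderiv P M pi p v = 0.

(* The vector v g at act p g. *)
Definition vact (p : P) (v : 'rV[R]_nP) (g : G) : 'rV[R]_nP :=
  mderiv P P (act ^~ g) p v.

Definition equivariant1 (V : Type) (rho : G -> V -> V) (T : P -> 'rV[R]_nP -> V) :=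
  forall p g v, T (act p g) (vact p v g) = rho (lgV g) (T p v).

Definition equivariant2 (V : Type) (rho : G -> V -> V)
    (T : P -> 'rV[R]_nP -> 'rV[R]_nP -> V) :=
  forall p g v w, T (act p g) (vact p v g) (vact p w g) = rho (lgV g) (T p v w).

Definition horizontal1 (V : nmodType) (T : P -> 'rV[R]_nP -> V) :=
  forall p v, vertical p v -> T p v = 0.

Definition horizontal2 (V : nmodType) (T : P -> 'rV[R]_nP -> 'rV[R]_nP -> V) :=
  forall p v w, vertical p v \/ vertical p w -> T p v w = 0.

Record connection (A : P -> 'rV[R]_nP -> 'rV[R]_nG) : Prop := {
  conn_form : form1 A;
  conn_equivariant : equivariant1 (@Ad R nG G) A;
  conn_vertical : forall p (X : 'rV[R]_nG),
    A p (mderiv G P (act p) (lg1 G) X) = X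
}.

End BundleForms.

Definition const_ends (R : realType) (T : Type) (eps a b : R) (c : R -> T) :=
  forall t, a <= t <= b ->
    (t - a <= eps -> c t = c a) /\ (b - t <= eps -> c t = c b).

(* c represents an element of the space of A-horizontal paths; only its
   restriction to [t0, t1] matters. *)
Definition horizontal_path (R : realType) (nG nP : nat) (P : manifold R nP)
    (A : P -> 'rV[R]_nP -> 'rV[R]_nG) (t0 t1 : R) (c : R -> P) : Prop :=
  [/\ smooth_near (vect R^o) P `[t0, t1] c,
      exists2 eps, 0 < eps & const_ends eps t0 t1 c &
      forall t, t0 <= t <= t1 -> A (c t) (velocity c t) = 0].

(* h is the solution h_c on [t0, t1]. *)
Definition is_h_solution (R : realType) (nH nP : nat) (H : lie_group R nH)
    (P : manifold R nP) (C1 : P -> 'rV[R]_nP -> 'rV[R]_nH) (t0 t1 : R)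
    (c : R -> P) (h : R -> H) : Prop :=
  [/\ smooth_near (vect R^o) H `[t0, t1] h,
      h t0 = lg1 H &
      forall t, t0 <= t <= t1 ->
        rtranslate (h t) (velocity h t) = - C1 (c t) (velocity c t)].

(* Gam t s and x s are the maps (t, s) |-> \hat\Gamma_s(t) and s |-> x_s. *)
Record dec_path (R : realType) (nG nH nP nM : nat) (H : lie_group R nH)
    (P : manifold R nP) (M : manifold R nM) (pi : P -> M)
    (A : P -> 'rV[R]_nP -> 'rV[R]_nG) (t0 t1 s0 s1 : R)
    (Gam : R -> R -> P) (x : R -> H) : Prop := {
  dp_smooth : smooth_near (prod_charted (vect R^o) (vect R^o)) P
    (`[t0, t1] `*` `[s0, s1]) (fun ts => Gam ts.1 ts.2);
  dp_horizontal : forall s, s0 <= s <= s1 ->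
    horizontal_path A t0 t1 (fun t => Gam t s);
  dp_x_smooth : smooth_near (vect R^o) H `[s0, s1] x;
  dp_const : exists2 eps, 0 < eps &
    (forall s, s0 <= s <= s1 -> const_ends eps t0 t1 (fun t => pi (Gam t s))) /\
    (forall t, t0 <= t <= t1 -> const_ends eps s0 s1 (fun s => pi (Gam t s)))
}.

Definition pair_integral (R : realType) (m n : nat) (a b : R)
    (f : R -> 'rV[R]_m * 'rV[R]_n) : 'rV[R]_m * 'rV[R]_n :=
  (\row_i \int[@lebesgue_measure R]_(t in `[a, b]) (f t).1 ord0 i,
   \row_i \int[@lebesgue_measure R]_(t in `[a, b]) (f t).2 ord0 i).

(* The connection form on the decorated bundle at (c, h), evaluated on v + X;
   hsol is the function h_c on [t0, t1]. *)
Definition Omega (R : realType) (nG nH nP : nat) (G : lie_group R nG)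
    (H : lie_group R nH) (alpha : G -> H -> H) (tau : H -> G)
    (P : manifold R nP) (A : P -> 'rV[R]_nP -> 'rV[R]_nG)
    (CL CR : P -> 'rV[R]_nP -> 'rV[R]_nH * 'rV[R]_nG)
    (B : P -> 'rV[R]_nP -> 'rV[R]_nP -> 'rV[R]_nH * 'rV[R]_nG)
    (t0 t1 : R) (hsol : R -> H)
    (c : R -> P) (h : H) (v : R -> 'rV[R]_nP) (X : 'rV[R]_nH)
    : 'rV[R]_nH * 'rV[R]_nG :=
  let g t := tau (hsol t) in
  sd_Ad alpha (inH (lgV h))
    ((0, A (c t0) (v t0))
     + sd_Ad alpha (inG (lgV (g t1))) (CR (c t1) (v t1))
     - CL (c t0) (v t0)
     + pair_integral t0 t1 (fun t =>
         sd_Ad alpha (inG (lgV (g t))) (B (c t) (v t) (velocity c t)))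
     + (rtranslate h X, 0)).

(* Main.v *)
(* Write [X(t,s) = - C1 (d_t Gam)], so that the curve [h_s = h_(Gam_s)] has right
   logarithmic derivative [X(.,s)].  For fixed [s] the curve
   [k_d = h_s^-1 h_(s+d)] starts at [e] and has logarithmic derivative
   [Ad(h_s^-1) (X(.,s+d) - X(.,s))], which is [O(d)] uniformly in [t].  Hence [k_d]
   stays in the chart at [e], and in that chart [k_d(t1) = e + d J(t1) + o(d)] where
   [J' = Ad(h_s^-1) d_s X] and [J(t0) = 0]; no theorem on the dependence of
   solutions of differential equations on parameters is needed.

   Since [(Ad(h_s^-1) Z)' = Ad(h_s^-1) (Z' - [X, Z])], taking [Z = C1 (d_s Gam)] gives
   [Ad(h_s^-1) d_s X = Ad(h_s^-1) B1(d_s Gam, d_t Gam) - (Ad(h_s^-1) Z)'], because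
   [B1] is minus the curvature of [C1].  So the L(H)-component of the equation
   [Omega = 0] says exactly that [x' x^-1 = - J(t1)].  The logarithmic derivatives of
   [h_s(t1)] on the left and of [x_s] on the right thus cancel in the product
   [h_s(t1) x_s], which is constant, hence equal to its initial value [e]. *)

Require Import Defs.
From HB Require Import structures.
From mathcomp Require Import all_boot all_order all_algebra.
From mathcomp Require Import all_classical all_reals all_analysis.
From mathcomp Require Import ring lra.
Import Order.TTheory GRing.Theory Num.Theory.
Import numFieldNormedType.Exports.

Set Implicit Arguments.
Unset Strict Implicit.
Unset Printing Implicit Defensive.

Local Open Scope classical_set_scope.
Local Open Scope ring_scope.

(** * Differential calculus *)

(** Tangent vectors at [p] are read in the chart chosen at [p], and that choice need not vary
    continuously with [p], so the velocity of a curve cannot simply be differentiated. Two devices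
    restore a fixed chart. In a group, [h r (h t)^-1] passes through the unit at [r = t], so
    logarithmic derivatives live in the chart at [e], where multiplication is the map [mulc]. On
    [P], the values of [C1] on [d_t Gam] and [d_s Gam] do not depend on charts, and become smooth
    functions of [(t, s)] once expanded in one chart near a given point.

    The condition [Omega = 0] lives in the semidirect product. Conjugation by an element of [H]
    preserves the [L(G)] component, so the outer [Ad(h^-1)] can be cancelled and the [L(H)]
    component read off; there the Peiffer identity turns the action of [tau(h)^-1] into the adjoint
    action of [h^-1] in [H] itself.

    The curves [h_s] are known only for [s] in [[s0, s1]], which leaves no two-sided derivative in
    [s] at the ends. Differentiation of [h_s(t1)] and of [h_s(t1) x_s] is therefore expressed by a
    curve [K] near [0], tied to the data only when [s + d] lies in the interval. *)

Section Differential.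
Context {R : realType}.
Implicit Types E F : normedModType R.

(** Coordinate expressions agree with the intended formula only near the base point, where [chartV]
    undoes [chart]; most differentials below are transported through such a local equality. *)
Lemma near_is_diff E F (f g : E -> F) (x : E) (df : E -> F) :
  (\near x, f x = g x) -> is_diff x f df -> is_diff x g df.
Proof.
move=> fg dfx; have fgx := nbhs_singleton fg.
have df0 : differentiable f x := @ex_diff _ _ _ _ _ _ _ dfx.
have H : g \o shift x = cst (g x) + 'd f x +o_ 0 id.
  apply/eqaddoP => e e0.
  have /eqaddoP /(_ e e0) := diff_locally df0.
  have fg' : \forall h \near (0 : E), f (h + x) = g (h + x).
    by have := fg; rewrite (near_shift (0 : E)) subr0.
  apply: filter_app; near=> h.
  by rewrite !fctE/= fgx (near fg').
have cd : continuous ('d f x) by apply: diff_continuous.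
have eqd : 'd g x = 'd f x :> (E -> F) by exact: diff_unique.
split; last by rewrite eqd; exact: diff_val.
by apply/diff_locallyP; rewrite eqd; split.
Unshelve. all: by end_near. Qed.

Lemma near_differentiable E F (f g : E -> F) (x : E) :
  (\near x, f x = g x) -> differentiable f x -> differentiable g x.
Proof.
by move=> fg df; have [] := near_is_diff fg (differentiableP df).
Qed.

Lemma near_diff E F (f g : E -> F) (x : E) :
  (\near x, f x = g x) -> differentiable f x -> 'd g x = 'd f x :> (E -> F).
Proof.
by move=> fg df; have [] := near_is_diff fg (differentiableP df).
Qed.

Lemma is_diff_lin_comp E F (F' : normedModType R) (l : {linear F -> F'})
    (f df : E -> F) (x : E) :
  continuous l -> is_diff x f df -> is_diff x (l \o f) (l \o df).
Proof.
move=> cl dfx; apply: is_diff_comp.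
by apply: DiffDef; [exact: linear_differentiable|rewrite diff_lin].
Qed.

Lemma scale_is_bilinear F :
  bilinear_for
    (GRing.Scale.Law.clone _ _ *:%R _) (GRing.Scale.Law.clone _ _ *:%R _)
    (fun (a : R^o) (u : F) => a *: u).
Proof.
split=> [u'|u] a x y /=.
- by rewrite scalerDl scalerA.
- by rewrite scalerDr !scalerA mulrC.
Qed.

Lemma is_diff_scale E F (a da : E -> R^o) (f df : E -> F) (x : E) :
  is_diff x a da -> is_diff x f df ->
  is_diff x (fun y => a y *: f y) (fun v => a x *: df v + da v *: f x).
Proof.
move=> dax dfx.
pose bM := bilinear_isBilinear.Build R _ _ F _ _ _ (scale_is_bilinear F).
pose B : {bilinear R^o -> F -> F} := HB.pack (fun (a : R^o) (u : F) => a *: u) bM.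
have cB : continuous (fun p : R^o * F => B p.1 p.2) by exact: scale_continuous.
have dB (p : R^o * F) : is_diff p (fun p : R^o * F => B p.1 p.2)
    (fun q => B p.1 q.2 + B q.1 p.2).
  by apply: DiffDef; [exact: differentiable_bilin|rewrite diff_bilin].
have := is_diff_comp (is_diff_pair dax dfx) (dB _).
by [].
Qed.

End Differential.

(** * Calculus of C^k maps on open sets *)

Section CkTheory.
Context {R : realType}.
Implicit Types E F : normedModType R.

Lemma is_diff_derive E F (f df : E -> F) (x v : E) :
  is_diff x f df -> 'D_v f x = df v.
Proof. by move=> [dfx <-]; rewrite deriveE. Qed.

Lemma Ck_sub E F k (U V : set E) (f : E -> F) :
  V `<=` U -> Ck k U f -> Ck k V f.
Proof.
move=> VU; elim: k f => [|k IH] f /=; first by move=> cf x /VU; exact: cf.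
by move=> [df Df]; split=> [x /VU|v]; [exact: df|exact: IH].
Qed.

Lemma Ck_ext E F k (U : set E) (f g : E -> F) :
  open U -> {in U, f =1 g} -> Ck k U f -> Ck k U g.
Proof.
move=> oU; elim: k f g => [|k IH] f g fg /=.
  move=> cf x Ux; have fgx : \near x, f x = g x.
    by apply: filterS (open_nbhs_nbhs (conj oU Ux)) => y Uy; apply/fg/mem_set.
  have := cf x Ux; rewrite /prop_for /continuous_at (nbhs_singleton fgx).
  by apply: cvg_trans; exact: near_eq_cvg.
have nfg x : U x -> \near x, f x = g x.
  by move=> Ux; apply: filterS (open_nbhs_nbhs (conj oU Ux)) => y Uy; apply/fg/mem_set.
move=> [df Df]; split=> [x Ux|v].
  by apply: near_differentiable (df _ Ux); exact: nfg.
apply: IH (Df v) => x /set_mem Ux.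
by apply: near_eq_derive; exact: nfg.
Qed.

Lemma Ck_local E F k (U : set E) (f : E -> F) :
  (forall x, U x -> exists2 W, open_nbhs x W & Ck k W f) -> Ck k U f.
Proof.
elim: k f => [|k IH] f /= H.
  by move=> x /H[W [_ Wx]]; apply.
split=> [x /H[W [_ Wx]] [+ _]|v]; first exact.
by apply: IH => x /H[W ? [_ ?]]; exists W.
Qed.

Lemma CkW E F k (U : set E) (f : E -> F) : Ck k.+1 U f -> Ck k U f.
Proof.
elim: k f => [|k IH] f; last by move=> [df Df]; split => // v; exact: IH.
by move=> [df _] x /df; exact: differentiable_continuous.
Qed.

Lemma Ck_derive E F k (U : set E) (f : E -> F) v : Ck k.+1 U f ->
  Ck k U (fun x => 'D_v f x).
Proof. by move=> [_ +]; exact. Qed.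

Lemma Ck_diff E F k (U : set E) (f : E -> F) x : Ck k.+1 U f -> U x ->
  differentiable f x.
Proof. by move=> [+ _]; exact. Qed.

Lemma Ck_cont E F k (U : set E) (f : E -> F) x : Ck k U f -> U x ->
  {for x, continuous f}.
Proof.
move=> Hf Ux; elim: k Hf => [Hf|k IH /CkW]; [exact: (Hf _ Ux)|exact: IH].
Qed.

Lemma Ck_cst E F k (U : set E) (a : F) : Ck k U (fun _ => a).
Proof.
elim: k a => [|k IH] a /=; first by move=> x _; exact: cst_continuous.
split=> [x _|v]; first exact: differentiable_cst.
suff -> : (fun x : E => 'D_v (fun=> a) x) = (fun=> 0) by [].
by apply/funext => x; exact: derive_cst.
Qed.

Lemma Ck_lin E F k (U : set E) (l : {linear E -> F}) :
  continuous l -> Ck k U l.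
Proof.
move=> cl; case: k => [|k] /=; first by move=> x _; exact: cl.
split=> [x _|v]; first exact: linear_differentiable.
suff -> : (fun x : E => 'D_v l x) = (fun=> l v) by exact: Ck_cst.
by apply/funext => x; rewrite deriveE ?diff_lin//; exact: linear_differentiable.
Qed.

Lemma Ck_id E k (U : set E) : Ck k U id.
Proof. by apply: (@Ck_lin _ _ _ _ idfun) => x; exact: cvg_id. Qed.

Lemma Ck_lin_comp E F (F' : normedModType R) k (U : set E) (f : E -> F)
    (l : {linear F -> F'}) :
  open U -> continuous l -> Ck k U f -> Ck k U (fun x => l (f x)).
Proof.
move=> oU cl; elim: k f => [|k IH] f /=.
  by move=> cf x Ux; apply: continuous_comp; [exact: cf|exact: cl].
move=> [df Df].
have dlf x : U x -> is_diff x (l \o f) (l \o 'd f x).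
  by move=> Ux; apply: is_diff_lin_comp => //; apply: differentiableP; exact: df.
split=> [x Ux|v]; first exact: (@ex_diff _ _ _ _ _ _ _ (dlf x Ux)).
apply: Ck_ext oU _ (IH _ (Df v)) => x /set_mem Ux.
by rewrite (is_diff_derive v (dlf x Ux)) /= deriveE//; exact: df.
Qed.

Lemma Ck_add E F k (U : set E) (f g : E -> F) :
  open U -> Ck k U f -> Ck k U g -> Ck k U (fun x => f x + g x).
Proof.
move=> oU; elim: k f g => [|k IH] f g /=.
  by move=> cf cg x Ux; apply: continuousD; [exact: cf|exact: cg].
move=> [df Df] [dg Dg]; split=> [x Ux|v].
  by apply: differentiableD; [exact: df|exact: dg].
apply: Ck_ext oU _ (IH _ _ (Df v) (Dg v)) => x /set_mem Ux.
by rewrite deriveD//; apply: diff_derivable; [exact: df|exact: dg].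
Qed.

Lemma Ck_sum E F (I : Type) (r : seq I) (p : pred I) k (U : set E)
    (f : I -> E -> F) :
  open U -> (forall i, Ck k U (f i)) -> Ck k U (fun x => \sum_(i <- r | p i) f i x).
Proof.
move=> oU Hf; elim: r => [|i r IH].
  suff -> : (fun x : E => \sum_(i <- [::] | p i) f i x) = (fun=> 0) by exact: Ck_cst.
  by apply/funext => x; rewrite big_nil.
have -> : (fun x : E => \sum_(i <- i :: r | p i) f i x) =
    (fun x => if p i then f i x + \sum_(i <- r | p i) f i x
              else \sum_(i <- r | p i) f i x).
  by apply/funext => x; rewrite big_cons.
by case: (p i) => //; exact: Ck_add.
Qed.

Lemma Ck_scale E F k (U : set E) (a : E -> R^o) (f : E -> F) :
  open U -> Ck k U a -> Ck k U f -> Ck k U (fun x => a x *: f x).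
Proof.
move=> oU; elim: k a f => [|k IH] a f.
  by move=> ca cf x Ux; apply: continuousZ; [exact: ca|exact: cf].
move=> Ha Hf; have [da Da] := Ha; have [df Df] := Hf.
have dd x : U x -> is_diff x (fun y => a y *: f y)
    (fun v => a x *: 'd f x v + 'd a x v *: f x).
  by move=> Ux; apply: is_diff_scale; apply: differentiableP; [exact: da|exact: df].
split=> [x Ux|v]; first exact: (@ex_diff _ _ _ _ _ _ _ (dd x Ux)).
have H : Ck k U (fun x => a x *: 'D_v f x + 'D_v a x *: f x).
  by apply: Ck_add => //; apply: IH; [exact: CkW|exact: Df|exact: Da|exact: CkW].
apply: Ck_ext oU _ H => x /set_mem Ux.
by rewrite (is_diff_derive v (dd x Ux)) (deriveE _ (da _ Ux)) (deriveE _ (df _ Ux)).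
Qed.

Lemma Ck_pair E F (F' : normedModType R) k (U : set E) (f : E -> F) (g : E -> F') :
  open U -> Ck k U f -> Ck k U g -> Ck k U (fun x => (f x, g x)).
Proof.
move=> oU; elim: k f g => [|k IH] f g /=.
  by move=> cf cg x Ux; apply: cvg_pair; [exact: (cf _ Ux)|exact: (cg _ Ux)].
move=> [df Df] [dg Dg]; split=> [x Ux|v].
  by apply: differentiable_pair; [exact: df|exact: dg].
apply: Ck_ext oU _ (IH _ _ (Df v) (Dg v)) => x /set_mem Ux.
have [dfx dgx] := (df _ Ux, dg _ Ux).
by rewrite [RHS]deriveE ?diff_pair ?deriveE//; exact: differentiable_pair.
Qed.

(** [Ck k.+1] controls derivatives in constant directions only, whereas the chain rule
    differentiates [f] in the moving direction ['D_v g x]. A finite spanning family with continuous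
    coordinates rewrites this as a sum over constant directions with variable coefficients. *)
Definition findim E := exists (I : finType) (e : I -> E) (l : I -> {linear E -> R^o}),
  (forall i, continuous (l i)) /\ forall y, y = \sum_i l i y *: e i.

Lemma Ck_comp E F (F' : normedModType R) k (U : set E) (V : set F)
    (g : E -> F) (f : F -> F') :
  findim F -> open U -> (forall x, U x -> V (g x)) ->
  Ck k U g -> Ck k V f -> Ck k U (fun x => f (g x)).
Proof.
move=> [I [e [l [cl le]]]] oU UV; elim: k f => [|k IH] f.
  by move=> cg cf x Ux; apply: continuous_comp; [exact: cg|exact/cf/UV].
move=> Hg Hf; have [dg Dg] := Hg; have [df Df] := Hf.
split=> [x Ux|v].
  by apply: (@differentiable_comp _ _ _ _ g f); [exact: dg|exact/df/UV].
have H : Ck k U (fun x => \sum_i l i ('D_v g x) *: 'D_(e i) f (g x)).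
  apply: Ck_sum => // i; apply: Ck_scale => //.
    by apply: Ck_lin_comp => //; exact: Dg.
  by apply: (IH (fun y => 'D_(e i) f y)); [exact: CkW|exact: Df].
apply: Ck_ext oU _ H => x /set_mem Ux.
have [dgx dfx] := (dg _ Ux, df _ (UV _ Ux)).
rewrite [RHS]deriveE; last exact: (@differentiable_comp _ _ _ _ g f).
rewrite (@diff_comp _ _ _ _ g f)//= -(deriveE v dgx) [in RHS](le ('D_v g x)).
by rewrite linear_sum; apply: eq_bigr => i _; rewrite linearZ /= (deriveE _ dfx).
Qed.

Lemma rV_coord_linear n (i : 'I_n) : linear (fun y : 'rV[R]_n => y ord0 i : R^o).
Proof. by move=> a u v; rewrite !mxE. Qed.

Definition rV_coord n (i : 'I_n) : {linear 'rV[R]_n -> R^o} :=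
  HB.pack (fun y : 'rV[R]_n => y ord0 i : R^o)
    (GRing.isLinear.Build _ _ _ _ _ (rV_coord_linear i)).

Lemma rV_coord_continuous n (i : 'I_n) : continuous (rV_coord i : 'rV[R]_n -> R^o).
Proof. exact: coord_continuous. Qed.

Lemma findim_rV n : findim 'rV[R]_n.
Proof.
exists 'I_n, (delta_mx ord0), (@rV_coord n); split=> [i|y].
  exact: rV_coord_continuous.
exact: row_sum_delta.
Qed.

Lemma findim_scalar : findim (R^o : normedModType R).
Proof.
exists unit, (fun=> 1), (fun=> idfun); split=> [_ x|y]; first exact: cvg_id.
by rewrite (big_pred1 tt) //= ?[_ *: _]mulr1//; case.
Qed.

Lemma findim_prod E F : findim E -> findim F -> findim (E * F)%type.
Proof.
move=> [I [e [l [cl le]]]] [J [e' [l' [cl' le']]]].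
pose L (k : I + J) (y : E * F) : R^o :=
  match k with inl i => l i y.1 | inr j => l' j y.2 end.
have lin k : linear (L k) by case: k => k a u v; rewrite /L linearP.
pose lk k : {linear (E * F)%type -> R^o} := HB.pack (L k)
  (GRing.isLinear.Build _ _ _ _ _ (lin k)).
exists (I + J)%type, (fun k => match k with inl i => (e i, 0) | inr j => (0, e' j) end), lk.
split=> [[k|k] x|y].
- by apply: (@continuous_comp _ _ _ fst (l k)); [exact: cvg_fst|exact: cl].
- by apply: (@continuous_comp _ _ _ snd (l' k)); [exact: cvg_snd|exact: cl'].
- rewrite big_sumType /=; apply: injective_projections; rewrite /=.
  + rewrite [LHS]le !(big_morph fst (id1 := 0) (op1 := +%R))//=.
    by rewrite [X in _ + X]big1 ?addr0// => j _; rewrite scaler0.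
  + rewrite [LHS]le' !(big_morph snd (id1 := 0) (op1 := +%R))//=.
    by rewrite [X in X + _]big1 ?add0r// => j _; rewrite scaler0.
Qed.

End CkTheory.

(** * Real induction and mean value inequalities *)

Section RealCurves.
Context {R : realType}.
Implicit Types E F : normedModType R.

(** The supremum of the times up to which [P] holds satisfies [P] by the first clause, and the
    second clause pushes beyond it unless it is [b]. At [t = a] the premise of the first clause is
    vacuous, which makes it the base case. *)
Lemma real_induction (a b : R) (P : R -> Prop) :
  (forall t, a <= t <= b -> (forall r, a <= r < t -> P r) -> P t) ->
  (forall t, a <= t < b -> (forall r, a <= r <= t -> P r) ->
     exists2 e, 0 < e & forall r, t < r < t + e -> r <= b -> P r) ->
  forall t, a <= t <= b -> P t.
Proof.
move=> Plim Pstep t /andP[at_ tb].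
pose S := [set r | a <= r <= b /\ forall q, a <= q <= r -> P q].
have Pa : P a.
  apply: Plim => [|r /andP[ar]]; first by rewrite lexx (le_trans at_).
  by rewrite ltNge ar.
have Sa : S a.
  split=> [|q /andP[aq qa]]; first by rewrite lexx (le_trans at_).
  by rewrite (_ : q = a)//; apply/eqP; rewrite eq_le aq qa.
have bS : has_sup S by split; [exists a|exists b => r [/andP[]]].
pose c := sup S.
have ac : a <= c by apply: ub_le_sup => //; exact: bS.2.
have cb : c <= b by apply: ge_sup; [exists a|move=> r [/andP[]]].
have Pc r : a <= r < c -> P r.
  move=> /andP[ar rc]; have [q [_ Sq] rq] : exists2 q, S q & r < q.
    have := @sup_adherent _ S (c - r); rewrite subr_gt0 => /(_ rc bS)[q Sq].
    by rewrite -/c opprB addrC subrK => ?; exists q.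
  by apply: Sq; rewrite ar ltW.
have Pcc : P c by apply: Plim => //; rewrite ac.
have [cb'|cb'] := ltP c b; last first.
  have [tc|ct] := ltP t c; first by apply: Pc; rewrite at_.
  by rewrite (_ : t = c)//; apply/eqP; rewrite eq_le ct (le_trans tb).
have Pc' r : a <= r <= c -> P r.
  by move=> /andP[ar]; rewrite le_eqVlt => /predU1P[->//|rc]; apply: Pc; rewrite ar.
have [e e0 Pe] := Pstep c (introT andP (conj ac cb')) Pc'.
pose d := Num.min (c + e / 2) b.
have cd : c < d by rewrite /d lt_min cb' andbT ltrDl divr_gt0.
have Sd : S d.
  split=> [|q /andP[aq qd]]; first by rewrite (le_trans ac (ltW cd)) /= ge_min lexx orbT.
  have [qc|cq] := leP q c; first by apply: Pc'; rewrite aq.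
  apply: Pe; last by apply: le_trans qd _; rewrite ge_min lexx orbT.
  rewrite cq /=; apply: le_lt_trans qd _; rewrite gt_min ltrD2l.
  by rewrite ltr_pdivrMr// ltr_pMr// ltr1n.
have : d <= c by apply: ub_le_sup => //; exact: bS.2.
by rewrite leNgt cd.
Qed.

(** Only increments that stay in [[a, b]] are compared, as befits curves known on a closed interval.
    Real induction on the bound at [t] steps back from a limit time in the first clause and forward
    in the second. *)
Lemma mean_value_le F (f : R -> F) (a b K : R) : a <= b ->
  (forall s, a <= s <= b -> forall e, 0 < e ->
     \forall d \near (0 : R), a <= s + d <= b ->
       `|f (s + d) - f s| <= (K + e) * `|d|) ->
  `|f b - f a| <= K * (b - a).
Proof.
move=> ab H; apply/ler_addgt0Pr => e e0.
(* The [+ 1] keeps the denominator positive when [a = b]. *)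
pose e' := e / (b - a + 1).
have ba : 0 < b - a + 1 by rewrite ltr_wpDl// subr_ge0.
have e'0 : 0 < e' by exact: divr_gt0.
suff P : forall t, a <= t <= b -> `|f t - f a| <= (K + e') * (t - a).
  have := P b; rewrite ab lexx => /(_ isT) /le_trans; apply.
  rewrite mulrDl lerD2l /e' mulrAC ler_pdivrMr// ler_pM2l//.
  by rewrite lerDl.
apply: real_induction => t /andP[at_ tb] IH.
  move: (at_); rewrite le_eqVlt => /predU1P[<-|at'].
    by rewrite !subrr normr0 mulr0.
  have /nbhs_ballP[r /= r0 Hr] := H t (introT andP (conj at_ tb)) _ e'0.
  pose d := Num.min (r / 2) (t - a).
  have d0 : 0 < d by rewrite lt_min divr_gt0 //= subr_gt0.
  have dr : d < r.
    by rewrite gt_min; apply/orP; left; rewrite ltr_pdivrMr// ltr_pMr// ltr1n.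
  have atd : a <= t - d by rewrite lerBrDr -lerBrDl ge_min lexx orbT.
  have := Hr (- d); rewrite /ball /= sub0r opprK gtr0_norm// => /(_ dr).
  rewrite normrN gtr0_norm// atd /= distrC => Hd.
  have tdt : t - d < t by rewrite ltrBlDr ltrDl.
  have {}Hd := Hd (le_trans (ltW tdt) tb).
  have {IH} := IH (t - d); rewrite atd tdt => /(_ isT) IH.
  have -> : f t - f a = (f t - f (t - d)) + (f (t - d) - f a) by rewrite subrKA.
  apply: le_trans (ler_normD _ _) _.
  have -> : (K + e') * (t - a) = (K + e') * d + (K + e') * (t - d - a).
    by ring.
  exact: lerD.
have tab : a <= t <= b by rewrite at_ ltW.
have /nbhs_ballP[r /= r0 Hr] := H t tab _ e'0.
exists r => // q /andP[tq qt] qb.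
have := Hr (q - t); rewrite /ball /= sub0r normrN gtr0_norm ?subr_gt0//.
rewrite ltrBlDl addrC => Hq; have {Hq} := Hq _; rewrite addrC qt => /(_ isT).
rewrite addrC subrK qb (le_trans at_ (ltW tq)) => /(_ isT) Hq.
have -> : f q - f a = (f q - f t) + (f t - f a) by rewrite subrKA.
apply: le_trans (ler_normD _ _) _.
have -> : (K + e') * (q - a) = (K + e') * (q - t) + (K + e') * (t - a).
  by rewrite -mulrDr subrKA.
by apply: lerD => //; apply: IH; rewrite at_ lexx.
Qed.

Lemma is_diff_is_derive F (f df : R -> F) (t : R) :
  is_diff t f df -> is_derive t 1 f (df 1).
Proof.
move=> [dfx <-]; apply: DeriveDef; first exact: diff_derivable.
exact: deriveE.
Qed.

Lemma is_derive_is_diff F (f : R -> F) (t : R) (X : F) :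
  is_derive t 1 f X -> is_diff t f (fun v => v *: X).
Proof.
move=> dfX; have df : differentiable f t by apply/derivable1_diffP; case: dfX.
split => //; apply/funext => v.
have -> : X = 'd f t 1 by rewrite -deriveE//; exact/esym/derive_val.
by rewrite -linearZ /= [_ *: 1]mulr1.
Qed.

Lemma is_derive_comp E F (f : R -> E) (g dg : E -> F) (t : R) (X : E) :
  is_derive t 1 f X -> is_diff (f t) g dg ->
  is_derive t 1 (fun r => g (f r)) (dg X).
Proof.
move=> /is_derive_is_diff df dg'.
by have := is_diff_is_derive (is_diff_comp df dg'); rewrite /= scale1r.
Qed.

Lemma is_derive_approx F (f : R -> F) (t : R) (X : F) (e : R) :
  is_derive t 1 f X -> 0 < e ->
  \forall d \near (0 : R), `|f (t + d) - f t - d *: X| <= e * `|d|.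
Proof.
move=> dfX e0; have [df dX] := is_derive_is_diff dfX.
have /eqaddoP /(_ e e0) := diff_locally df.
apply: filterS => d; rewrite !fctE /= [d + t]addrC opprD addrA => H.
by apply: le_trans H; rewrite dX.
Qed.

Lemma mean_value_le_derive F (f f' : R -> F) (a b K : R) : a <= b ->
  (forall s, a <= s <= b -> is_derive s 1 f (f' s)) ->
  (forall s, a <= s <= b -> `|f' s| <= K) ->
  `|f b - f a| <= K * (b - a).
Proof.
move=> ab df f'K; apply: mean_value_le => // s sab e e0.
apply: filterS (is_derive_approx (df s sab) e0) => d H _.
rewrite -(subrK (d *: f' s) (_ - _)) (le_trans (ler_normD _ _))//.
rewrite mulrDl addrC lerD// normrZ mulrC ler_wpM2r//.
exact: f'K.
Qed.

Lemma is_derive_line E F (f : E -> F) (x u : E) (a : R) :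
  differentiable f (x + a *: u) ->
  is_derive a 1 (fun b : R => f (x + b *: u)) ('D_u f (x + a *: u)).
Proof.
move=> df; pose g (b : R) := x + b *: u.
have dg : is_diff a g (fun b => b *: u).
  by apply: is_diff_eq; apply/funext => b; rewrite fctE /= add0r.
have := is_derive_comp (is_diff_is_derive dg) (differentiableP (df : differentiable f (g
  a))).
by rewrite scale1r -deriveE.
Qed.

(** The base point [y] moves together with [d]: this joint version is what compactness of a time
    interval later turns into an estimate uniform in time. It comes from the mean value inequality
    for [f] minus its linear part on the segment from [y] to [y + d *: v], where ['D_v f] stays
    within [e / 2] of its value at [x]. *)
Lemma strict_derive E F (f : E -> F) (x v : E) (e : R) :
  (\near x, differentiable f x) -> {for x, continuous (fun y => 'D_v f y)} ->
  0 < e ->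
  \forall y \near x & d \near (0 : R),
    `|f (y + d *: v) - f y - d *: 'D_v f y| <= e * `|d|.
Proof.
move=> df cDf e0.
have e20 : 0 < e / 2 by exact: divr_gt0.
have : \forall y \near x, differentiable f y /\ `|'D_v f x - 'D_v f y| <= e / 2.
  by apply: filterI => //; move/cvgrPdist_le : cDf; exact.
move=> /nbhs_ballP[r /= r0 Hr].
have v1 : 0 < `|v| + 1 by rewrite ltr_wpDl.
exists (ball x (r / 2), ball (0 : R) (r / 2 / (`|v| + 1))) => /=.
  by split; apply: nbhsx_ballx; rewrite !divr_gt0.
move=> [y d] /= [xy]; rewrite /ball /= sub0r normrN ltr_pdivlMr// => dv.
have yq q : 0 <= q <= 1 -> ball x r (y + q *: (d *: v)).
  move=> /andP[q0 q1]; rewrite [r]splitr -ball_normE /=.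
  move: xy; rewrite -ball_normE /= => xy; rewrite opprD addrA.
  apply: le_lt_trans (ler_normB _ _) _; apply: ltrD => //.
  rewrite !normrZ ger0_norm//; apply: le_lt_trans dv.
  rewrite mulrDr mulr1 -[leLHS]addr0 lerD// ler_piMl// mulr_ge0//.
have yr : ball x r y by have := yq 0; rewrite scale0r addr0; apply; rewrite lexx ler01.
pose g (q : R) := f (y + q *: (d *: v)) - q *: (d *: 'D_v f y).
have -> : f (y + d *: v) - f y - d *: 'D_v f y = g 1 - g 0.
  by rewrite /g !scale1r !scale0r addr0 subr0 addrAC.
have := @mean_value_le_derive _ g
  (fun q => d *: ('D_v f (y + q *: (d *: v)) - 'D_v f y)) 0 1 (e * `|d|) ler01.
rewrite subr0 mulr1; apply=> q q01; have [dfq Dfq] := Hr _ (yq _ q01).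
  have := is_derive_line dfq; rewrite deriveE// linearZ /= -deriveE// => D1.
  have D2 : is_derive q 1 (fun q : R => q *: (d *: 'D_v f y)) (d *: 'D_v f y).
    have D2 : is_diff q (fun q : R => q *: (d *: 'D_v f y)) (fun q => q *: (d *: 'D_v f
      y)) by exact: is_diff_scalel.
    by have := is_diff_is_derive D2; rewrite scale1r.
  by have := is_deriveB D1 D2; rewrite -scalerBr.
have [_ Dfy] := Hr _ yr.
rewrite normrZ mulrC ler_wpM2r// -(subrKA ('D_v f x)) (splitr e).
by rewrite (le_trans (ler_normD _ _))// lerD// distrC.
Unshelve. all: by end_near. Qed.

End RealCurves.

(** * Symmetry of second derivatives *)

Section MixedDerivatives.
Context {R : realType} {E : normedModType R}.

(** The mean value theorem is applied twice, first along [u] to the increment of [f] in the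
    direction [v], then along [v] to ['D_u f]. This requires real values; vector values are handled
    by coordinates in [derive_swap]. *)
Lemma second_difference (f : E -> R^o) (x u v : E) (h : R) : 0 < h ->
  (forall a b, 0 <= a <= h -> 0 <= b <= h ->
    differentiable f (x + a *: u + b *: v) /\
    differentiable (fun y => 'D_u f y) (x + a *: u + b *: v)) ->
  exists a b, [/\ 0 <= a <= h, 0 <= b <= h &
    f (x + h *: u + h *: v) - f (x + h *: u) - f (x + h *: v) + f x =
    h * h * 'D_v (fun y => 'D_u f y) (x + a *: u + b *: v)].
Proof.
move=> h0 H; have hh : 0 <= h <= h by rewrite (ltW h0) lexx.
have h00 : 0 <= (0 : R) <= h by rewrite lexx ltW.
pose p (a : R) := f (x + h *: v + a *: u) - f (x + a *: u).
have dp (a : R) : 0 <= a <= h -> is_derive a 1 p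
    ('D_u f (x + h *: v + a *: u) - 'D_u f (x + a *: u)).
  move=> ah; apply: is_deriveB; apply: is_derive_line.
    by rewrite addrAC; have [] := H a h ah hh.
  by have [] := H a 0 ah h00; rewrite scale0r addr0.
have cont (g dg : R -> R) : (forall a, 0 <= a <= h -> is_derive a 1 g (dg a)) ->
    {within `[0, h], continuous g}.
  move=> dg'; apply: derivable_within_continuous => a.
  by rewrite in_itv /= => /dg' [].
have [a ah pa] := MVT_segment (ltW h0) (fun a ah => dp a (subset_itv_oo_cc ah))
  (cont _ _ dp).
rewrite in_itv /= in ah.
pose q (b : R) := 'D_u f (x + a *: u + b *: v).
have dq (b : R) : 0 <= b <= h -> is_derive b 1 q
    ('D_v (fun y => 'D_u f y) (x + a *: u + b *: v)).
  by move=> bh; apply: is_derive_line; have [] := H a b ah bh.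
have [b bh qb] := MVT_segment (ltW h0) (fun b bh => dq b (subset_itv_oo_cc bh))
  (cont _ _ dq).
rewrite in_itv /= in bh.
exists a, b; split=> //; move: pa qb.
rewrite /p /q !scale0r !addr0 !subr0 => pa qb; rewrite [x + h *: v + a *: u]addrAC qb in pa.
by rewrite [x + h *: u + h *: v]addrAC mulrC mulrA -[RHS]pa opprB addrA [RHS]addrAC.
Qed.

(** The second difference over a small parallelogram is symmetric in [u] and [v], so the two mixed
    derivatives take a common value at two points near [x]; continuity moves both points to [x] with
    total error [e]. *)
Lemma derive_swap_scalar (U : set E) (f : E -> R^o) (x u v : E) :
  open U -> U x -> Ck 2 U f ->
  'D_u (fun y => 'D_v f y) x = 'D_v (fun y => 'D_u f y) x.
Proof.
move=> oU Ux Hf; apply/eqP; rewrite -subr_eq0 -normr_le0.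
apply/ler_addgt0Pr => e e0; rewrite add0r.
have e20 : 0 < e / 2 by exact: divr_gt0.
have c1 : {for x, continuous (fun y => 'D_u (fun y => 'D_v f y) y)}.
  by apply: Ck_cont Ux; apply: Ck_derive; exact: Ck_derive Hf.
have c2 : {for x, continuous (fun y => 'D_v (fun y => 'D_u f y) y)}.
  by apply: Ck_cont Ux; apply: Ck_derive; exact: Ck_derive Hf.
have : \forall y \near x, [/\ U y,
   `|'D_u (fun y => 'D_v f y) x - 'D_u (fun y => 'D_v f y) y| <= e / 2 &
   `|'D_v (fun y => 'D_u f y) x - 'D_v (fun y => 'D_u f y) y| <= e / 2].
  have N1 : \forall y \near x, U y by exact: open_nbhs_nbhs.
  move/cvgrPdist_le : c1 => /(_ _ e20) N2.
  move/cvgrPdist_le : c2 => /(_ _ e20) N3.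
  by near=> y; split; [exact: (near N1 y)|exact: (near N2 y)|exact: (near N3 y)].
move=> /nbhs_ballP[r /= r0 Hr].
have uv0 : 0 < `|u| + `|v| + 1 by rewrite ltr_wpDl ?addr_ge0.
(* Small enough for the parallelogram with sides [h *: u] and [h *: v] to fit in the ball of radius
   [r]; the [+ 1] covers [u = v = 0]. *)
pose h := r / 2 / (`|u| + `|v| + 1).
have h0 : 0 < h by rewrite !divr_gt0.
have hr : h * (`|u| + `|v| + 1) < r by rewrite divfK ?gt_eqF// ltr_pdivrMr// ltr_pMr//
  ltr1n.
have inr a b : 0 <= a <= h -> 0 <= b <= h -> ball x r (x + a *: u + b *: v).
  move=> /andP[a0 ah] /andP[b0 bh]; rewrite -ball_normE /= -addrA opprD addNKr normrN.
  apply: le_lt_trans (ler_normD _ _) _; apply: le_lt_trans hr.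
  rewrite !normrZ !ger0_norm// !mulrDr mulr1 -[leLHS]addr0 !lerD// ?ler_wpM2r//.
  exact: ltW.
have Dif w y : U y -> differentiable (fun y => 'D_w f y) y.
  by move=> Uy; apply: (Ck_diff (k := 0)) Uy; exact: Ck_derive Hf.
have [a [b [ah bh E1]]] : exists a b, [/\ 0 <= a <= h, 0 <= b <= h &
    f (x + h *: u + h *: v) - f (x + h *: u) - f (x + h *: v) + f x =
    h * h * 'D_v (fun y => 'D_u f y) (x + a *: u + b *: v)].
  apply: second_difference => // a b ah bh; have [Uy _ _] := Hr _ (inr a b ah bh).
  by split; [exact: Ck_diff Hf Uy|exact: Dif].
have [b' [a' [bh' ah' E2]]] : exists b a, [/\ 0 <= b <= h, 0 <= a <= h &
    f (x + h *: v + h *: u) - f (x + h *: v) - f (x + h *: u) + f x =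
    h * h * 'D_u (fun y => 'D_v f y) (x + b *: v + a *: u)].
  apply: second_difference => // b' a' bh' ah'.
  have := Hr _ (inr a' b' ah' bh'); rewrite addrAC => -[Uy _ _].
  by split; [exact: Ck_diff Hf Uy|exact: Dif].
have tri (p q w : R) : `|p - w| <= e / 2 -> `|q - w| <= e / 2 -> `|p - q| <= e.
  move=> pr qr; rewrite -(subrKA w) (splitr e).
  by rewrite (le_trans (ler_normD _ _))// lerD// distrC.
have cancel_hh (p q t w D1 D2 : R) : p - q - t + w = h * h * D1 ->
    p - t - q + w = h * h * D2 -> D1 = D2.
  move=> e1 e2; apply: (@mulfI _ (h * h)); first by rewrite mulf_neq0// gt_eqF.
  by rewrite -e1 -e2 [p - q - t]addrAC.
have E3 : 'D_v (fun y => 'D_u f y) (x + a *: u + b *: v) =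
          'D_u (fun y => 'D_v f y) (x + b' *: v + a' *: u).
  rewrite [x + h *: v + h *: u]addrAC in E2.
  exact: cancel_hh E1 E2.
have [_ _ H1] := Hr _ (inr a b ah bh).
have := Hr _ (inr a' b' ah' bh'); rewrite addrAC => -[_ H2 _].
rewrite E3 in H1; exact: tri H2 H1.
Unshelve. all: by end_near. Qed.

Lemma is_diff_coord n (f df : E -> 'rV[R]_n) (x : E) (i : 'I_n) :
  is_diff x f df -> is_diff x (fun y => f y ord0 i : R^o) (fun v => df v ord0 i).
Proof. by move=> dfx; exact: (is_diff_lin_comp (@rV_coord_continuous R n i) dfx). Qed.

Lemma Ck_coord n k (U : set E) (f : E -> 'rV[R]_n) (i : 'I_n) : open U ->
  Ck k U f -> Ck k U (fun y => f y ord0 i : R^o).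
Proof. by move=> oU Hf; exact: (Ck_lin_comp oU (@rV_coord_continuous R n i) Hf). Qed.

Lemma derive_coord n (f : E -> 'rV[R]_n) (x v : E) (i : 'I_n) :
  differentiable f x -> 'D_v (fun y => f y ord0 i : R^o) x = 'D_v f x ord0 i.
Proof.
move=> df; rewrite (is_diff_derive v (is_diff_coord i (differentiableP df))).
by rewrite deriveE.
Qed.

Lemma derive_swap n (U : set E) (f : E -> 'rV[R]_n) (x u v : E) :
  open U -> U x -> Ck 2 U f ->
  'D_u (fun y => 'D_v f y) x = 'D_v (fun y => 'D_u f y) x.
Proof.
move=> oU Ux Hf; apply/rowP => i.
have Dif w y : U y -> differentiable (fun y => 'D_w f y) y.
  by move=> Uy; apply: (Ck_diff (k := 0)) Uy; exact: Ck_derive Hf.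
have nU : \forall y \near x, U y by exact: open_nbhs_nbhs.
have E1 w z : 'D_w (fun y => 'D_z f y) x ord0 i =
    'D_w (fun y => 'D_z (fun y => f y ord0 i : R^o) y) x.
  rewrite -derive_coord; last exact: Dif.
  apply: near_eq_derive; near=> y.
  by rewrite derive_coord//; apply: (Ck_diff Hf); exact: (near nU y).
have swap := derive_swap_scalar u v oU Ux (Ck_coord i oU Hf).
exact: (etrans (E1 u v) (etrans swap (esym (E1 v u)))).
Unshelve. all: by end_near. Qed.

Lemma rV_coord_norm n (X : 'rV[R]_n) i : `|X ord0 i| <= `|X|.
Proof.
rewrite [leRHS]/Num.Def.normr /= mx_normrE.
exact: (@le_bigmax _ _ _ _ (fun ij : 'I_1 * 'I_n => `|X ij.1 ij.2|) (ord0, i)).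
Qed.

End MixedDerivatives.

(** * Charted spaces *)

Lemma continuous_for_pair (T U V : topologicalType) (f : T -> U) (g : T -> V) x :
  {for x, continuous f} -> {for x, continuous g} ->
  {for x, continuous (fun y => (f y, g y))}.
Proof. by move=> cf cg; exact: (cvg_pair cf cg). Qed.

Section Charts.
Context {R : realType}.
Implicit Types E F : normedModType R.

(* What smoothness at a point uses of the chart chosen at that point.  Unlike
   [is_manifold] it is available for products and for vector spaces too. *)
Record charts_ok E (M : charted E) : Prop := {
  ok_chartK : forall p : M, \forall x \near p, chartV p (chart p x) = x;
  ok_chart_cont : forall p : M, {for p, continuous (chart p)};
  ok_chartV_cont : forall p : M, {for chart p p, continuous (chartV p)};
  ok_chartVK : forall p : M, \forall y \near chart p p, chart p (chartV p y) = y
}.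

Definition mdifferentiable E F (M : charted E) (N : charted F) (f : M -> N) (p : M) :=
  {for p, continuous f} /\ differentiable (in_coord f p (f p)) (chart p p).

Arguments mdifferentiable {E F} M N f p.

Lemma chartV_chart E (M : charted E) (p : M) : charts_ok M -> chartV p (chart p p) = p.
Proof. by move=> [+ _ _ _] => /(_ p) /nbhs_singleton. Qed.

Lemma ok_vect E : charts_ok (vect E).
Proof.
split=> p; rewrite /=.
- exact: filterE.
- exact: cvg_id.
- exact: cvg_id.
- exact: filterE.
Qed.

Lemma ok_prod E F (M : charted E) (N : charted F) :
  charts_ok M -> charts_ok N -> charts_ok (prod_charted M N).
Proof.
move=> okM okN; split=> -[p q].
- exists ([set x | chartV p (chart p x) = x], [set x | chartV q (chart q x) = x]).
    by split; exact: ok_chartK.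
  by move=> [x y] /= [-> ->].
- apply: (@continuous_for_pair _ _ _ (fun x : M * N => chart p x.1)
    (fun x : M * N => chart q x.2)).
    by apply: (@continuous_comp _ _ _ fst (chart p)); [exact: cvg_fst|exact: ok_chart_cont].
  by apply: (@continuous_comp _ _ _ snd (chart q)); [exact: cvg_snd|exact: ok_chart_cont].
- apply: (@continuous_for_pair _ _ _ (fun x : E * F => chartV p x.1)
    (fun x : E * F => chartV q x.2)).
    by apply: (@continuous_comp _ _ _ fst (chartV p)); [exact: cvg_fst|exact:
      ok_chartV_cont].
  by apply: (@continuous_comp _ _ _ snd (chartV q)); [exact: cvg_snd|exact: ok_chartV_cont].
- exists ([set y | chart p (chartV p y) = y], [set y | chart q (chartV q y) = y]).
    by split; exact: ok_chartVK.
  by move=> [x y] /= [-> ->].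
Qed.

Lemma ok_manifold n (M : manifold R n) : charts_ok M.
Proof.
have [_ _ Mdom Mimg MK Mc McV _] := mfd_axioms M; split=> p.
- by apply: filterS (open_nbhs_nbhs (Mdom p)) => x; exact: MK.
- by apply: Mc; exact: nbhs_singleton (open_nbhs_nbhs (Mdom p)).
- by apply: McV; exists p => //; exact: nbhs_singleton (open_nbhs_nbhs (Mdom p)).
- have : \forall y \near chart p p, (chart p @` dom p) y.
    apply: open_nbhs_nbhs; split; first exact: Mimg.
    by exists p => //; exact: nbhs_singleton (open_nbhs_nbhs (Mdom p)).
  by apply: filterS => _ [x px <-]; rewrite MK.
Qed.

Lemma near_chartV E (M : charted E) (p : M) (Q : set M) : charts_ok M ->
  nbhs p Q -> \forall y \near chart p p, Q (chartV p y).
Proof.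
by move=> okM pQ; apply: ok_chartV_cont => //; rewrite chartV_chart.
Qed.

Lemma near_in_coord E F (M : charted E) (N : charted F) (f : M -> N) (p : M)
    (Q : set N) : charts_ok M -> {for p, continuous f} ->
  nbhs (f p) Q -> \forall y \near chart p p, Q (f (chartV p y)).
Proof.
by move=> okM cf fpQ; exact: (near_chartV (Q := fun x => Q (f x)) okM (cf _ fpQ)).
Qed.

Lemma smooth_mdifferentiable E F (M : charted E) (N : charted F) (f : M -> N) (p : M) :
  smooth_at M N f p -> mdifferentiable M N f p.
Proof.
move=> [cf [W Wp sW]]; split=> //; apply: (Ck_diff (sW 1%N)).
exact: nbhs_singleton (open_nbhs_nbhs Wp).
Qed.

(** The chart at [f p] cancels between the two coordinate expressions only near [p], where
    continuity of [f] keeps the images in the region on which that chart is inverted. *)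
Lemma mdifferentiable_comp E1 E2 E3 (M : charted E1) (N : charted E2) (K : charted E3)
    (f : M -> N) (g : N -> K) (p : M) :
  charts_ok M -> charts_ok N ->
  mdifferentiable M N f p -> mdifferentiable N K g (f p) ->
  mdifferentiable M K (fun x => g (f x)) p /\
  mderiv M K (fun x => g (f x)) p = mderiv N K g (f p) \o mderiv M N f p :> (E1 -> E3).
Proof.
move=> okM okN [cf df] [cg dg].
have ifp : in_coord f p (f p) (chart p p) = chart (f p) (f p).
  by rewrite /in_coord chartV_chart.
have e : \forall y \near chart p p,
    (in_coord g (f p) (g (f p)) \o in_coord f p (f p)) y =
    in_coord (fun x => g (f x)) p (g (f p)) y.
  have := near_in_coord okM cf (ok_chartK okN (f p)).
  by apply: filterS => y; rewrite /in_coord /= => ->.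
rewrite -ifp in dg.
split.
  split; first by apply: continuous_comp.
  exact: near_differentiable e (differentiable_comp df dg).
rewrite /mderiv; apply/funext => v.
by rewrite (near_diff e (differentiable_comp df dg)) diff_comp// ifp.
Qed.

Lemma smooth_at_comp E1 E2 E3 (M : charted E1) (N : charted E2) (K : charted E3)
    (f : M -> N) (g : N -> K) (p : M) : findim E2 ->
  charts_ok M -> charts_ok N ->
  smooth_at M N f p -> smooth_at N K g (f p) ->
  smooth_at M K (fun x => g (f x)) p.
Proof.
move=> fE okM okN [cf [W [oW Wp] sW]] [cg [V [oV Vp] sV]].
split; first by apply: continuous_comp.
(* The three conditions make the inner expression smooth, put its values where the outer one is
   smooth, and let the middle chart cancel. The interior of [Q] is the open set wanted. *)
pose Q := [set y | [/\ W y, V (in_coord f p (f p) y) &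
   chartV (f p) (chart (f p) (f (chartV p y))) = f (chartV p y)]].
have ifp : in_coord f p (f p) (chart p p) = chart (f p) (f p).
  by rewrite /in_coord chartV_chart.
have nQ : nbhs (chart p p) Q.
  have N1 : nbhs (chart p p) W by exact: open_nbhs_nbhs.
  have N2 : \forall y \near chart p p, V (in_coord f p (f p) y).
    by apply: (Ck_cont (sW 0%N) Wp); rewrite ifp; exact: open_nbhs_nbhs.
  have N3 := near_in_coord okM cf (ok_chartK okN (f p)).
  by near=> y; split; [exact: (near N1 y)|exact: (near N2 y)|exact: (near N3 y)].
have iQ y : Q^° y -> Q y by exact: interior_subset.
exists Q^°; first by split; [exact: open_interior|].
move=> k; have H : Ck k Q^° (fun y => in_coord g (f p) (g (f p)) (in_coord f p (f p) y)).
  apply: (Ck_comp (V := V)) => //; first exact: open_interior.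
  - by move=> y /iQ[].
  - by apply: Ck_sub (sW k) => y /iQ[].
apply: Ck_ext (open_interior _) _ H => y /set_mem/iQ[_ _].
by rewrite /in_coord => ->.
Unshelve. all: by end_near. Qed.

Lemma smooth_at_pair E1 E2 E3 (M : charted E1) (N : charted E2) (K : charted E3)
    (f : M -> N) (g : M -> K) (p : M) :
  smooth_at M N f p -> smooth_at M K g p ->
  smooth_at M (prod_charted N K) (fun x => (f x, g x)) p.
Proof.
move=> [cf [W [oW Wp] sW]] [cg [V [oV Vp] sV]].
split; first exact: cvg_pair.
exists (W `&` V); first by split; [exact: openI|].
move=> k; apply: Ck_pair; first exact: openI.
  by apply: Ck_sub (sW k) => y [].
by apply: Ck_sub (sV k) => y [].
Qed.

Lemma smooth_at_cst E F (M : charted E) (N : charted F) (a : N) (p : M) :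
  smooth_at M N (fun=> a) p.
Proof.
split; first exact: cst_continuous.
by exists setT; [split; [exact: openT|]|move=> k; exact: Ck_cst].
Qed.

Lemma smooth_at_id E (M : charted E) (p : M) : charts_ok M -> smooth_at M M id p.
Proof.
move=> okM; split; first exact: cvg_id.
exists [set y | chart p (chartV p y) = y]^°; first by split; [exact: open_interior|exact:
  ok_chartVK].
move=> k; apply: Ck_ext (open_interior _) _ (@Ck_id _ _ _ _).
by move=> y /set_mem /interior_subset /= yK; rewrite /in_coord yK.
Qed.

Lemma smooth_at_fst E F (M : charted E) (N : charted F) (p : M * N) :
  charts_ok M -> smooth_at (prod_charted M N) M fst p.
Proof.
move=> okM; split; first exact: cvg_fst.
pose Q := [set y : E * F | chart p.1 (chartV p.1 y.1) = y.1].
have nQ : nbhs (@chart _ _ (prod_charted M N) p p) Q.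
  exact: (@cvg_fst _ _ (nbhs (chart p.1 p.1)) (nbhs (chart p.2 p.2)) _ _ (ok_chartVK okM
    p.1)).
exists Q^°; first by split; [exact: open_interior|].
move=> k; apply: Ck_ext (open_interior _) _ (@Ck_lin _ _ _ k _ fst _).
  by move=> y /set_mem /interior_subset /= yK; rewrite /in_coord yK.
by move=> y; exact: cvg_fst.
Qed.

Lemma smooth_at_snd E F (M : charted E) (N : charted F) (p : M * N) :
  charts_ok N -> smooth_at (prod_charted M N) N snd p.
Proof.
move=> okM; split; first exact: cvg_snd.
pose Q := [set y : E * F | chart p.2 (chartV p.2 y.2) = y.2].
have nQ : nbhs (@chart _ _ (prod_charted M N) p p) Q.
  exact: (@cvg_snd _ _ (nbhs (chart p.1 p.1)) (nbhs (chart p.2 p.2)) _ _ (ok_chartVK okM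
    p.2)).
exists Q^°; first by split; [exact: open_interior|].
move=> k; apply: Ck_ext (open_interior _) _ (@Ck_lin _ _ _ k _ snd _).
  by move=> y /set_mem /interior_subset /= yK; rewrite /in_coord yK.
by move=> y; exact: cvg_snd.
Qed.

End Charts.

Arguments mdifferentiable {R E F} M N f p.

Section Manifolds.
Context {R : realType} {n : nat} (M : manifold R n).
Let E := 'rV[R]_n.

Lemma nbhs_dom (p : M) : nbhs p (dom p).
Proof. exact: open_nbhs_nbhs (mfd_dom (mfd_axioms M) p). Qed.

Lemma open_dom (p : M) : open (dom p).
Proof. by have [] := mfd_dom (mfd_axioms M) p. Qed.

Lemma dom_self (p : M) : dom p p.
Proof. exact: nbhs_singleton (nbhs_dom p). Qed.

Lemma nbhs_dom_of (p q : M) : dom p q -> nbhs q (dom p).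
Proof. by move=> pq; apply: open_nbhs_nbhs; split=> //; exact: open_dom. Qed.

Lemma dom_chartK (p x : M) : dom p x -> chartV p (chart p x) = x.
Proof. exact: (mfd_chartK (mfd_axioms M)). Qed.

Lemma dom_chart_cont (p x : M) : dom p x -> {for x, continuous (chart p)}.
Proof. exact: (mfd_chart_cont (mfd_axioms M)). Qed.

Lemma nbhs_img (p : M) (y : E) : (chart p @` dom p) y -> nbhs y (chart p @` dom p).
Proof.
by move=> py; apply: open_nbhs_nbhs; split=> //; exact: (mfd_img (mfd_axioms M)).
Qed.

Lemma dom_chartVK (p : M) (y : E) : (chart p @` dom p) y ->
  chart p (chartV p y) = y /\ dom p (chartV p y).
Proof. by move=> [x px <-]; rewrite dom_chartK. Qed.

(** In coordinates at [q] this is a transition map of the atlas; the same holds for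
    [smooth_chartV]. *)
Lemma smooth_chart (p q : M) : dom p q -> smooth_at M (vect E) (chart p) q.
Proof.
move=> pq; split; first exact: dom_chart_cont.
pose Q := [set y | (chart q @` (dom q `&` dom p)) y].
have nQ : nbhs (chart q q) Q.
  have N1 : \forall y \near chart q q, (chart q @` dom q) y.
    by apply: nbhs_img; exists q => //; exact: dom_self.
  have N2 := near_chartV (ok_manifold M) (nbhs_dom_of pq).
  near=> y; have := near N1 y; move=> /(_ _)/dom_chartVK[]// => yK qy.
  by exists (chartV q y) => //; split=> //; exact: (near N2 y).
exists Q^°; first by split; [exact: open_interior|].
move=> k; apply: (Ck_sub (@interior_subset _ _)).
exact: (mfd_transition (mfd_axioms M) q p).
Unshelve. all: by end_near. Qed.

Lemma smooth_chartV (p : M) (y : E) : (chart p @` dom p) y ->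
  smooth_at (vect E) M (chartV p) y.
Proof.
move=> py; have [yK pq] := dom_chartVK py.
have cV : {for y, continuous (chartV p)} by exact: (mfd_chartV_cont (mfd_axioms M)).
split=> //; pose q := chartV p y.
pose Q := [set z | (chart p @` (dom p `&` dom q)) z].
have nQ : nbhs y Q.
  have N1 := nbhs_img py.
  have N2 : \forall z \near y, dom q (chartV p z) by apply: cV; exact: nbhs_dom.
  near=> z; have := near N1 z; move=> /(_ _)/dom_chartVK[]// => zK pz.
  by exists (chartV p z) => //; split=> //; exact: (near N2 z).
exists Q^°; first by split; [exact: open_interior|].
move=> k; apply: (Ck_sub (@interior_subset _ _)).
exact: (mfd_transition (mfd_axioms M) p q).
Unshelve. all: by end_near. Qed.

End Manifolds.

(** * Lie groups *)

Section LieGroup.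
Context {R : realType} {n : nat} (H : lie_group R n).
Let E := 'rV[R]_n.
Implicit Types g h k : H.
Local Notation e := (lg1 H).
Local Notation phi := (chart e).
Local Notation psi := (chartV e).
Local Notation o := (chart (lg1 H) (lg1 H)).
Local Notation "g ** h" := (lgM g h) (at level 40, left associativity).
Local Notation "g ^i" := (lgV g) (at level 3, format "g ^i").

Let ax := lg_axioms H.
Let okH := ok_manifold H.
Let fE : findim E := findim_rV n.

Lemma lgMA g h k : g ** (h ** k) = g ** h ** k. Proof. exact: (lg_mulA ax). Qed.
Lemma lgM1 g : g ** e = g. Proof. exact: (lg_mulr1 ax). Qed.
Lemma lg1M g : e ** g = g. Proof. exact: (lg_mul1 ax). Qed.
Lemma lgMV g : g ** g^i = e. Proof. exact: (lg_mulrV ax). Qed.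
Lemma lgVM g : g^i ** g = e. Proof. exact: (lg_mulV ax). Qed.
Lemma lgMK g h : g ** h ** h^i = g. Proof. by rewrite -lgMA lgMV lgM1. Qed.
Lemma lgMVK g h : g ** h^i ** h = g. Proof. by rewrite -lgMA lgVM lgM1. Qed.
Lemma lgV_uniq g h : g ** h = e -> h = g^i.
Proof. by move=> gh; rewrite -(lg1M h) -(lgVM g) -lgMA gh lgM1. Qed.
Lemma lgVK g : (g^i)^i = g. Proof. by rewrite -(lgV_uniq (lgVM g)). Qed.
Lemma lgVMM g h : (g ** h)^i = h^i ** g^i.
Proof. by rewrite -(@lgV_uniq (g ** h) (h^i ** g^i))// lgMA lgMK lgMV. Qed.
Lemma lgV1 : e^i = e. Proof. by rewrite -(@lgV_uniq e e)// lgM1. Qed.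

Lemma smooth_lgM (F : normedModType R) (N : charted F) (f f' : N -> H) (p : N) :
  charts_ok N -> smooth_at N H f p -> smooth_at N H f' p ->
  smooth_at N H (fun x => f x ** f' x) p.
Proof.
move=> okN sf sf'.
have sm : smooth_at (prod_charted H H) H (fun z => z.1 ** z.2) (f p, f' p).
  by apply: (lg_mul_smooth ax).
apply: (smooth_at_comp (f := fun x => (f x, f' x) : prod_charted H H) _ okN _ _ sm).
- exact: findim_prod.
- exact: ok_prod.
- exact: smooth_at_pair.
Qed.

Lemma smooth_lgV (F : normedModType R) (N : charted F) (f : N -> H) (p : N) :
  charts_ok N -> smooth_at N H f p -> smooth_at N H (fun x => (f x)^i) p.
Proof.
move=> okN sf; apply: (smooth_at_comp fE okN okH sf).
exact: (lg_inv_smooth ax).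
Qed.

Lemma smooth_conj g (p : H) : smooth_at H H (fun x => g ** x ** g^i) p.
Proof.
apply: smooth_lgM => //; last exact: smooth_at_cst.
by apply: smooth_lgM => //; [exact: smooth_at_cst|exact: smooth_at_id].
Qed.

Lemma conj1 g : g ** e ** g^i = e. Proof. by rewrite lgM1 lgMV. Qed.

(** [Ad] is computed with the chart chosen at [g ** e ** g^-1]. That point is [e], so the chart at
    the unit serves on both sides and [Ad g] becomes an ordinary differential. *)
Lemma Ad_is_diff g : is_diff (o : E) (fun y : E => phi (g ** psi y ** g^i) : E) (Ad g).
Proof.
have [_] := smooth_mdifferentiable (smooth_conj g e).
rewrite /in_coord (conj1 g) => df; split; first exact: df.
by rewrite /Ad /mderiv /in_coord (conj1 g).
Qed.

Lemma Ad_linear g : linear (@Ad R n H g).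
Proof. by move=> a u v; rewrite /Ad /mderiv linearP. Qed.

Lemma Ad_continuous g : continuous (@Ad R n H g).
Proof.
have [df <-] := Ad_is_diff g; exact: diff_continuous.
Qed.

Definition AdL g : {linear E -> E} :=
  HB.pack (@Ad R n H g) (GRing.isLinear.Build _ _ _ _ _ (Ad_linear g)).

Lemma Ad_mul g h X : Ad (g ** h) X = Ad g (Ad h X).
Proof.
have ch := smooth_mdifferentiable (smooth_conj h e).
have cg := smooth_mdifferentiable (smooth_conj g (h ** e ** h^i)).
have [_] := mdifferentiable_comp okH okH ch cg.
rewrite conj1 => eq; have := congr1 (@^~ X) eq.
rewrite /Ad /= => <-; congr (mderiv H H _ e X).
by apply/funext => x; rewrite lgVMM !lgMA.
Qed.

Lemma Ad1 X : Ad e X = X.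
Proof.
have [df <-] := Ad_is_diff e.
have near_id : \forall y \near o, id y = phi (e ** psi y ** e^i).
  apply: filterS (ok_chartVK okH e) => y yK.
  by rewrite lgV1 lgM1 lg1M yK.
by have [_ ->] := near_is_diff near_id (is_diff_id (o : E)).
Qed.

Lemma AdK g X : Ad g^i (Ad g X) = X.
Proof. by rewrite -Ad_mul lgVM Ad1. Qed.

(** Infinitesimal computations in the group are reduced to derivatives of this one map at and near
    [(o, o)]. Away from there the product may leave the domain of the chart, so every use is
    local. *)
Definition mulc (z : E * E) : E := phi (psi z.1 ** psi z.2).

Lemma mulc_smooth : exists2 W : set (E * E), open_nbhs (o, o) W & Cinf W mulc.
Proof.
have : smooth_at (prod_charted H H) H (fun z => z.1 ** z.2) (e, e).
  by apply: (lg_mul_smooth ax).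
by move=> [_]; rewrite /in_coord /= lg1M.
Qed.

Lemma psi_o : psi o = e. Proof. exact: chartV_chart. Qed.

Lemma mulc1 : \forall y \near o, mulc (y, o) = y.
Proof.
apply: filterS (ok_chartVK okH e) => y yK.
by rewrite /mulc /= psi_o lgM1 yK.
Qed.

Lemma mul1c : \forall y \near o, mulc (o, y) = y.
Proof.
apply: filterS (ok_chartVK okH e) => y yK.
by rewrite /mulc /= psi_o lg1M yK.
Qed.

Lemma is_diff_inl (F F' : normedModType R) (x : F) (y : F') :
  is_diff x (fun z => (z, y)) (fun v => (v, 0)).
Proof. exact: is_diff_pair. Qed.

Lemma is_diff_inr (F F' : normedModType R) (x : F) (y : F') :
  is_diff y (fun z => (x, z)) (fun v => (0, v)).
Proof. exact: is_diff_pair. Qed.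

(** On either axis through [(o, o)] the map is the identity near [o], because [psi o] is the unit;
    linearity of the differential gives the sum. *)
Lemma mulc_is_diff : is_diff ((o, o) : E * E) mulc (fun v => v.1 + v.2).
Proof.
have [W [oW Woo] sW] := mulc_smooth.
have dm : differentiable mulc (o, o) by exact: Ck_diff (sW 1%N) Woo.
split=> //; apply/funext => -[v w] /=.
have -> : (v, w) = (v, 0) + (0, w) by apply: injective_projections; rewrite /= ?addr0
  ?add0r.
rewrite linearD; congr (_ + _).
  have [_ /(congr1 (@^~ v)) /= <-] :=
    is_diff_comp (is_diff_inl (o : E) (o : E)) (differentiableP dm).
  have H1 : \forall y \near o, id y = (mulc \o (fun z => (z, o))) y.
    by apply: filterS mulc1 => y /= ->.
  by have [_ ->] := near_is_diff H1 (is_diff_id (o : E)).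
have [_ /(congr1 (@^~ w)) /= <-] :=
  is_diff_comp (is_diff_inr (o : E) (o : E)) (differentiableP dm).
have H1 : \forall y \near o, id y = (mulc \o (fun z => (o, z))) y.
  by apply: filterS mul1c => y /= ->.
by have [_ ->] := near_is_diff H1 (is_diff_id (o : E)).
Qed.

(** Passing through the unit at time [t] makes one fixed chart sufficient. Continuity is a separate
    clause because [phi (k r)] says nothing about [k r] outside the domain of that chart. *)
Definition tangent (k : R -> H) (t : R) (X : E) :=
  [/\ {for t, continuous k}, k t = e & is_derive t 1 (fun r => phi (k r) : E) X].

Lemma tangent_near (k : R -> H) t X : tangent k t X ->
  \forall r \near t, psi (phi (k r)) = k r.
Proof.
move=> [kc ke _]; apply: (kc [set x | psi (phi x) = x]).
by rewrite ke; exact: ok_chartK.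
Qed.

Lemma continuous_lgM (T : topologicalType) (a b : T -> H) t :
  {for t, continuous a} -> {for t, continuous b} ->
  {for t, continuous (fun r => a r ** b r)}.
Proof.
move=> ca cb; have cab := continuous_for_pair ca cb.
have [cm _] : smooth_at (prod_charted H H) H (fun z => z.1 ** z.2) (a t, b t).
  by apply: (lg_mul_smooth ax).
exact: (continuous_comp cab cm).
Qed.

Lemma continuous_lgV (T : topologicalType) (a : T -> H) t :
  {for t, continuous a} -> {for t, continuous (fun r => (a r)^i)}.
Proof.
move=> ca; have [ci _] : smooth_at H H (@lgV R n H) (a t) by apply: (lg_inv_smooth ax).
exact: (continuous_comp ca ci).
Qed.

Lemma tangent_mul a b t A B : tangent a t A -> tangent b t B ->
  tangent (fun r => a r ** b r) t (A + B).
Proof.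
move=> Ta Tb; have [ac ae da] := Ta; have [bc be db] := Tb.
split; [exact: continuous_lgM|by rewrite ae be lgM1|].
have dab : is_derive t 1 (fun r => (phi (a r) : E, phi (b r) : E)) (A, B).
  have := is_diff_is_derive (is_diff_pair (is_derive_is_diff da) (is_derive_is_diff db)).
  by rewrite !scale1r.
have dm : is_diff (phi (a t) : E, phi (b t) : E) mulc (fun v => v.1 + v.2).
  by rewrite ae be; exact: mulc_is_diff.
apply: near_eq_is_derive (is_derive_comp dab dm).
near=> r; rewrite /mulc /=.
by rewrite (near (tangent_near Ta) r)// (near (tangent_near Tb) r).
Unshelve. all: by end_near. Qed.

Lemma tangent_conj g a t A : tangent a t A ->
  tangent (fun r => g ** a r ** g^i) t (Ad g A).
Proof.
move=> Ta; have [ac ae da] := Ta.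
split; last 1 first.
- have dm : is_diff (phi (a t) : E) (fun y : E => phi (g ** psi y ** g^i) : E) (Ad g).
    by rewrite ae; exact: Ad_is_diff.
  apply: near_eq_is_derive (is_derive_comp da dm).
  by near=> r; rewrite (near (tangent_near Ta) r).
- apply: continuous_lgM; last exact: cst_continuous.
  by apply: continuous_lgM => //; exact: cst_continuous.
- by rewrite ae conj1.
Unshelve. all: by end_near. Qed.

Lemma tangent_cst t : tangent (fun=> e) t 0.
Proof.
split; [exact: cst_continuous|by []|exact: is_derive_cst].
Qed.

(** Smoothness of inversion yields some derivative [B]; differentiating the constant product of
    [a r] with its inverse forces [A + B = 0]. *)
Lemma tangent_inv a t A : tangent a t A -> tangent (fun r => (a r)^i) t (- A).
Proof.
move=> Ta; have [ac ae da] := Ta.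
have [_ di] := smooth_mdifferentiable (lg_inv_smooth ax I : smooth_at H H (@lgV R n H) e).
rewrite /in_coord lgV1 in di.
have [B dB] : exists B, tangent (fun r => (a r)^i) t B.
  exists ('d (fun y : E => phi (psi y)^i : E) (o : E) A).
  split; [exact: continuous_lgV|by rewrite ae lgV1|].
  have dm : is_diff (phi (a t) : E) (fun y : E => phi (psi y)^i : E)
      ('d (fun y : E => phi (psi y)^i : E) (o : E)).
    by rewrite ae; exact: differentiableP.
  apply: near_eq_is_derive (is_derive_comp da dm).
  by near=> r; rewrite (near (tangent_near Ta) r).
suff -> : - A = B by [].
have [_ _ d1] := tangent_mul Ta dB; have [_ _ d2] := tangent_cst t.
have d1' := @derive_val _ _ _ _ _ _ _ d1.
have d2' := @derive_val _ _ _ _ _ _ _ d2.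
have E1 : (fun r => phi (a r ** (a r)^i) : E) = (fun=> phi e).
  by apply/funext => r; rewrite lgMV.
rewrite E1 d2' in d1'.
by apply/eqP; rewrite eqr_oppLR -addr_eq0 -d1'.
Unshelve. all: by end_near. Qed.

(* The right logarithmic derivative [h' h^-1] read in the chart at the unit, which
   avoids the charts chosen at the points [h r]. *)
Definition rlog (h : R -> H) (t : R) (X : E) := tangent (fun r => h r ** (h t)^i) t X.

(** [a r b r (a t b t)^-1] is [a r (a t)^-1] times the conjugate by [a t] of [b r (b t)^-1]. *)
Lemma rlog_mul a b t A B : rlog a t A -> rlog b t B ->
  rlog (fun r => a r ** b r) t (A + Ad (a t) B).
Proof.
move=> Ra Rb; have := tangent_mul Ra (tangent_conj (a t) Rb).
rewrite /rlog; congr (tangent _ _ _); apply/funext => r.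
by rewrite lgVMM !lgMA lgMVK.
Qed.

(** [(a r)^-1 a t] is the conjugate by [(a t)^-1] of the inverse of [a r (a t)^-1]. *)
Lemma rlog_inv a t A : rlog a t A -> rlog (fun r => (a r)^i) t (- Ad (a t)^i A).
Proof.
move=> Ra; have := tangent_conj (a t)^i (tangent_inv Ra).
rewrite -(linearN (AdL (a t)^i)).
rewrite /rlog; congr (tangent _ _ _); apply/funext => r.
by rewrite lgVMM !lgVK !lgMA lgVM lg1M.
Qed.

(** By the chain rule the chart at [h t], through which both [velocity] and [rtranslate] are read,
    drops out; this links [rlog] with the equations of the statement. *)
Lemma rlog_velocity (h : R -> H) t : smooth_at (vect R^o) H h t ->
  rlog h t (rtranslate (h t) (velocity h t)).
Proof.
move=> sh; have mh := smooth_mdifferentiable sh.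
have sr : smooth_at H H (fun x => x ** (h t)^i) (h t).
  by apply: smooth_lgM => //; [exact: smooth_at_id|exact: smooth_at_cst].
have [[c d] eq] := mdifferentiable_comp (ok_vect _) okH mh (smooth_mdifferentiable sr).
split; [exact: c|by rewrite lgMV|].
have := congr1 (@^~ 1) eq; rewrite /rtranslate /velocity /= => <-.
move: d; rewrite /mderiv /in_coord /= lgMV => d.
exact: (is_diff_is_derive (differentiableP d)).
Qed.

End LieGroup.

(** * The differential of Ad at the unit is the Lie bracket *)

Section Bracket.
Context {R : realType} {n : nat} (H : lie_group R n).
Let E := 'rV[R]_n.
Implicit Types g h k : H.
Local Notation e := (lg1 H).
Local Notation phi := (chart e).
Local Notation psi := (chartV e).
Local Notation o := (chart (lg1 H) (lg1 H)).
Local Notation "g ** h" := (lgM g h) (at level 40, left associativity).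
Local Notation "g ^i" := (lgV g) (at level 3, format "g ^i").
Local Notation delta i := (delta_mx ord0 i : 'rV[R]_n).
Let okH := ok_manifold H.
Let fE : findim E := findim_rV n.

(** Conjugation is smooth in both arguments jointly, and [Ad g Z] is its derivative in the direction
    [(0, Z)] at the unit of the second argument. *)
Lemma Ad_smooth Z (p : H) : smooth_at H (vect E) (fun g => Ad g Z) p.
Proof.
have [_ [W [oW Wp]]] : smooth_at (prod_charted H H) H
    (fun z => z.1 ** z.2 ** (z.1)^i) (p, e).
  have okHH := ok_prod okH okH.
  apply: smooth_lgM => //; last by apply: smooth_lgV => //; exact: smooth_at_fst.
  by apply: smooth_lgM => //; [exact: smooth_at_fst|exact: smooth_at_snd].
rewrite /in_coord /= conj1 => sW.
pose F (z : E * E) : E := phi (chartV p z.1 ** psi z.2 ** (chartV p z.1)^i).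
pose W' := [set y : E | W (y, o)].
have oW' : open W'.
  apply: (@open_comp _ _ (fun y : E => (y, o : E)) W) => // y _.
  by apply: (@continuous_for_pair _ _ _ id (fun=> o)); [exact: cvg_id|exact:
    cst_continuous].
have AdF y : W' y -> Ad (chartV p y) Z = 'D_((0 : E), Z) F (y, o).
  move=> Wy; have dF : differentiable F (y, o) by apply: Ck_diff (sW 1%N) Wy.
  rewrite deriveE// -(@diff_val _ _ _ _ _ _ _ (Ad_is_diff (chartV p y))).
  by rewrite (@diff_val _ _ _ _ _ _ _ (is_diff_comp (is_diff_inr y (o : E))
    (differentiableP dF))).
have sA : Cinf W' (fun y => Ad (chartV p y) Z).
  move=> k; have S1 : Ck k W' (fun y => 'D_((0 : E), Z) F (y, o)).
    apply: (Ck_comp (V := W) (f := fun z => 'D_((0 : E), Z) F z)) => //.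
    - exact: findim_prod.
    - by apply: Ck_pair => //; [exact: Ck_id|exact: Ck_cst].
    - exact: Ck_derive (sW k.+1).
  by apply: Ck_ext oW' _ S1 => y /set_mem /AdF ->.
split; last by exists W' => //; split.
have c1 : {for chart p p, continuous (fun y => Ad (chartV p y) Z)} by exact: Ck_cont (sA
  0%N) Wp.
have c0 : {for p, continuous (chart p)} by exact: ok_chart_cont.
have c2 := continuous_comp c0 c1.
rewrite /prop_for /continuous_at /= (chartV_chart p okH) in c2.
apply: cvg_trans c2; apply: near_eq_cvg.
by apply: filterS (ok_chartK okH p) => g /= ->.
Qed.

Lemma mulc_near (Q : set (E * E)) : nbhs (o, o) Q ->
  (\forall y \near o, Q (y, o)) /\ (\forall y \near o, Q (o, y)).
Proof.
move=> nQ; split.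
  apply: (@continuous_for_pair _ _ _ id (fun=> o) o) nQ.
    exact: cvg_id.
  exact: cst_continuous.
apply: (@continuous_for_pair _ _ _ (fun=> o) id o) nQ.
  exact: cst_continuous.
exact: cvg_id.
Qed.

(* The derivative at [x = e] of [(y x y^-1) y = y x]. *)
Lemma Ad_mulc Z : \forall y \near o,
  'D_(Ad (psi y) Z, (0 : E)) (@mulc R n H) (o, y) =
  'D_((0 : E), Z) (@mulc R n H) (y, o).
Proof.
have [W Wo sW] := mulc_smooth H.
have nW := open_nbhs_nbhs Wo.
have [N1 N2] := mulc_near nW.
have dm (z : E * E) : W z -> differentiable (@mulc R n H) z.
  by move=> Wz; apply: Ck_diff (sW 1%N) Wz.
near=> y.
have d1 : differentiable (@mulc R n H) (y, o) by apply: dm; exact: (near N1 y).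
have d2 : differentiable (@mulc R n H) (o, y) by apply: dm; exact: (near N2 y).
rewrite (deriveE _ d1) (deriveE _ d2).
pose c := fun x : E => phi (psi y ** psi x ** (psi y)^i) : E.
have co : c o = o by rewrite /c (psi_o H) conj1.
have dc : is_diff (o : E) c (Ad (psi y)) by exact: Ad_is_diff.
have f1 := is_diff_comp (is_diff_inr y (o : E)) (differentiableP d1).
have d2' : is_diff (c o, y) (@mulc R n H) ('d (@mulc R n H) (o, y)).
  by rewrite co; exact: differentiableP.
have f2 := is_diff_comp (is_diff_comp dc (is_diff_inl (c o) y)) d2'.
have [sc _] := smooth_conj (psi y) e.
have nc : \forall x \near e, psi (phi (psi y ** x ** (psi y)^i)) = psi y ** x ** (psi y)^i.
  by apply: (sc [set x | psi (phi x) = x]); rewrite conj1; exact: ok_chartK.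
have N3 := near_chartV okH nc.
have E12 : \forall x \near o, (@mulc R n H \o (fun z => (y, z))) x =
    (@mulc R n H \o ((fun z => (z, y)) \o c)) x.
  by near=> x; rewrite /mulc /= /c (near N3 x)// lgMVK.
have f12 := near_is_diff E12 f1.
have v12 := etrans (esym (@diff_val _ _ _ _ _ _ _ f2)) (@diff_val _ _ _ _ _ _ _ f12).
exact: (congr1 (@^~ Z) v12).
Unshelve. all: by end_near. Qed.

Let m : E * E -> E := mulc H.
(** The second derivative of multiplication at the unit; antisymmetrising its mixed part gives the
    Lie bracket. *)
Let D2 (u v : E * E) : E := 'D_u (fun z => 'D_v m z) (o, o).

(** Left translation by [psi y] followed by [chart e] is, in coordinates, the partial map of [mulc]
    at [y]; the chart chosen at [psi y] disappears by the chain rule. *)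
Lemma left_field_coord Z : \forall y \near o,
  field_coord (left_field (G := H) Z) e y = 'D_((0 : E), Z) m (y, o).
Proof.
have [W Wo sW] := mulc_smooth H.
have [N1 _] := mulc_near (open_nbhs_nbhs Wo).
have N2 := near_chartV okH (nbhs_dom e).
near=> y; have dy : dom e (psi y) by exact: (near N2 y).
have d1 : differentiable m (y, o).
  by apply: Ck_diff (sW 1%N) _; exact: (near N1 y).
have m1 : mdifferentiable H H (lgM (psi y)) e.
  apply: smooth_mdifferentiable; apply: smooth_lgM => //; last exact: smooth_at_id.
  exact: smooth_at_cst.
have m2 : mdifferentiable H (vect E) (chart e) (psi y ** e).
  by rewrite lgM1; apply: smooth_mdifferentiable; exact: smooth_chart.
have [_] := mdifferentiable_comp okH okH m1 m2.
rewrite lgM1 => /(congr1 (@^~ Z)) /= v; rewrite /field_coord /left_field -v.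
rewrite (deriveE _ d1).
have f1 := is_diff_comp (is_diff_inr y (o : E)) (differentiableP d1).
exact: (congr1 (@^~ Z) (@diff_val _ _ _ _ _ _ _ f1)).
Unshelve. all: by end_near. Qed.

Lemma left_field1 X : left_field (G := H) X e = X.
Proof.
rewrite /left_field.
have -> : lgM (l := H) e = id by apply/funext => x; rewrite lg1M.
have near_id : \forall y \near o, id y = in_coord (M := H) (N := H) id e e y.
  by apply: filterS (ok_chartVK okH e) => y yK; rewrite /in_coord yK.
have H1 := near_is_diff near_id (is_diff_id (o : E)).
exact: (congr1 (@^~ X) (@diff_val _ _ _ _ _ _ _ H1)).
Qed.

Lemma mulc_diff2 (v : E * E) : differentiable (fun z => 'D_v m z) (o, o).
Proof.
have [W [oW Wo] sW] := mulc_smooth H.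
by apply: (Ck_diff (k := 0)) Wo; apply: Ck_derive; exact: (sW 2%N).
Qed.

Lemma left_field_diff Z :
  is_diff (o : E) (fun y => 'D_((0 : E), Z) m (y, o)) (fun X => D2 (X, 0) (0, Z)).
Proof.
have d := mulc_diff2 (0, Z).
have -> : (fun X => D2 (X, 0) (0, Z)) =
    'd (fun z => 'D_((0 : E), Z) m z) (o, o) \o (fun v => (v, 0)).
  by apply/funext => X; exact: (deriveE _ d).
exact: (is_diff_comp (is_diff_inl (o : E) (o : E)) (differentiableP d)).
Qed.

Lemma lie_bracketE X Z : lie_bracket H X Z = D2 (X, 0) (0, Z) - D2 (Z, 0) (0, X).
Proof.
rewrite /lie_bracket /vbracket !left_field1.
have H1 Y : is_diff (o : E) (field_coord (left_field (G := H) Y) e)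
    (fun X => D2 (X, 0) (0, Y)).
  apply: near_is_diff (left_field_diff Y).
  by apply: filterS (left_field_coord Y) => y ->.
have [_ e1] := H1 Z; have [_ e2] := H1 X.
exact: (congr2 (fun a b => a - b) (congr1 (@^~ X) e1) (congr1 (@^~ Z) e2)).
Qed.

Lemma is_diff_sum (F F' : normedModType R) (I : Type) (r : seq I)
    (f df : I -> F -> F') (x : F) :
  (forall i, is_diff x (f i) (df i)) ->
  is_diff x (fun y => \sum_(i <- r) f i y) (fun v => \sum_(i <- r) df i v).
Proof.
move=> dfi; elim: r => [|i r IH].
  have := is_diff_cst (0 : F') x; rewrite /cst.
  have -> : (fun y => \sum_(i <- [::]) f i y) = (fun=> 0 : F').
    by apply/funext => y; rewrite big_nil.
  by have -> : (fun y => \sum_(i <- [::]) df i y) = (0 : F -> F')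
    by apply/funext => y; rewrite big_nil.
have -> : (fun y => \sum_(i <- i :: r) f i y) = f i + (fun y => \sum_(i <- r) f i y).
  by apply/funext => y; rewrite big_cons.
have -> : (fun y => \sum_(i <- i :: r) df i y) = df i + (fun y => \sum_(i <- r) df i y).
  by apply/funext => y; rewrite big_cons.
exact: is_diffD.
Qed.

Lemma pair_row_sum_delta (Y : E) :
  (Y, 0) = \sum_(i < n) Y ord0 i *: ((delta i, 0) : E * E).
Proof.
apply: injective_projections => /=.
  by rewrite (big_morph fst (id1 := 0) (op1 := +%R))//= [LHS]row_sum_delta.
rewrite (big_morph snd (id1 := 0) (op1 := +%R))//= big1// => i _.
by rewrite scaler0.
Qed.

Lemma mulc_derive_coords (y Y : E) : differentiable m (o, y) ->
  'D_(Y, (0 : E)) m (o, y) = \sum_(i < n) Y ord0 i *: 'D_(delta i, (0 : E)) m (o, y).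
Proof.
move=> dm; rewrite (deriveE _ dm) pair_row_sum_delta linear_sum.
by apply: eq_bigr => i _; rewrite linearZ /= (deriveE _ dm).
Qed.

(** Differentiate the identity [Ad_mulc] at [y = o] in the direction [X]. The right side gives
    [D2 (X, 0) (0, Z)]; the left side gives the derivative of [Ad (psi y) Z] plus
    [D2 (0, X) (Z, 0)], which symmetry turns into [D2 (Z, 0) (0, X)]. The difference of the [D2]
    terms is [lie_bracketE]. *)
Lemma Ad_diff Z : is_diff (o : E) (fun y : E => Ad (psi y) Z : E) (fun X => lie_bracket H
  X Z).
Proof.
have [_] := smooth_mdifferentiable (Ad_smooth Z e).
rewrite /in_coord /= => dA; split=> //; apply/funext => X.
pose A (y : E) := Ad (psi y) Z : E.
have Ao : A o = Z by rewrite /A (psi_o H) Ad1.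
have [W [oW Wo] sW] := mulc_smooth H.
have dA' : is_diff (o : E) A ('d A (o : E)) by exact: differentiableP.
have dmi (i : 'I_n) : is_diff (o : E) (fun y : E => 'D_(delta i, (0 : E)) m (o, y))
    (fun X => D2 (0, X) (delta i, 0)).
  have d := mulc_diff2 (delta i, 0).
  have -> : (fun X => D2 (0, X) (delta i, 0)) =
      'd (fun z => 'D_(delta i, (0 : E)) m z) (o, o) \o (fun v => (0, v)).
    by apply/funext => Y; exact: (deriveE _ d).
  exact: (is_diff_comp (is_diff_inr (o : E) (o : E)) (differentiableP d)).
(* Direction and base point both depend on [y]; expanding the direction in the standard basis
   separates them for the product rule. *)
have L1 := is_diff_sum (index_enum 'I_n)
  (fun i => is_diff_scale (is_diff_coord i dA') (dmi i)).
have L2 : \forall y \near (o : E), 'D_((0 : E), Z) m (y, o) =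
    \sum_(i < n) A y ord0 i *: 'D_(delta i, (0 : E)) m (o, y).
  have [_ N2] := mulc_near (open_nbhs_nbhs (conj oW Wo)).
  have N3 := Ad_mulc Z.
  near=> y; rewrite -(near N3 y)//.
  have d2 : differentiable m (o, y) by apply: Ck_diff (sW 1%N) _; exact: (near N2 y).
  exact: mulc_derive_coords.
have v1 := @diff_val _ _ _ _ _ _ _ (near_is_diff L2 (left_field_diff Z)).
have v12 := congr1 (@^~ X) (etrans (esym v1) (@diff_val _ _ _ _ _ _ _ L1)).
move: v12 => /= v12.
have dmo (i : 'I_n) : 'D_(delta i, (0 : E)) m (o, o) = delta i.
  by rewrite (is_diff_derive _ (mulc_is_diff H)) /= addr0.
have S (i : 'I_n) : D2 (0, X) (delta i, 0) = 'd (fun z => 'D_((0 : E), X) m z) (o, o)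
  (delta i, 0).
  rewrite -(deriveE _ (mulc_diff2 (0, X))).
  exact: (derive_swap _ _ oW Wo (sW 2%N)).
rewrite lie_bracketE v12.
under eq_bigr => i _ do rewrite dmo S.
rewrite big_split /= -row_sum_delta.
rewrite addrAC [X in X + _](_ : _ = 0) ?add0r//.
apply/eqP; rewrite subr_eq0; apply/eqP.
rewrite /D2 (deriveE _ (mulc_diff2 (0, X))).
rewrite pair_row_sum_delta Ao.
by rewrite linear_sum; apply: eq_bigr => i _; rewrite linearZ.
Unshelve. all: by end_near. Qed.

End Bracket.

Section Estimates.
Context {R : realType}.

(** Converse of [is_derive_approx]: it produces a derivative from estimates alone, which is all that
    is available for the parameter [s]. *)
Lemma approx_is_derive (F : normedModType R) (f : R -> F) (t : R) (X : F) :
  (forall c : R, 0 < c ->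
    \forall d \near (0 : R), `|f (t + d) - f t - d *: X| <= c * `|d|) ->
  is_derive t 1 f X.
Proof.
move=> H.
have lin : linear (fun v : R^o => v *: X).
  by move=> a u v /=; rewrite scalerDl scalerA.
pose l : {linear R^o -> F} := HB.pack (fun v : R^o => v *: X)
  (GRing.isLinear.Build _ _ _ _ _ lin).
have cl : continuous l by move=> v; exact: scalel_continuous.
have fE : (f : R^o -> F) \o shift t = cst (f t) + l +o_ (0 : R^o) id.
  apply/eqaddoP => c c0; apply: filterS (H c c0) => d.
  by rewrite !fctE /= [d + t]addrC opprD addrA.
have eqd : 'd (f : R^o -> F) t = l :> (R^o -> F) by exact: diff_unique.
have df : differentiable (f : R^o -> F) t by apply/diff_locallyP; rewrite eqd; split.
have dfl : is_diff (t : R^o) (f : R^o -> F) l by split.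
have := is_diff_is_derive dfl.
by rewrite /l /= scale1r.
Qed.

End Estimates.

(** * Logarithmic derivatives and the adjoint action *)

Section Logarithmic.
Context {R : realType} {n : nat} (H : lie_group R n).
Let E := 'rV[R]_n.
Implicit Types g h k : H.
Local Notation e := (lg1 H).
Local Notation phi := (chart e).
Local Notation psi := (chartV e).
Local Notation o := (chart (lg1 H) (lg1 H)).
Local Notation "g ** h" := (lgM g h) (at level 40, left associativity).
Local Notation "g ^i" := (lgV g) (at level 3, format "g ^i").
Local Notation delta i := (delta_mx ord0 i : 'rV[R]_n).
Let m : E * E -> E := mulc H.

(** By [Ad_diff] the bracket is a differential in its first argument, hence linear there; linearity
    in the second is inherited from [Ad] in [lie_bracket_coords]. *)
Lemma lie_bracketNl X Z : lie_bracket H (- X) Z = - lie_bracket H X Z.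
Proof.
have [_ dA] := Ad_diff H Z.
have := linearN ('d (fun y : E => Ad (psi y) Z : E) (o : E)) X.
by rewrite -[LHS](congr1 (@^~ (- X)) (esym dA)) -[in RHS](congr1 (@^~ X) (esym dA)).
Qed.

(** [(h r)^-1] is [(h t)^-1] times the inverse of [h r (h t)^-1]. The second factor passes through
    the unit with derivative [- X], so [Ad_diff] applies; the fixed linear map of the first factor
    is composed afterwards. *)
Lemma rlog_Ad (h : R -> H) t X Z : rlog h t X ->
  is_derive t 1 (fun r => Ad (h r)^i Z : E) (- Ad (h t)^i (lie_bracket H X Z)).
Proof.
move=> Rh; have Tk := tangent_inv Rh; have [kc ke dk] := Tk.
have dA : is_diff (phi ((h t ** (h t)^i)^i) : E) (fun y : E => Ad (psi y) Z : E)
    (fun X => lie_bracket H X Z).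
  by rewrite ke; exact: Ad_diff.
have d1 := is_derive_comp dk dA; rewrite lie_bracketNl in d1.
have dL : is_diff (Ad (psi (phi ((h t ** (h t)^i)^i))) Z : E) (AdL (h t)^i) (AdL (h t)^i).
  apply: DiffDef; last by rewrite diff_lin//; exact: Ad_continuous.
  by apply: linear_differentiable; exact: Ad_continuous.
have := is_derive_comp d1 dL; rewrite linearN /=.
apply: near_eq_is_derive; near=> r.
have Nr : psi (phi ((h r ** (h t)^i)^i)) = (h r ** (h t)^i)^i.
  by exact: (near (tangent_near Tk) r).
rewrite Nr /AdL /= -Ad_mul; apply: (congr1 (fun g => Ad g Z)).
by rewrite lgVMM lgVK lgMA lgVM lg1M.
Unshelve. all: by end_near. Qed.

Lemma Ad_coords g (Z : E) : Ad g Z = \sum_(i < n) Z ord0 i *: Ad g (delta i).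
Proof.
rewrite [in LHS](row_sum_delta Z) -[Ad g]/(AdL g : _ -> _) linear_sum.
by apply: eq_bigr => i _; rewrite linearZ.
Qed.

Lemma lie_bracket_coords X (Z : E) :
  lie_bracket H X Z = \sum_(i < n) Z ord0 i *: lie_bracket H X (delta i).
Proof.
have L := is_diff_sum (index_enum 'I_n)
  (fun i => is_diffZ (Z ord0 i) (Ad_diff H (delta i))).
have eqf : (fun y : E => \sum_(i < n) (Z ord0 i *: (fun y : E => Ad (psi y) (delta i) :
  E)) y) =
    (fun y : E => Ad (psi y) Z : E).
  by apply/funext => y; rewrite [in RHS]Ad_coords.
rewrite eqf in L.
have v := etrans (esym (@diff_val _ _ _ _ _ _ _ (Ad_diff H Z))) (@diff_val _ _ _ _ _ _ _ L).
exact: (congr1 (@^~ X) v).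
Qed.

(** Product rule: expanding [Z] in the standard basis leaves [Ad] to be differentiated on constant
    vectors only. *)
Lemma rlog_Ad_curve (h : R -> H) (Z : R -> E) t X Z' : rlog h t X ->
  is_derive t 1 Z Z' ->
  is_derive t 1 (fun r => Ad (h r)^i (Z r) : E)
    (Ad (h t)^i (Z' - lie_bracket H X (Z t))).
Proof.
move=> Rh /is_derive_is_diff dZ.
have L := is_diff_sum (index_enum 'I_n) (fun i =>
  is_diff_scale (is_diff_coord i dZ) (is_derive_is_diff (rlog_Ad (delta i) Rh))).
have := is_diff_is_derive L.
have -> : (fun y => \sum_(i < n) Z y ord0 i *: Ad (h y)^i (delta i)) =
    (fun r => Ad (h r)^i (Z r)).
  by apply/funext => r; rewrite [in RHS]Ad_coords.
set D := (X in is_derive _ _ _ X) => dD.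
suff <- : D = Ad (h t)^i (Z' - lie_bracket H X (Z t)) by [].
rewrite /D big_split /= -[Ad (h t)^i (_ - _)]/(AdL (h t)^i _) linearB /= addrC.
congr (_ + _).
  rewrite [in RHS]Ad_coords; apply: eq_bigr => i _.
  by rewrite mxE mul1r.
rewrite lie_bracket_coords -[Ad (h t)^i (\sum_(_ < _) _)]/(AdL (h t)^i _).
rewrite linear_sum -sumrN; apply: eq_bigr => i _.
by rewrite scale1r linearZ /= scalerN.
Qed.

(** Near [t] the point [k r] is the product of [k r (k t)^-1], close to the unit, with the fixed
    [k t]. This turns the logarithmic derivative into an ordinary one while [k t] is in the domain
    of the chart. *)
Lemma rlog_phi (k : R -> H) t Y : rlog k t Y -> dom e (k t) ->
  differentiable m (o, phi (k t)) ->
  is_derive t 1 (fun r => phi (k r) : E) ('D_(Y, (0 : E)) m (o, phi (k t))).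
Proof.
move=> Rk dkt dm; have [c ke dk] := Rk.
have L := is_diff_comp (is_diff_inl (o : E) (phi (k t) : E)) (differentiableP dm).
have L' : is_diff (phi (k t ** (k t)^i) : E) (m \o (fun z => (z, phi (k t) : E)))
    ('d m (o, phi (k t)) \o (fun v => (v, 0))).
  by rewrite ke; exact: L.
have := is_derive_comp dk L'; rewrite /= -(deriveE _ dm).
apply: near_eq_is_derive; near=> r.
have Nr : psi (phi (k r ** (k t)^i)) = k r ** (k t)^i.
  by exact: (near (tangent_near Rk) r).
by rewrite /m /mulc /= Nr (dom_chartK dkt) lgMVK.
Unshelve. all: by end_near. Qed.

End Logarithmic.

(** * First-order variation of curves with prescribed logarithmic derivative *)

Section Variation.
Context {R : realType} {n : nat} (H : lie_group R n).
Let E := 'rV[R]_n.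
Implicit Types g k : H.
Local Notation e := (lg1 H).
Local Notation phi := (chart e).
Local Notation psi := (chartV e).
Local Notation o := (chart (lg1 H) (lg1 H)).
Local Notation "g ** h" := (lgM g h) (at level 40, left associativity).
Local Notation "g ^i" := (lgV g) (at level 3, format "g ^i").
Local Notation delta i := (delta_mx ord0 i : 'rV[R]_n).
Let okH := ok_manifold H.
Let m : E * E -> E := mulc H.

(** At [y = o] the map sending [Y] to ['D_(Y, 0) m (o, y)] is the identity, and it depends
    continuously on [y]. *)
Lemma mulc_radius (c : R) : 0 < c -> exists2 r : R, 0 < r & forall y : E, `|y - o| < r ->
  [/\ dom e (psi y), differentiable m (o, y) &
      forall Y : E, `|'D_(Y, (0 : E)) m (o, y) - Y| <= c * `|Y|].
Proof.
move=> c0; have [W [oW Wo] sW] := mulc_smooth H.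
have [_ N1] := mulc_near (open_nbhs_nbhs (conj oW Wo)).
have N2 := near_chartV okH (nbhs_dom e).
(* The [n] coordinate errors then add up to at most [n / n.+1] of [c]; the successor also covers
   [n = 0]. *)
have c' : 0 < c / n.+1%:R by rewrite divr_gt0.
have N3 (i : 'I_n) : \forall y \near (o : E),
    `|'D_(delta i, (0 : E)) m (o, y) - delta i| <= c / n.+1%:R.
  have c1 : {for (o : E), continuous (fun y : E => 'D_(delta i, (0 : E)) m (o, y))}.
    apply: differentiable_continuous.
    have d := mulc_diff2 H (delta i, 0).
    by have [] := is_diff_comp (is_diff_inr (o : E) (o : E)) (differentiableP d).
  move/cvgrPdist_le : c1 => /(_ _ c'); apply: filterS => y.
  rewrite (is_diff_derive _ (mulc_is_diff H)) /= addr0 distrC.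
  exact.
have N3' : \forall y \near (o : E), forall i : 'I_n,
    `|'D_(delta i, (0 : E)) m (o, y) - delta i| <= c / n.+1%:R.
  exact: (@filter_forall E 'I_n (fun i y => `|'D_(delta i, (0 : E)) m (o, y) - delta i| <=
    c / n.+1%:R) (nbhs (o : E)) _ N3).
have : \forall y \near (o : E), [/\ dom e (psi y), W (o, y) & forall i : 'I_n,
    `|'D_(delta i, (0 : E)) m (o, y) - delta i| <= c / n.+1%:R].
  by near=> y; split; [exact: (near N2 y)|exact: (near N1 y)|exact: (near N3' y)].
move=> /nbhs_ballP[r /= r0 Hr]; exists r => // y yr.
have [dy Wy Dy] : [/\ dom e (psi y), W (o, y) & forall i : 'I_n,
    `|'D_(delta i, (0 : E)) m (o, y) - delta i| <= c / n.+1%:R].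
  by apply: Hr; rewrite -ball_normE /= distrC.
have dm : differentiable m (o, y) by exact: Ck_diff (sW 1%N) Wy.
split=> // Y; rewrite (mulc_derive_coords _ dm) [X in _ - X]row_sum_delta -sumrB.
apply: le_trans (ler_norm_sum _ _ _) _.
apply: (@le_trans _ _ (\sum_(i < n) `|Y| * (c / n.+1%:R))).
  apply: ler_sum => i _; rewrite -scalerBr normrZ.
  by apply: ler_pM (rV_coord_norm _ _) (Dy i).
have -> : \sum_(i < n) `|Y| * (c / n.+1%:R) = c * `|Y| * (n%:R / n.+1%:R).
  by rewrite sumr_const card_ord -mulr_natr; ring.
rewrite ler_piMr ?mulr_ge0 ?(ltW c0)//.
by rewrite ler_pdivrMr// mul1r ler_nat.
Unshelve. all: by end_near. Qed.

(** Serves to re-enter the chart in [log_bound], where an element is known only as a product of two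
    elements close to the unit. *)
Lemma mul_radius : exists2 r : R, 0 < r & forall x y : E,
  `|x - o| < r -> `|y - o| < r -> dom e (psi x ** psi y).
Proof.
have c1 : {for (o : E), continuous (fun x : E => psi x : H)} by exact: ok_chartV_cont.
have cm : {for ((o, o) : E * E), continuous (fun z : E * E => psi z.1 ** psi z.2)}.
  apply: (@continuous_lgM _ _ _ _ (fun z : E * E => psi z.1) (fun z => psi z.2)).
    by apply: (@continuous_comp _ _ _ fst (psi : E -> H)); [exact: cvg_fst|exact: c1].
  by apply: (@continuous_comp _ _ _ snd (psi : E -> H)); [exact: cvg_snd|exact: c1].
have : \forall z \near ((o, o) : E * E), dom e (psi z.1 ** psi z.2).
  have ne : nbhs (psi (o, o).1 ** psi (o, o).2) (dom e).
    by rewrite /= psi_o lgM1; exact: nbhs_dom.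
  exact: (cm (dom e) ne).
move=> /nbhs_ballP[r /= r0 Hr]; exists r => // x y xr yr.
by apply: (Hr (x, y)); split; rewrite -ball_normE /= distrC.
Qed.

(* Continuation in [t]: at a limit time [t], [k t] is [k t (k q)^-1] times [k q] for
   [q < t] close to [t], a product of two elements close to the unit. *)
Lemma log_bound (a b c r : R) (k : R -> H) (Y : R -> E) :
  0 < r -> 2 * c * (b - a) < r -> k a = e ->
  (forall x y : E, `|x - o| < r -> `|y - o| < r -> dom e (psi x ** psi y)) ->
  (forall y : E, `|y - o| < r -> [/\ dom e (psi y), differentiable m (o, y) &
      forall Z : E, `|'D_(Z, (0 : E)) m (o, y) - Z| <= `|Z|]) ->
  (forall t, a <= t <= b -> rlog k t (Y t) /\ `|Y t| <= c) ->
  forall t, a <= t <= b -> dom e (k t) /\ `|phi (k t) - o| < r.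
Proof.
move=> r0 cr ka Hmul Hr HY.
have dphi t : a <= t <= b -> dom e (k t) /\ `|phi (k t) - o| < r ->
    is_derive t 1 (fun r => phi (k r) : E) ('D_(Y t, (0 : E)) m (o, phi (k t))).
  move=> abt [dk kr]; have [_ dm _] := Hr _ kr.
  by apply: rlog_phi => //; have [] := HY t abt.
(* The factor [2] arises because the derivative in the chart differs from [Y t] by at most the norm
   of [Y t]. *)
have Dphi t : a <= t <= b -> dom e (k t) /\ `|phi (k t) - o| < r ->
    `|'D_(Y t, (0 : E)) m (o, phi (k t))| <= 2 * c.
  move=> abt [dk kr]; have [_ _ dm] := Hr _ kr.
  have [_ Yc] := HY t abt; rewrite -(subrK (Y t) ('D_(_) _ _)).
  apply: le_trans (ler_normD _ _) _; rewrite mulrDl mul1r lerD//.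
  exact: le_trans (dm _) Yc.
have kc t : a <= t <= b -> {for t, continuous k}.
  move=> abt; have [[c1 _ _] _] := HY t abt.
  have := continuous_lgM c1 (@cst_continuous R H (k t) t).
  rewrite /prop_for /continuous_at lgMVK; apply: cvg_trans; apply: near_eq_cvg.
  by near=> q; rewrite lgMVK.
apply: real_induction => t abt IH; have /andP[at_ tb] := abt.
  move: (at_); rewrite le_eqVlt => /predU1P[<-|lat].
    by rewrite ka subrr normr0; split=> //; exact: dom_self.
  have bound q : a <= q < t -> `|phi (k q) - o| <= 2 * c * (b - a).
    move=> /andP[aq qt].
    have Pq s : a <= s <= q -> a <= s <= b /\ (dom e (k s) /\ `|phi (k s) - o| < r).
      move=> /andP[as_ sq]; split; first by rewrite as_ (le_trans sq)// (le_trans (ltW qt)).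
      by apply: IH; rewrite as_ (le_lt_trans sq).
    have := @mean_value_le_derive _ _ (fun s => phi (k s) : E)
      (fun s => 'D_(Y s, (0 : E)) m (o, phi (k s))) a q (2 * c) aq.
    rewrite ka => /(_ _ _)/le_trans; apply.
    - by move=> s /Pq[abs Ps]; exact: dphi.
    - by move=> s /Pq[abs Ps]; exact: Dphi.
    - have c0 : 0 <= 2 * c.
        by rewrite mulr_ge0//; apply: le_trans (HY t abt).2.
      by rewrite ler_wpM2l// lerD2r (le_trans (ltW qt)).
  have ck := kc t abt.
  have cq : {for t, continuous (fun q => k t ** (k q)^i)}.
    by apply: continuous_lgM; [exact: cst_continuous|exact: continuous_lgV].
  have nq : \forall q \near t, dom e (k t ** (k q)^i) /\ `|phi (k t ** (k q)^i) - o| < r.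
    have ne : nbhs (k t ** (k t)^i) [set x | dom e x /\ `|phi x - o| < r].
      rewrite lgMV; apply: filterI; first exact: nbhs_dom.
      have cphi : {for e, continuous (phi : H -> E)} by exact: ok_chart_cont.
      move/cvgrPdist_lt : cphi => /(_ _ r0).
      by apply: filterS => x /=; rewrite distrC.
    exact: (cq _ ne).
  have dkt : dom e (k t).
    have [q [/andP[aq qt] [dq rq]]] : exists q, a <= q < t /\
        (dom e (k t ** (k q)^i) /\ `|phi (k t ** (k q)^i) - o| < r).
      move/nbhs_ballP : nq => [d /= d0 Hd].
      exists (t - Num.min (d / 2) (t - a)).
      have m0 : 0 < Num.min (d / 2) (t - a) by rewrite lt_min divr_gt0//= subr_gt0.
      rewrite lerBrDr -lerBrDl ge_min lexx orbT ltrBlDr ltrDl m0; split=> //.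
      apply: Hd; rewrite /ball /= opprB addrC subrK gtr0_norm//.
      by rewrite gt_min ltr_pdivrMr// ltr_pMr// ltr1n.
    have [dkq rkq] := IH q (introT andP (conj aq qt)).
    by have := Hmul _ _ rq rkq; rewrite (dom_chartK dq) (dom_chartK dkq) lgMVK.
  split=> //.
  (* Half of the slack between the integrated bound and [r], so that the strict inequality survives
     the passage to the limit time [t]. *)
  pose c' := (r - 2 * c * (b - a)) / 2.
  have c'0 : 0 < c' by rewrite divr_gt0// subr_gt0.
  have cpk : {for t, continuous (fun q => phi (k q) : E)}.
    by apply: (@continuous_comp _ _ _ k (phi : H -> E)) => //; exact: dom_chart_cont.
  move/cvgrPdist_lt : cpk => /(_ _ c'0)/nbhs_ballP[d /= d0 Hd].
  pose q := t - Num.min (d / 2) (t - a).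
  have m0 : 0 < Num.min (d / 2) (t - a) by rewrite lt_min divr_gt0//= subr_gt0.
  have aqt : a <= q < t.
    by rewrite /q lerBrDr -lerBrDl ge_min lexx orbT ltrBlDr ltrDl m0.
  have tq : `|phi (k t) - phi (k q)| < c'.
    apply: Hd; rewrite /ball /= opprB addrC subrK gtr0_norm//.
    by rewrite gt_min ltr_pdivrMr// ltr_pMr// ltr1n.
  rewrite -(subrKA (phi (k q))); apply: le_lt_trans (ler_normD _ _) _.
  have := bound q aqt => bq.
  have := ltr_leD tq bq => /lt_trans; apply.
  by rewrite /c'; lra.
have abt' : a <= t <= b by rewrite at_ ltW.
have [dkt rkt] := IH t (introT andP (conj at_ (lexx t))).
have N1 : \forall q \near t, dom e (k q) by exact: (kc t abt' _ (nbhs_dom_of dkt)).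
have N2 : \forall q \near t, `|phi (k q) - o| < r.
  have cpk : {for t, continuous (fun q => phi (k q) : E)}.
    apply: (@continuous_comp _ _ _ k (phi : H -> E)); first exact: kc.
    exact: dom_chart_cont.
  have r1 : 0 < r - `|phi (k t) - o| by rewrite subr_gt0.
  move/cvgrPdist_lt : cpk => /(_ _ r1); apply: filterS => q.
  rewrite distrC => H1; rewrite -(subrKA (phi (k t))).
  by apply: le_lt_trans (ler_normD _ _) _; rewrite -ltrBrDr.
have /nbhs_ballP[d /= d0 Hd] : \forall q \near t, dom e (k q) /\ `|phi (k q) - o| < r.
  exact: filterI.
exists d => // q /andP[tq qd] qb; apply: Hd.
by rewrite /ball /= distrC gtr0_norm ?subr_gt0// ltrBlDl.
Unshelve. all: by end_near. Qed.

(* [I] is the set of parameters for which [h] is given; [K] extends the curve of the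
   [(h s b)^-1 h (s + d) b] to all [d], so that its derivative makes sense at the
   end points of [I]. *)
Lemma log_curve_parameter_derivative (a b s : R) (I : set R) (h : R -> R -> H) (X : R -> R -> E)
    (J : R -> E) (f : R^o * R^o -> E) :
  f = (fun z : R^o * R^o => Ad (h s z.1)^i (X z.1 z.2)) ->
  a < b -> I s -> (forall r, I r -> h r a = e) ->
  (forall r t, I r -> a <= t <= b -> rlog (h r) t (X t r)) ->
  (forall t, a <= t <= b -> (\forall z \near ((t, s) : R^o * R^o), differentiable f z) /\
     {for ((t, s) : R^o * R^o), continuous (fun z => 'D_((0, 1) : R^o * R^o) f z)}) ->
  J a = 0 ->
  (forall t, a <= t <= b -> is_derive t 1 J ('D_((0, 1) : R^o * R^o) f (t, s))) ->
  exists K : R -> E, [/\ K 0 = o, is_derive (0 : R) 1 K (J b) &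
    \forall d \near (0 : R), I (s + d) -> (h s b)^i ** h (s + d) b = psi (K d)].
Proof.
move=> fE ab Is h1 hX Hf J0 dJ.
pose D (t : R) := 'D_((0, 1) : R^o * R^o) f (t, s).
have cov : near_covering `[a, b]%classic.
  by apply/compact_near_coveringP; exact: segment_compact.
(* Boundedness on a compact interval: near-covering along the filter at [+oo] selects one constant
   for all times. *)
have [C C0 HC] : exists2 C : R, 0 < C & forall t, a <= t <= b -> `|D t| <= C.
  have [C0 [_ HC]] : \forall C \near +oo, `[a, b]%classic `<=` (fun t => `|D t| <= C).
    apply: (cov R (pinfty_nbhs R) (fun C t => `|D t| <= C)).
    move=> t; rewrite /= in_itv /= => abt; have [_ cD] := Hf t abt.
    have cDt : {for t, continuous D}.
      apply: (@continuous_comp _ _ _ (fun t : R => (t, s) : R^o * R^o)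
        (fun z => 'D_((0, 1) : R^o * R^o) f z)) => //.
      by apply: continuous_for_pair; [exact: cvg_id|exact: cst_continuous].
    move/cvgrPdist_le : cDt => /(_ 1 ltr01) N1.
    exists ([set q | `|D t - D q| <= 1], [set C | `|D t| + 1 < C]) => /=.
      by split=> //; exact: nbhs_pinfty_gt.
    move=> [q C] /= [H1 H2]; rewrite -(subrK (D t) (D q)).
    apply: le_trans (ler_normD _ _) _; rewrite distrC addrC.
    by apply: le_trans (ltW H2); rewrite lerD2l.
  exists (Num.max (C0 + 1) 1); first by rewrite lt_max ltr01 orbT.
  move=> t abt; apply: (HC (Num.max (C0 + 1) 1)).
    by rewrite lt_max ltrDl ltr01.
  by rewrite /= in_itv.
pose g (t d : R) := f (t, s + d) - f (t, s).
(* The same compactness makes the joint estimate of [strict_derive] around each [(t, s)] uniform in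
   [t]. *)
have U1 (c : R) : 0 < c -> \forall d \near (0 : R), forall t, a <= t <= b ->
    `|g t d - d *: D t| <= c * `|d|.
  move=> c0.
  have HH : \forall d \near (0 : R), `[a, b]%classic `<=`
      (fun t => `|g t d - d *: D t| <= c * `|d|).
    apply: (cov R (nbhs (0 : R)) (fun d t => `|g t d - d *: D t| <= c * `|d|)) => t.
    rewrite /= in_itv /= => abt; have [df cD] := Hf t abt.
    have [[A B] /= [nA nB] AB] := strict_derive df cD c0.
    exists ([set q : R | A (q, s)], B) => /=.
      split=> //; have cp : {for t, continuous (fun t : R => (t, s) : R^o * R^o)}.
        by apply: continuous_for_pair; [exact: cvg_id|exact: cst_continuous].
      exact: (cp _ nA).
    move=> [q d] /= [Aq Bd]; have := AB ((q, s), d) (conj Aq Bd) => /=.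
    have -> : (q, s) + d *: ((0, 1) : R^o * R^o) = (q, s + d).
      by apply: injective_projections; rewrite /= ?scaler0 ?addr0// [_ *: 1]mulr1.
    exact.
  by apply: filterS HH => d HH t abt; apply: HH; rewrite /= in_itv.
pose k (d t : R) := (h s t)^i ** h (s + d) t.
(* The inverse of [h s] contributes [- Ad (h s t)^-1 (X t s)]; together with the contribution of
   [h (s + d)] this is the increment of [f]. *)
have kX d t : I (s + d) -> a <= t <= b -> rlog (k d) t (g t d).
  move=> Isd abt; have := rlog_mul (rlog_inv (hX s t Is abt)) (hX (s + d) t Isd abt).
  have -> : g t d = - Ad (h s t)^i (X t s) + Ad (h s t)^i (X t (s + d)).
    by rewrite /g fE /= addrC.
  exact.
have k1 d : I (s + d) -> k d a = e by move=> Isd; rewrite /k !h1// lgV1 lgM1.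
have [r2 r20 Hmul] := mul_radius.
have ba : 0 < b - a by rewrite subr_gt0.
have main (c : R) : 0 < c -> \forall d \near (0 : R), I (s + d) ->
    dom e (k d b) /\ `|phi (k d b) - o - d *: J b| <= c * `|d|.
  move=> c0.
  (* The first entry brings the final error, [c1 * (C + 2) * (b - a)] times the norm of [d], below
     [c] times that norm; the bound by [1] provides the estimate on [mulc] that [log_bound] asks
     for. *)
  pose c1 := Num.min (c / ((C + 2) * (b - a))) 1.
  have C20 : 0 < C + 2 by rewrite addr_gt0.
  have c10 : 0 < c1 by rewrite lt_min ltr01 andbT divr_gt0// mulr_gt0.
  have [r1 r10 Hr] := mulc_radius c10.
  pose r := Num.min r1 r2.
  have r0 : 0 < r by rewrite lt_min r10.
  have N1 := U1 _ c10; have N2 := U1 _ ltr01.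
  (* Since [g t d] is at most [C + 1] times the norm of [d], such a [d] keeps the curve [k d] in the
     ball of radius [r]. *)
  have N3 : \forall d \near (0 : R), 2 * ((C + 1) * `|d|) * (b - a) < r.
    exists (r / (2 * (C + 1) * (b - a))) => /=.
      by rewrite divr_gt0// !mulr_gt0// addr_gt0.
    move=> d /=; rewrite sub0r normrN ltr_pdivlMr; last first.
      by rewrite !mulr_gt0// addr_gt0.
    by apply: le_lt_trans; rewrite le_eqVlt; apply/orP; left; apply/eqP; ring.
  near=> d => Isd.
  have n1 : forall t, a <= t <= b -> `|g t d - d *: D t| <= c1 * `|d|.
    exact: (near N1 d).
  have n2 : forall t, a <= t <= b -> `|g t d - d *: D t| <= 1 * `|d|.
    exact: (near N2 d).
  have n3 : 2 * ((C + 1) * `|d|) * (b - a) < r by exact: (near N3 d).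
  have gb t : a <= t <= b -> `|g t d| <= (C + 1) * `|d|.
    move=> abt; rewrite -(subrK (d *: D t) (g t d)).
    apply: le_trans (ler_normD _ _) _; rewrite mulrDl addrC lerD//; last exact: n2.
    by rewrite normrZ mulrC ler_wpM2r// HC.
  have rr1 (y : E) : `|y - o| < r -> `|y - o| < r1.
    by move=> yr; apply: lt_le_trans yr _; rewrite ge_min lexx.
  have rr2 (y : E) : `|y - o| < r -> `|y - o| < r2.
    by move=> yr; apply: lt_le_trans yr _; rewrite ge_min lexx orbT.
  have LB := @log_bound a b ((C + 1) * `|d|) r (k d) (fun t => g t d) r0 n3 (k1 d Isd)
    (fun x y xr yr => Hmul x y (rr2 _ xr) (rr2 _ yr)).
  have {}LB : forall t, a <= t <= b -> dom e (k d t) /\ `|phi (k d t) - o| < r.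
    apply: LB => [y /rr1/Hr[dy dm Dm]|t abt]; last by split; [exact: kX|exact: gb].
    split=> // Z; apply: le_trans (Dm Z) _; rewrite ler_piMl//.
    by rewrite ge_min lexx orbT.
  have bb : a <= b <= b by rewrite (ltW ab) lexx.
  split; first by have [] := LB b bb.
  (* Two errors enter this derivative: the deviation of the chart from a linear one, [c1] times the
     bound on [g t d], and the linearisation error of [g t d], at most [c1] times the norm of
     [d]. *)
  have dF t : a <= t <= b -> is_derive t 1 (fun t => (phi (k d t) : E) - d *: J t)
      ('D_(g t d, (0 : E)) m (o, phi (k d t)) - d *: D t).
    move=> abt; have [dk /rr1/Hr[_ dm _]] := LB t abt.
    have L1 := rlog_phi (kX d t Isd abt) dk dm.
    have L2 := dJ t abt.
    exact: (is_deriveB L1 (is_deriveZ _ L2)).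
  have := @mean_value_le_derive _ _ _ _ a b (c1 * (C + 2) * `|d|) (ltW ab) dF.
  rewrite (k1 d Isd) J0 scaler0 subr0 addrAC => /(_ _)/le_trans; apply.
    move=> t abt; have [dk /rr1/Hr[_ dm Dm]] := LB t abt.
    rewrite -(subrKA (g t d)); apply: le_trans (ler_normD _ _) _.
    have -> : c1 * (C + 2) * `|d| = c1 * ((C + 1) * `|d|) + c1 * `|d| by ring.
    apply: lerD; last exact: n1.
    by apply: le_trans (Dm _) _; rewrite ler_wpM2l ?gb// ltW.
  have -> : c1 * (C + 2) * `|d| * (b - a) = c1 * ((C + 2) * (b - a)) * `|d| by ring.
  rewrite ler_wpM2r// -ler_pdivlMr ?mulr_gt0//.
  by rewrite ge_min lexx.
(* Off the parameter set the affine curve with slope [J b] is used, which gives the right two-sided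
   derivative at [0] even if [s] is an end point. *)
pose K (d : R) : E := if asbool (I (s + d)) then phi (k d b) else o + d *: J b.
have K0 : K 0 = o.
  rewrite /K addr0 asboolT// /k addr0 lgVM; exact: erefl.
exists K; split=> //.
  apply: approx_is_derive => c c0; apply: filterS (main c c0) => d Hd.
  rewrite add0r K0 /K; case: asboolP => [Isd|_]; first by have [] := Hd Isd.
  by rewrite addrAC addrK subrr normr0 mulr_ge0// ltW.
apply: filterS (main 1 ltr01) => d Hd Isd.
by rewrite /K asboolT//; have [/dom_chartK -> _] := Hd Isd.
Unshelve. all: by end_near. Qed.

End Variation.

(** * Primitives of continuous functions on a closed interval *)

Section Primitive.
Context {R : realType}.
Local Notation mu := (@lebesgue_measure R).

Lemma continuous_primitive (f : R -> R) (a b : R) : a < b ->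
  (forall t, a <= t <= b -> {for t, continuous f}) ->
  exists F : R -> R, forall t, a <= t <= b -> is_derive t 1 F (f t).
Proof.
(* Freezing [f] at its end values makes it continuous on the whole line. *)
move=> ab cf; pose g t := f (Num.max a (Num.min t b)).
have gf t : a <= t <= b -> g t = f t.
  by move=> /andP[at_ tb]; rewrite /g (min_idPl tb) (max_idPr at_).
have cg : continuous g.
  move=> t; apply: (@continuous_comp _ _ _ (fun t : R => Num.max a (Num.min t b)) f).
    apply: (@continuous_max _ _ (fun=> a) (fun t => Num.min t b)); first exact:
      cst_continuous.
    by apply: (@continuous_min _ _ id (fun=> b)); [exact: cvg_id|exact: cst_continuous].
  apply: cf; rewrite le_max lexx /= ge_max (ltW ab) /=.
  by rewrite ge_min lexx orbT.
(* Starting the integral at [a - 1] makes [a] an interior point, so the derivative there is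
   two-sided. *)
exists (fun x => \int[mu]_(t in `[a - 1, x]) g t)%R => t /andP[at_ tb].
have tb1 : t < b + 1 by rewrite (le_lt_trans tb)// ltrDl.
have ig : mu.-integrable `[a - 1, b + 1] (EFin \o g).
  apply: continuous_compact_integrable; first exact: segment_compact.
  exact: continuous_subspaceT.
have at1 : a - 1 < t by rewrite (lt_le_trans _ at_)// ltrBlDr ltrDl.
have [d1 d2] := continuous_FTC1_closed tb1 ig at1 (cg t).
apply: DeriveDef => //; rewrite -derive1E d2 gf//.
by rewrite at_.
Qed.

Lemma FTC2_closed (f F : R -> R) (a b : R) : a < b ->
  (forall t, a <= t <= b -> {for t, continuous f}) ->
  (forall t, a <= t <= b -> is_derive t 1 F (f t)) ->
  (\int[mu]_(t in `[a, b]) f t = F b - F a)%R.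
Proof.
move=> ab cf dF; rewrite /Rintegral (@continuous_FTC2 _ f F)//.
- apply: continuous_in_subspaceT => t.
  by rewrite inE /= in_itv /=; exact: cf.
- have cF t : a <= t <= b -> {for t, continuous F}.
    by move=> /dF[dFt _]; apply: differentiable_continuous; exact/derivable1_diffP.
  split.
  + move=> t; rewrite in_itv /= => /andP[at_ tb].
    by have [] := dF t (introT andP (conj (ltW at_) (ltW tb))).
  + by apply: cvg_at_right_filter; apply: cF; rewrite lexx ltW.
  + by apply: cvg_at_left_filter; apply: cF; rewrite lexx ltW.
- move=> t; rewrite in_itv /= => /andP[at_ tb].
  by rewrite derive1E; have [] := dF t (introT andP (conj (ltW at_) (ltW tb))).
Qed.

Lemma is_derive_rV n (F : R -> 'rV[R]_n) (t : R) (X : 'rV[R]_n) :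
  (forall i, is_derive t 1 (fun r => F r ord0 i) (X ord0 i)) -> is_derive t 1 F X.
Proof.
move=> dF; have D : derivable F t 1.
  by apply/derivable_mxP => i j; rewrite (ord1 i); have [] := dF j.
apply: DeriveDef => //; rewrite derive_mx//; apply/rowP => i; rewrite mxE.
by have [] := dF i.
Qed.

Lemma continuous_primitive_rV n (f : R -> 'rV[R]_n) (a b : R) : a < b ->
  (forall t, a <= t <= b -> {for t, continuous f}) ->
  exists F : R -> 'rV[R]_n, forall t, a <= t <= b -> is_derive t 1 F (f t).
Proof.
move=> ab cf.
have H (i : 'I_n) : exists F : R -> R, forall t, a <= t <= b ->
    is_derive t 1 F (f t ord0 i).
  apply: (@continuous_primitive (fun t => f t ord0 i)) => // t abt.
  apply: (@continuous_comp _ _ _ f (fun y : 'rV[R]_n => y ord0 i)); first exact: cf.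
  exact: coord_continuous.
pose F i := projT1 (cid (H i)).
exists (fun t => \row_i F i t) => t abt; apply: is_derive_rV => i.
have -> : (fun r => (\row_i F i r) ord0 i) = F i by apply/funext => r; rewrite mxE.
exact: (projT2 (cid (H i))).
Qed.

Lemma FTC2_rV n (f F : R -> 'rV[R]_n) (a b : R) : a < b ->
  (forall t, a <= t <= b -> {for t, continuous f}) ->
  (forall t, a <= t <= b -> is_derive t 1 F (f t)) ->
  \row_i (\int[mu]_(t in `[a, b]) f t ord0 i)%R = F b - F a.
Proof.
move=> ab cf dF; apply/rowP => i; rewrite !mxE.
apply: (@FTC2_closed (fun t => f t ord0 i) (fun t => F t ord0 i)) => // t abt.
  apply: (@continuous_comp _ _ _ f (fun y : 'rV[R]_n => y ord0 i)); first exact: cf.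
  exact: coord_continuous.
have := is_diff_is_derive (is_diff_coord i (is_derive_is_diff (dF t abt))).
by rewrite scale1r.
Qed.

End Primitive.

(** * Group-valued curves with zero derivative *)

Section ZeroDerivative.
Context {R : realType} {n : nat} (H : lie_group R n).
Let E := 'rV[R]_n.
Local Notation e := (lg1 H).
Local Notation phi := (chart e).
Local Notation psi := (chartV e).
Local Notation o := (chart (lg1 H) (lg1 H)).
Local Notation "g ** h" := (lgM g h) (at level 40, left associativity).
Local Notation "g ^i" := (lgV g) (at level 3, format "g ^i").
Let okH := ok_manifold H.
Let m : E * E -> E := mulc H.

(* The derivative is taken within [[a, b]]: only the values of [z] there matter. *)
Lemma group_const (a b : R) (z : R -> H) : 
  (forall s, a <= s <= b -> exists K : R -> E, [/\ K 0 = o, is_derive (0 : R) 1 K 0 &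
    \forall d \near (0 : R), a <= s + d <= b -> z (s + d) ** (z s)^i = psi (K d)]) ->
  forall s, a <= s <= b -> z s = z a.
Proof.
move=> Hz.
have [r1 r10 Hr] := mulc_radius H ltr01.
have [r r0 {Hr} rP] : exists2 r : R, 0 < r & forall y : E, `|y - o| < r ->
    differentiable m (o, y) /\ phi (psi y) = y.
  have /nbhs_ballP[r2 /= r20 Hr2] := ok_chartVK okH e.
  exists (Num.min r1 r2); first by rewrite lt_min r10.
  move=> y; rewrite lt_min => /andP[y1 y2]; split; first by have [] := Hr y y1.
  by apply: Hr2; rewrite -ball_normE /= distrC.
(* Local constancy comes first, because the chart at the unit is sure to cover [z s (z t)^-1] only
   for [s] close to [t]; real induction propagates it afterwards. *)
have local t : a <= t <= b -> exists2 d0 : R, 0 < d0 & forall s, a <= s <= b ->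
    `|t - s| < d0 -> z s = z t.
  move=> abt; have [K [K0 dK zK]] := Hz t abt.
  have cK : {for (0 : R), continuous K}.
    by apply: differentiable_continuous; apply/derivable1_diffP; case: dK.
  have nK : \forall d \near (0 : R), `|K d - o| < r.
    by move/cvgrPdist_lt : cK => /(_ _ r0); apply: filterS => d; rewrite K0 distrC.
  have /nbhs_ballP[d0 /= d00 Hd] : \forall d \near (0 : R), `|K d - o| < r /\
      (a <= t + d <= b -> z (t + d) ** (z t)^i = psi (K d)) by exact: filterI.
  exists d0 => // s abs ts.
  pose F (q : R) : E := phi (z q ** (z t)^i).
  have zq q : a <= q <= b -> `|t - q| < d0 ->
      `|F q - o| < r /\ z q ** (z t)^i = psi (F q).
    move=> abq tq; have [|H1 H2] := Hd (q - t).
      by rewrite /ball /= sub0r opprB.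
    have tqt : t + (q - t) = q by rewrite addrC subrK.
    rewrite tqt in H2; have {}H2 := H2 abq; rewrite /F H2.
    by have [_ ->] := rP _ H1.
  (* [F (q + d)] is [mulc (K' d, F q)], and [K'] has derivative zero at [0]. *)
  have step q : a <= q <= b -> `|t - q| < d0 -> forall c, 0 < c ->
     \forall d \near (0 : R), a <= q + d <= b -> `|t - (q + d)| < d0 ->
       `|F (q + d) - F q| <= (0 + c) * `|d|.
    move=> abq tq c c0; have [Fq zqt] := zq q abq tq.
    have [K' [K'0 dK' zK']] := Hz q abq; have [dm phipsi] := rP _ Fq.
    have L : is_diff (K' 0) (m \o (fun z => (z, F q)))
        ('d m (o, F q) \o (fun v => (v, 0))).
      rewrite K'0; exact: (is_diff_comp (is_diff_inl (o : E) (F q)) (differentiableP dm)).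
    have := is_derive_comp dK' L; rewrite /= (_ : (0, 0) = 0)// linear0 => dmK.
    have := is_derive_approx dmK c0; apply: filter_app.
    near=> d => Ha abqd tqd; have H1 := near zK' d.
    have {}H1 : z (q + d) ** (z q)^i = psi (K' d) by apply: H1.
    move: Ha; rewrite add0r scaler0 subr0 K'0 add0r.
    have -> : m (o, F q) = F q by rewrite /m /mulc /= (psi_o H) lg1M.
    suff -> : m (K' d, F q) = F (q + d) by [].
    by rewrite /m /mulc /= -H1 -zqt lgMA lgMVK.
  have Fst : F s = F t.
    apply/eqP; rewrite -subr_eq0 -normr_le0.
    (* The mean value bound runs from left to right, so the two orders of [s] and [t] are treated
       apart. *)
    have [st|ts'] := leP t s.
      have := @mean_value_le _ _ F t s 0 st; rewrite mul0r; apply=> q /andP[tq qs] c c0.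
      have abq : a <= q <= b by case/andP: abt => ? _; case/andP: abs => _ ?;
        rewrite (le_trans _ tq)//= (le_trans qs).
      have tqd : `|t - q| < d0.
        by apply: le_lt_trans ts; rewrite !ler0_norm ?subr_le0// lerN2 lerD2l lerN2.
      apply: filterS (step q abq tqd c c0) => d Hd' /andP[tqd' qds]; apply: Hd'.
        by case/andP: abt => ? _; case/andP: abs => _ ?;
        rewrite (le_trans _ tqd')//= (le_trans qds).
      by apply: le_lt_trans ts; rewrite !ler0_norm ?subr_le0// lerN2 lerD2l lerN2.
    rewrite distrC.
    have := @mean_value_le _ _ F s t 0 (ltW ts'); rewrite mul0r; apply=> q /andP[sq qt] c
      c0.
    have abq : a <= q <= b by case/andP: abs => ? _; case/andP: abt => _ ?;
      rewrite (le_trans _ sq)//= (le_trans qt).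
    have tqd : `|t - q| < d0.
      by apply: le_lt_trans ts; rewrite !ger0_norm ?subr_ge0 ?(ltW ts')// lerD2l lerN2.
    apply: filterS (step q abq tqd c c0) => d Hd' /andP[sqd qdt]; apply: Hd'.
      by case/andP: abs => ? _; case/andP: abt => _ ?;
      rewrite (le_trans _ sqd)//= (le_trans qdt).
    by apply: le_lt_trans ts; rewrite !ger0_norm ?subr_ge0 ?(ltW ts')// lerD2l lerN2.
  have [_ zst] := zq s abs ts.
  have : z s ** (z t)^i = e by rewrite zst Fst /F lgMV (psi_o H).
  by move=> /(congr1 (fun x => x ** z t)); rewrite lgMVK lg1M.
apply: real_induction => t abt IH; have /andP[at_ tb] := abt.
  move: at_; rewrite le_eqVlt => /predU1P[<-//|at_].
  have [d0 d00 Hd] := local t abt.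
  have m0 : 0 < Num.min (d0 / 2) (t - a) by rewrite lt_min divr_gt0//= subr_gt0.
  pose q := t - Num.min (d0 / 2) (t - a).
  have aqt : a <= q < t.
    by rewrite /q lerBrDr -lerBrDl ge_min lexx orbT ltrBlDr ltrDl m0.
  rewrite -(IH q aqt); apply/esym/Hd.
    by case/andP: aqt => -> /ltW/le_trans; exact.
  rewrite opprB addrC subrK gtr0_norm//.
  by rewrite gt_min ltr_pdivrMr// ltr_pMr// ltr1n.
have abt' : a <= t <= b by rewrite at_ ltW.
have [d0 d00 Hd] := local t abt'.
exists d0 => // q /andP[tq qd] qb; rewrite (Hd q).
- by apply: IH; rewrite at_ lexx.
- by rewrite qb (le_trans at_)// ltW.
- by rewrite distrC gtr0_norm ?subr_gt0// ltrBlDl.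
Unshelve. all: by end_near. Qed.

End ZeroDerivative.

(** * Pulling back a 1-form by a surface *)

Section CoordinateFields.
Context {R : realType} {n : nat} (P : manifold R n).
Let E := 'rV[R]_n.
Implicit Types p q : P.
Let okP := ok_manifold P.

Lemma coord_vec_self p (u : E) : coord_vec (M := P) p (chart p p) u = u.
Proof.
rewrite /coord_vec /mderiv /in_coord /= (chartV_chart p okP).
have near_id : \forall y \near chart p p, id y = chart p (chartV p y).
  by apply: filterS (ok_chartVK okP p) => y yK.
have H1 := near_is_diff near_id (is_diff_id (chart p p : E)).
exact: (congr1 (@^~ u) (@diff_val _ _ _ _ _ _ _ H1)).
Qed.

Lemma coord_vec_linear p (y : E) : linear (coord_vec (M := P) p y).
Proof. by move=> a u v; rewrite /coord_vec /mderiv linearP. Qed.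

(** A single tangent vector must be extended to a field before [ext_deriv] or the hypothesis on [B1]
    can be applied. Constant coordinates in the chart at [p] make the bracket of two such fields
    vanish at [p]; the field is meaningful on [dom p]. *)
Definition coord_field p (u : E) (x : P) : E := coord_vec (M := P) p (chart p x) u.

Lemma mderiv_chart_chartV p q (y u : E) : (chart p @` dom p) y -> dom q (chartV p y) ->
  mderiv P (vect E) (chart q) (chartV p y) (coord_vec (M := P) p y u) =
  'd (fun z : E => chart q (chartV p z) : E) y u.
Proof.
move=> py qy; have m1 := smooth_mdifferentiable (smooth_chartV py).
have m2 := smooth_mdifferentiable (smooth_chart qy).
have [_ eq] := mdifferentiable_comp (ok_vect E) okP m1 m2.
exact: (esym (congr1 (@^~ u) eq)).
Qed.

Lemma coord_field_const p (u : E) : \forall y \near chart p p,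
  field_coord (M := P) (coord_field p u) p y = u.
Proof.
have py : (chart p @` dom p) (chart p p) by exists p => //; exact: dom_self.
have N1 := nbhs_img py.
have oI : open (chart p @` dom p) by exact: (mfd_img (mfd_axioms P)).
near=> y; have Iy : (chart p @` dom p) y by exact: (near N1 y).
have [yK dy] := dom_chartVK Iy.
rewrite /field_coord /coord_field yK mderiv_chart_chartV//.
have near_id : \forall z \near y, id z = chart p (chartV p z).
  apply: filterS (open_nbhs_nbhs (conj oI Iy)) => z /dom_chartVK[zK _].
  exact/esym.
have H1 := near_is_diff near_id (is_diff_id (y : E)).
exact: (congr1 (@^~ u) (@diff_val _ _ _ _ _ _ _ H1)).
Unshelve. all: by end_near. Qed.

(** Smoothness is tested in the chart of every [q] in [dom p], where the coordinates of the field
    are the derivative ['D_u] of a transition map composed with the inverse transition. *)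
Lemma coord_field_smooth p (u : E) : smooth_field (dom p) (coord_field p u).
Proof.
move=> q pq; pose Q : set E := chart q @` (dom q `&` dom p).
have N1 : \forall y \near chart q q, (chart q @` dom q) y.
  by apply: nbhs_img; exists q => //; exact: dom_self.
have N2 := near_chartV okP (nbhs_dom_of pq).
have nQ : nbhs (chart q q) Q.
  near=> y; have := near N1 y; move=> /(_ _)/dom_chartVK[]// => yK qy.
  by exists (chartV q y) => //; split=> //; exact: (near N2 y).
exists Q^°; first by split; [exact: open_interior|].
have oQ : open Q^° by exact: open_interior.
have ST := mfd_transition (mfd_axioms P) p q.
have SS := mfd_transition (mfd_axioms P) q p.
move=> k; pose T (z : E) : E := chart q (chartV p z).
have S1 : Ck k Q^° (fun y : E => 'D_u T (chart p (chartV q y))).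
  apply: (Ck_comp (V := chart p @` (dom p `&` dom q)) (f := fun z => 'D_u T z)) => //.
  - exact: findim_rV.
  - move=> y /interior_subset [x [qx px] <-]; rewrite dom_chartK//.
    by exists x.
  - by apply: Ck_sub (SS k); exact: interior_subset.
  - exact: Ck_derive (ST k.+1).
apply: Ck_ext oQ _ S1 => y /set_mem /interior_subset [x [qx px] <-].
rewrite /field_coord /coord_field dom_chartK//.
have px' : (chart p @` dom p) (chart p x) by exists x.
have pxq : dom q (chartV p (chart p x)) by rewrite dom_chartK.
have := mderiv_chart_chartV u px' pxq; rewrite (dom_chartK px) => ->.
apply: deriveE; apply: Ck_diff (ST 1%N) _.
by exists x.
Unshelve. all: by end_near. Qed.

End CoordinateFields.

Section Pullback.
Context {R : realType} {n k : nat} (P : manifold R n).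
Let E := 'rV[R]_n.
Let V := 'rV[R]_k.
Let R2 := (R^o * R^o)%type.
Variables (C : P -> E -> V) (hC : form1 C).
Variables (L : R2 -> P) (U : set R2) (oU : open U).
Hypothesis sL : smooth_on (prod_charted (vect R^o) (vect R^o)) P U L.
Local Notation delta i := (delta_mx ord0 i : 'rV[R]_n).
Let okP := ok_manifold P.

Let coef (p : P) (i : 'I_n) (y : E) : V := C (chartV p y) (coord_vec (M := P) p y (delta
  i)).

Lemma form1_coords (p : P) (y u : E) :
  C (chartV p y) (coord_vec (M := P) p y u) = \sum_(i < n) u ord0 i *: coef p i y.
Proof.
pose l : {linear E -> V} := HB.pack (C (chartV p y))
  (GRing.isLinear.Build _ _ _ _ _ (form1_linear hC (chartV p y))).
pose l' : {linear E -> E} := HB.pack (coord_vec (M := P) p y)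
  (GRing.isLinear.Build _ _ _ _ _ (coord_vec_linear p y)).
rewrite -[LHS]/(l (l' u)) [in LHS](row_sum_delta u) !linear_sum.
by apply: eq_bigr => i _; rewrite !linearZ.
Qed.

Lemma is_diff_slice1 (t s : R) :
  is_diff t (fun r : R => (r, s) : R2) (fun a => a *: ((1, 0) : R2)).
Proof.
have := is_diff_inl (t : R^o) (s : R^o).
rewrite (_ : (fun v : R^o => (v, 0)) = (fun a => a *: ((1, 0) : R2)))//.
by apply/funext => a; apply: injective_projections; rewrite /= ?scaler0//; exact/esym/mulr1.
Qed.

Lemma is_diff_slice2 (t s : R) :
  is_diff s (fun r : R => (t, r) : R2) (fun a => a *: ((0, 1) : R2)).
Proof.
have := is_diff_inr (t : R^o) (s : R^o).
rewrite (_ : (fun v : R^o => (0, v)) = (fun a => a *: ((0, 1) : R2)))//.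
by apply/funext => a; apply: injective_projections; rewrite /= ?scaler0//; exact/esym/mulr1.
Qed.

(** [velocity] is read in the chart at the moving point [L (l t)]. Writing it with [coord_vec] and a
    chart at a fixed [p] makes the value of [C] on it a combination of smooth coefficients. *)
Lemma velocity_line (l : R -> R2) (t : R) (v : R2) (p : P) :
  is_diff t l (fun a => a *: v) -> U (l t) -> dom p (L (l t)) ->
  differentiable (fun z : R2 => chart p (L z) : E) (l t) ->
  velocity (fun r => L (l r)) t =
    coord_vec (M := P) p (chart p (L (l t))) ('D_v (fun z : R2 => chart p (L z) : E) (l t)).
Proof.
move=> dl Ul pl dg.
have cl : {for t, continuous l} by apply: differentiable_continuous; case: dl.
have cL : {for l t, continuous L} by have [] := sL Ul.
have cLl : {for t, continuous (fun r => L (l r))} by exact: (continuous_comp cl cL).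
pose c (r : R) : E := chart p (L (l r)).
have dc : is_diff t c (fun a => a *: 'D_v (fun z : R2 => chart p (L z) : E) (l t)).
  have := is_diff_comp dl (differentiableP dg).
  rewrite (_ : _ \o (fun a => a *: v) =
    (fun a => a *: 'D_v (fun z : R2 => chart p (L z) : E) (l t)))//.
  by apply/funext => a; rewrite /= linearZ /= -deriveE.
have pc : (chart p @` dom p) (c t) by exists (L (l t)).
have mc : mdifferentiable (vect R^o) (vect E) c t.
  by split; [apply: differentiable_continuous; case: dc|case: dc].
have mV := smooth_mdifferentiable (smooth_chartV pc).
have [[_ dVc] eq] := mdifferentiable_comp (ok_vect R^o) (ok_vect E) mc mV.
have vc : mderiv (vect R^o) (vect E) c t 1 =
    'D_v (fun z : R2 => chart p (L z) : E) (l t).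
  exact: (etrans (congr1 (@^~ 1) (@diff_val _ _ _ _ _ _ _ dc)) (scale1r _)).
have := congr1 (@^~ 1) eq; rewrite /= vc => veq.
apply: etrans _ veq.
rewrite /velocity /mderiv.
have cVt : chartV p (c t) = L (l t) by rewrite /c dom_chartK.
rewrite cVt in dVc *; apply: (congr1 (@^~ 1)).
apply: near_diff dVc; have N1 : \forall r \near t, dom p (L (l r)) by exact: (cLl _
  (nbhs_dom_of pl)).
near=> r; have Nr : dom p (L (l r)) by exact: (near N1 r).
by rewrite /in_coord /c /= (dom_chartK Nr).
Unshelve. all: by end_near. Qed.

(** With parameters [(t, s)], the pullback of [C] by [L] is [pull1 dt + pull2 ds]. *)
Definition pull1 (z : R2) : V := C (L z) (velocity (fun r => L (r, z.2)) z.1).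
Definition pull2 (z : R2) : V := C (L z) (velocity (fun r => L (z.1, r)) z.2).

(** The single chart at [L z0] is used on a whole neighbourhood because the formulas are going to be
    differentiated at [z0]. *)
Lemma pull_local (z0 : R2) : U z0 -> exists2 W : set R2, open_nbhs z0 W &
  [/\ W `<=` U, Cinf W (fun z => chart (L z0) (L z) : E),
      forall z, W z -> (chart (L z0) @` dom (L z0)) (chart (L z0) (L z)),
      forall z, W z -> pull1 z =
        \sum_(i < n) 'D_((1, 0) : R2) (fun z => chart (L z0) (L z) : E) z ord0 i *:
           coef (L z0) i (chart (L z0) (L z)) &
      forall z, W z -> pull2 z =
        \sum_(i < n) 'D_((0, 1) : R2) (fun z => chart (L z0) (L z) : E) z ord0 i *:
           coef (L z0) i (chart (L z0) (L z))].
Proof.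
move=> Uz; pose p := L z0; have [cL [W0 [oW0 W0z] sW0]] := sL Uz.
pose g (z : R2) : E := chart p (L z).
pose Q := [set z : R2 | [/\ W0 z, U z & dom p (L z)]].
have nQ : nbhs z0 Q.
  have N1 : nbhs z0 W0 by apply: open_nbhs_nbhs; split=> //; case: z0 {Uz p cL sW0 g Q} W0z.
  have N2 : nbhs z0 U by exact: open_nbhs_nbhs.
  have N3 : \forall z \near z0, dom p (L z) by exact: (cL _ (nbhs_dom p)).
  by near=> z; split; [exact: (near N1 z)|exact: (near N2 z)|exact: (near N3 z)].
have iQ z : Q^° z -> Q z by exact: interior_subset.
have sg : Cinf Q^° g.
  move=> j; have := Ck_sub (fun z Qz => let: And3 H _ _ := iQ z Qz in H) (sW0 j).
  apply: Ck_ext; first exact: open_interior.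
  by case=> a b _; rewrite /in_coord /=.
have gd z : Q^° z -> differentiable g z by move=> Qz; exact: Ck_diff (sg 1%N) Qz.
exists Q^°; first by split; [exact: open_interior|].
split=> //.
- by move=> z /iQ[].
- by move=> z /iQ[_ _ pz]; exists (L z).
- move=> [t s] Qz; have [_ Uts pts] := iQ _ Qz; rewrite /pull1 /=.
  have dl := is_diff_slice1 t s.
  rewrite (velocity_line dl Uts pts (gd _ Qz)) -form1_coords.
  by rewrite (dom_chartK pts).
- move=> [t s] Qz; have [_ Uts pts] := iQ _ Qz; rewrite /pull2 /=.
  have dl := is_diff_slice2 t s.
  rewrite (velocity_line dl Uts pts (gd _ Qz)) -form1_coords.
  by rewrite (dom_chartK pts).
Unshelve. all: by end_near. Qed.

Lemma coef_smooth (p : P) i : Cinf (chart p @` dom p) (coef p i).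
Proof. exact: form1_smooth hC p (delta i). Qed.

Lemma pull_smooth : Cinf U pull1 /\ Cinf U pull2.
Proof.
have H (p : P) (W : set R2) (g : R2 -> E) (v : R2) j : open W -> Cinf W g ->
    (forall z, W z -> (chart p @` dom p) (g z)) ->
    Ck j W (fun z => \sum_(i < n) 'D_v g z ord0 i *: coef p i (g z)).
  move=> oW sg gW; apply: Ck_sum => // i; apply: Ck_scale => //.
    by apply: Ck_coord => //; apply: Ck_derive; exact: (sg j.+1).
  by apply: (Ck_comp (V := chart p @` dom p)) => //; [exact: findim_rV|exact: coef_smooth].
split=> j; apply: Ck_local => z0 Uz; have [W Wz [WU sg gW p1 p2]] := pull_local Uz;
  exists W => //; have oW : open W by case: Wz.
- by apply: Ck_ext oW _ (H _ _ _ (1, 0) _ oW sg gW) => z /set_mem/p1 ->.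
- by apply: Ck_ext oW _ (H _ _ _ (0, 1) _ oW sg gW) => z /set_mem/p2 ->.
Qed.

Lemma derive_pull_sum (p : P) (W : set R2) (g : R2 -> E) (u v z0 : R2) :
  open W -> W z0 -> Cinf W g -> (forall z, W z -> (chart p @` dom p) (g z)) ->
  'D_u (fun z => \sum_(i < n) 'D_v g z ord0 i *: coef p i (g z)) z0 =
  \sum_(i < n) 'D_v g z0 ord0 i *: 'd (coef p i) (g z0) ('D_u g z0) +
  \sum_(i < n) 'D_u (fun z => 'D_v g z) z0 ord0 i *: coef p i (g z0).
Proof.
move=> oW Wz sg gW.
have dg : differentiable g z0 by exact: Ck_diff (sg 1%N) Wz.
have ddg : differentiable (fun z => 'D_v g z) z0.
  by apply: (Ck_diff (k := 0)) Wz; apply: Ck_derive; exact: (sg 2%N).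
have dc i : differentiable (coef p i) (g z0).
  exact: Ck_diff (coef_smooth p i 1%N) (gW _ Wz).
have D := is_diff_sum (index_enum 'I_n) (fun i => is_diff_scale
  (is_diff_coord i (differentiableP ddg))
  (is_diff_comp (differentiableP dg) (differentiableP (dc i)))).
apply: etrans (is_diff_derive u D) _; rewrite big_split /=.
by rewrite (deriveE u dg) (deriveE u ddg).
Qed.

(** The fields have constant coordinates, so the bracket term is zero and only derivatives of the
    coefficients of [C] remain. *)
Lemma ext_deriv_coord (p : P) (v w : E) :
  ext_deriv C (coord_field p v) (coord_field p w) p =
  \sum_(i < n) w ord0 i *: 'd (coef p i) (chart p p) v -
  \sum_(i < n) v ord0 i *: 'd (coef p i) (chart p p) w.
Proof.
have py : (chart p @` dom p) (chart p p) by exists p => //; exact: dom_self.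
have cp u : coord_field p u p = u by exact: coord_vec_self.
have bracket0 : vbracket (coord_field p v) (coord_field p w) p = 0.
  rewrite /vbracket !cp.
  have H u : is_diff (chart p p : E) (field_coord (coord_field p u) p) (fun=> 0).
    apply: near_is_diff (is_diff_cst u (chart p p : E)).
    by apply: filterS (coord_field_const p u) => y ->.
  have [_ e1] := H w; have [_ e2] := H v.
  exact: (etrans (congr2 (fun a b => a - b) (congr1 (@^~ v) e1) (congr1 (@^~ w) e2))
    (subr0 _)).
have H u u' : mderiv P (vect V) (fun x => C x (coord_field p u x)) p u' =
    \sum_(i < n) u ord0 i *: 'd (coef p i) (chart p p) u'.
  have dc i : differentiable (coef p i) (chart p p).
    exact: Ck_diff (coef_smooth p i 1%N) py.
  have D := is_diff_sum (index_enum 'I_n) (fun i =>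
    is_diffZ (u ord0 i) (differentiableP (dc i))).
  have N1 : \forall y \near chart p p,
      \sum_(i < n) (u ord0 i *: coef p i) y =
      in_coord (M := P) (N := vect V) (fun x => C x (coord_field p u x)) p
        (C p (coord_field p u p)) y.
    apply: filterS (ok_chartVK okP p) => y yK.
    by rewrite /in_coord /coord_field /= yK form1_coords.
  exact: (congr1 (@^~ u') (@diff_val _ _ _ _ _ _ _ (near_is_diff N1 D))).
rewrite /ext_deriv bracket0 !cp !H.
pose l : {linear E -> V} := HB.pack (C p)
  (GRing.isLinear.Build _ _ _ _ _ (form1_linear hC p)).
by rewrite -[C p 0]/(l 0) linear0 subr0.
Qed.

Lemma velocity_pull (z : R2) : U z ->
  velocity (fun r => L (r, z.2)) z.1 = 'D_((1, 0) : R2) (fun y => chart (L z) (L y) : E)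
    z /\
  velocity (fun r => L (z.1, r)) z.2 = 'D_((0, 1) : R2) (fun y => chart (L z) (L y) : E) z.
Proof.
case: z => t s Uts /=; have [W [oW Wz] [_ sg _ _ _]] := pull_local Uts.
have dg : differentiable (fun y => chart (L (t, s)) (L y) : E) (t, s).
  exact: Ck_diff (sg 1%N) Wz.
have pts := dom_self (L (t, s)).
split.
- have dl := is_diff_slice1 t s.
  by rewrite (velocity_line dl Uts pts dg) coord_vec_self.
- have dl := is_diff_slice2 t s.
  by rewrite (velocity_line dl Uts pts dg) coord_vec_self.
Qed.

(** In the chart at [L z] the terms with second derivatives of [L] cancel by symmetry and
    [ext_deriv_coord] is left: pullback commutes with the exterior derivative. *)
Lemma pull_ext_deriv (z : R2) : U z ->
  'D_((1, 0) : R2) pull2 z - 'D_((0, 1) : R2) pull1 z =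
  ext_deriv C (coord_field (L z) (velocity (fun r => L (r, z.2)) z.1))
              (coord_field (L z) (velocity (fun r => L (z.1, r)) z.2)) (L z).
Proof.
move=> Uz; have [W Wz [WU sg gW p1 p2]] := pull_local Uz; have [oW Wzz] := Wz.
have [-> ->] := velocity_pull Uz; rewrite ext_deriv_coord.
have N1 := open_nbhs_nbhs Wz.
have e1 : 'D_((0, 1) : R2) pull1 z = 'D_((0, 1) : R2) (fun z' => \sum_(i < n)
    'D_((1, 0) : R2) (fun z' => chart (L z) (L z') : E) z' ord0 i *:
      coef (L z) i (chart (L z) (L z'))) z.
  by apply: near_eq_derive; apply: filterS N1 => y /p1.
have e2 : 'D_((1, 0) : R2) pull2 z = 'D_((1, 0) : R2) (fun z' => \sum_(i < n)
    'D_((0, 1) : R2) (fun z' => chart (L z) (L z') : E) z' ord0 i *: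
      coef (L z) i (chart (L z) (L z'))) z.
  by apply: near_eq_derive; apply: filterS N1 => y /p2.
have swap := @derive_swap _ _ _ W _ z ((1, 0) : R2) ((0, 1) : R2) oW Wzz (sg 2%N).
have f1 := @derive_pull_sum (L z) W _ ((0, 1) : R2) ((1, 0) : R2) z oW Wzz sg gW.
have f2 := @derive_pull_sum (L z) W _ ((1, 0) : R2) ((0, 1) : R2) z oW Wzz sg gW.
have f2' := etrans f2 (congr1 (fun X : E => _ + \sum_(i < n) X ord0 i *: coef (L z) i
  (chart (L z) (L z))) swap).
apply: etrans (congr2 (fun a b : V => a - b) (etrans e2 f2') (etrans e1 f1)) _.
have aux (a b c : V) : (a + c) - (b + c) = a - b by rewrite opprD addrACA subrr addr0.
exact: aux.
Qed.

End Pullback.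

(** * Crossed modules and the horizontal lift *)

Section Projections.
Context {R : realType}.

Lemma is_diff_fst_map (F F' : normedModType R) (x : F) (y : F') :
  is_diff ((x, y) : F * F') (fun z : F * F' => z.1) (fun v => v.1).
Proof.
have c : continuous (fun z : F * F' => z.1) by move=> z; exact: cvg_fst.
pose l : {linear (F * F')%type -> F} := fst.
have D : is_diff ((x, y) : F * F') l l.
  by apply: DiffDef; [exact: linear_differentiable|exact: diff_lin].
exact: D.
Qed.

Lemma is_diff_snd_map (F F' : normedModType R) (x : F) (y : F') :
  is_diff ((x, y) : F * F') (fun z : F * F' => z.2) (fun v => v.2).
Proof.
have c : continuous (fun z : F * F' => z.2) by move=> z; exact: cvg_snd.
pose l : {linear (F * F')%type -> F'} := snd.
have D : is_diff ((x, y) : F * F') l l.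
  by apply: DiffDef; [exact: linear_differentiable|exact: diff_lin].
exact: D.
Qed.

End Projections.

Section CrossedModule.
Context {R : realType} {nG nH : nat} (G : lie_group R nG) (H : lie_group R nH).
Variables (alpha : G -> H -> H) (tau : H -> G) (cm : crossed_module alpha tau).
Let okH := ok_manifold H.
Let okG := ok_manifold G.
Local Notation eH := (lg1 H).
Local Notation eG := (lg1 G).

Lemma cm_alpha_lg1 g : alpha g eH = eH.
Proof.
have := cm_alpha_morph cm g eH eH; rewrite lgM1 => /(congr1 (fun h => lgM h (lgV (alpha g
  eH)))).
by rewrite lgMV lgMK.
Qed.

Lemma cm_tau_lg1 : tau eH = eG.
Proof.
have := cm_tauM cm eH eH; rewrite lgM1 => /(congr1 (fun h => lgM h (lgV (tau eH)))).
by rewrite lgMV lgMK.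
Qed.

Lemma cm_tauV h : tau (lgV h) = lgV (tau h).
Proof. by apply: lgV_uniq; rewrite -(cm_tauM cm) lgMV cm_tau_lg1. Qed.

(** By the Peiffer identity [alpha (tau h)] is conjugation by [h]. This is where the action of
    [tau h] in [Omega] meets the adjoint action of [H] in the variation formula. *)
Lemma dalpha_tau h X : dalpha alpha (tau h) X = Ad h X.
Proof.
rewrite /dalpha /Ad; congr (mderiv H H _ eH X).
by apply/funext => h'; rewrite (cm_peiffer cm).
Qed.

Lemma smooth_alpha (F : normedModType R) (N : charted F) (f : N -> G) (f' : N -> H) p :
  charts_ok N -> smooth_at N G f p -> smooth_at N H f' p ->
  smooth_at N H (fun x => alpha (f x) (f' x)) p.
Proof.
move=> okN sf sf'.
have sa : smooth_at (prod_charted G H) H (fun z => alpha z.1 z.2) (f p, f' p).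
  by apply: (cm_alpha_smooth cm).
apply: (smooth_at_comp (f := fun x => (f x, f' x) : prod_charted G H) _ okN _ _ sa).
- by apply: findim_prod; exact: findim_rV.
- exact: ok_prod.
- exact: smooth_at_pair.
Qed.

Lemma sd_Ad_inG_fst g (Z : 'rV[R]_nH * 'rV[R]_nG) :
  (sd_Ad alpha (inG g) Z).1 = dalpha alpha g Z.1.
Proof.
rewrite /sd_Ad.
have -> : (fun x : H * G => sd_mul alpha (sd_mul alpha (inG g) x) (sd_inv alpha (inG g))) =
    (fun x => (alpha g x.1, lgM (lgM g x.2) (lgV g))).
  apply/funext => x; rewrite /sd_mul /sd_inv /inG /= lg1M lgV1 !cm_alpha_lg1 lgM1.
  by [].
have [_ da] : mdifferentiable H H (alpha g) eH.
  apply: smooth_mdifferentiable; apply: smooth_alpha => //; first exact: smooth_at_cst.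
  exact: smooth_at_id.
have [_ dc] := smooth_mdifferentiable (smooth_conj g eG).
have D := is_diff_pair
  (is_diff_comp (@is_diff_fst_map _ _ _ (chart eH eH : 'rV[R]_nH) (chart eG eG :
    'rV[R]_nG)) (differentiableP da))
  (is_diff_comp (@is_diff_snd_map _ _ _ (chart eH eH : 'rV[R]_nH) (chart eG eG :
    'rV[R]_nG)) (differentiableP dc)).
exact: (congr1 (fun d => (d Z).1) (@diff_val _ _ _ _ _ _ _ D)).
Qed.

(** Conjugation by [inH k] keeps the [G] coordinate, so [Z.2] vanishes first; on pairs [(Z.1, 0)]
    the first component is [Ad k Z.1], and [Ad k] is injective. *)
Lemma sd_Ad_inH_eq0 k (Z : 'rV[R]_nH * 'rV[R]_nG) : sd_Ad alpha (inH k) Z = 0 -> Z.1 = 0.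
Proof.
rewrite /sd_Ad.
have -> : (fun x : H * G => sd_mul alpha (sd_mul alpha (inH k) x) (sd_inv alpha (inH k))) =
    (fun x => (lgM (lgM k x.1) (alpha x.2 (lgV k)), x.2)).
  apply/funext => x; rewrite /sd_mul /sd_inv /inH /= lgV1 !(cm_alpha1 cm) lg1M lgM1.
  by [].
pose F1 (x : H * G) := lgM (lgM k x.1) (alpha x.2 (lgV k)).
have okHG := ok_prod okH okG.
have sF1 : smooth_at (prod_charted H G) H F1 (eH, eG).
  apply: smooth_lgM => //.
    by apply: smooth_lgM => //; [exact: smooth_at_cst|exact: smooth_at_fst].
  by apply: smooth_alpha => //; [exact: smooth_at_snd|exact: smooth_at_cst].
have [_ d1] := smooth_mdifferentiable sF1.
have [_ d2] := smooth_mdifferentiable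
  (smooth_at_snd (M := H) (N := G) (eH, eG) okG).
have D := is_diff_pair (differentiableP d1) (differentiableP d2).
have vD := congr1 (fun d => d Z) (@diff_val _ _ _ _ _ _ _ D).
move=> Z0; have {}Z0 := etrans (esym vD) Z0.
have N2 : \forall y \near ((chart eH eH, chart eG eG) : 'rV[R]_nH * 'rV[R]_nG),
    y.2 = in_coord (M := prod_charted H G) (N := G) snd (eH, eG) eG y.
  have c2 : {for ((chart eH eH, chart eG eG) : 'rV[R]_nH * 'rV[R]_nG), continuous snd}.
    exact: cvg_snd.
  have N : \forall y \near (chart eG eG : 'rV[R]_nG), y = chart eG (chartV eG y).
    by apply: filterS (ok_chartVK okG eG) => y ->.
  exact: (c2 _ N).
have D2 := near_is_diff N2 (@is_diff_snd_map _ _ _ (chart eH eH : 'rV[R]_nH) (chart eG eG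
  : 'rV[R]_nG)).
have Z2 : Z.2 = 0.
  have := congr1 snd Z0; rewrite /= => <-.
  exact: (esym (congr1 (@^~ Z) (@diff_val _ _ _ _ _ _ _ D2))).
have Z1 := congr1 fst Z0.
have Zin : Z = (Z.1, 0) by rewrite -Z2; case: (Z).
have F1e : F1 (eH, eG) = eH by rewrite /F1 /= (cm_alpha1 cm) conj1.
rewrite F1e in d1.
have L := is_diff_comp (is_diff_inl (chart eH eH : 'rV[R]_nH) (chart eG eG : 'rV[R]_nG))
  (differentiableP d1).
have N1 : \forall y \near (chart eH eH : 'rV[R]_nH),
   chart eH (lgM (lgM k (chartV eH y)) (lgV k)) =
   (in_coord (M := prod_charted H G) (N := H) F1 (eH, eG) eH \o (fun y => (y, chart eG
     eG))) y.
  apply: filterE => y; rewrite /in_coord /= /F1 /= (chartV_chart eG okG).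
  by rewrite (cm_alpha1 cm).
have A := near_is_diff N1 (Ad_is_diff k).
have v := etrans (esym (@diff_val _ _ _ _ _ _ _ A)) (@diff_val _ _ _ _ _ _ _ L).
have AZ : Ad k Z.1 = 0.
  apply: etrans (congr1 (@^~ Z.1) v) _; rewrite /= -Zin.
  by move: Z1; rewrite /= F1e; exact.
by rewrite -(AdK k Z.1) AZ -[Ad _ _]/(AdL (lgV k) 0) linear0.
Qed.

End CrossedModule.

(** * Regularity of Ad along a curve, applied to a two-parameter family *)

Section AdCurves.
Context {R : realType} {n : nat} (H : lie_group R n).
Let E := 'rV[R]_n.
Let R2 := (R^o * R^o)%type.
Local Notation "g ^i" := (lgV g) (at level 3, format "g ^i").
Local Notation delta i := (delta_mx ord0 i : 'rV[R]_n).
Let okH := ok_manifold H.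

Lemma Cinf_near_sum (F F' : normedModType R) (I : Type) (r : seq I) (f : I -> F -> F') (x
  : F) :
  (forall i, exists2 W, open_nbhs x W & Cinf W (f i)) ->
  exists2 W, open_nbhs x W & Cinf W (fun y => \sum_(i <- r) f i y).
Proof.
move=> Hf; elim: r => [|i r [W Wx sW]].
  exists setT; first by split; [exact: openT|].
  move=> k; suff -> : (fun y => \sum_(i <- [::]) f i y) = (fun=> 0) by exact: Ck_cst.
  by apply/funext => y; rewrite big_nil.
have [V Vx sV] := Hf i; exists (W `&` V).
  by case: Wx => oW Wx; case: Vx => oV Vx; split; [exact: openI|split].
have oWV : open (W `&` V) by apply: openI; [case: Wx|case: Vx].
move=> k; suff -> : (fun y => \sum_(j <- i :: r) f j y) =
    (fun y => f i y + \sum_(j <- r) f j y).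
  apply: Ck_add => //.
    by apply: Ck_sub (sV k) => y [].
  by apply: Ck_sub (sW k) => y [].
by apply/funext => y; rewrite big_cons.
Qed.

Lemma Ad_family_smooth (h : R -> H) (Y : R2 -> E) (U : set R2) (t s : R) :
  open U -> U (t, s) -> Cinf U Y -> smooth_at (vect R^o) H h t ->
  exists2 W : set R2, open_nbhs ((t, s) : R2) W &
    Cinf W (fun z : R2 => Ad (h z.1)^i (Y z) : E).
Proof.
move=> oU Uts sY sh.
have -> : (fun z : R2 => Ad (h z.1)^i (Y z) : E) =
    (fun z : R2 => \sum_(i < n) Y z ord0 i *: Ad (h z.1)^i (delta i)).
  by apply/funext => z; rewrite [LHS]Ad_coords.
apply: Cinf_near_sum => i.
have sA : smooth_at (vect R^o) (vect E) (fun r => Ad (h r)^i (delta i)) t.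
  have sV : smooth_at (vect R^o) H (fun r => (h r)^i) t.
    by apply: smooth_lgV => //; exact: ok_vect.
  exact: (smooth_at_comp (findim_rV n) (ok_vect _) okH sV (Ad_smooth _ _)).
have [_ [W [oW Wt] sW]] := sA.
have o1 : open (fst @^-1` W : set R2).
  by apply: open_comp => // z _; exact: cvg_fst.
exists (U `&` fst @^-1` W); first by split; [exact: openI|].
have oUW : open (U `&` fst @^-1` W : set R2) by exact: openI.
move=> k; apply: Ck_scale => //.
  by apply: Ck_coord => //; apply: Ck_sub (sY k) => z [].
apply: (Ck_comp (V := W) (g := fun z : R2 => z.1)
  (f := fun r : R^o => Ad (h r)^i (delta i))) => //.
- exact: findim_scalar.
- by move=> z [].
- by apply: (@Ck_lin _ _ _ k _ (fst : {linear R2 -> R^o})) => z; exact: cvg_fst.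
Qed.

Lemma Ad_family_regular (h : R -> H) (Y : R2 -> E) (U : set R2) (t s : R) (v : R2)
    (f : R2 -> E) : f = (fun z : R2 => Ad (h z.1)^i (Y z) : E) ->
  open U -> U (t, s) -> Cinf U Y -> smooth_at (vect R^o) H h t ->
  [/\ \forall z \near ((t, s) : R2), differentiable f z,
      {for ((t, s) : R2), continuous (fun z => 'D_v f z)} &
      {for t, continuous (fun r : R => 'D_v f ((r, s) : R2))}].
Proof.
move=> -> oU Uts sY sh; have [W Wts sW] := Ad_family_smooth oU Uts sY sh.
have Wt : W (t, s) by case: Wts.
have c2 : {for ((t, s) : R2), continuous (fun z => 'D_v (fun z : R2 => Ad (h z.1)^i (Y z)
  : E) z)}.
  by apply: Ck_cont Wt; exact: Ck_derive (sW 1%N).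
have c1 : {for t, continuous (fun r : R => (r, s) : R2)}.
  by apply: continuous_for_pair; [exact: cvg_id|exact: cst_continuous].
split; [|exact: c2|exact: (continuous_comp c1 c2)].
by apply: filterS (open_nbhs_nbhs Wts) => z Wz; exact: Ck_diff (sW 1%N) Wz.
Qed.

Lemma is_derive_slice1 (F : normedModType R) (f : R2 -> F) (t s : R) :
  differentiable f ((t, s) : R2) ->
  is_derive t 1 (fun r : R => f ((r, s) : R2)) ('D_((1, 0) : R2) f (t, s)).
Proof.
move=> df; rewrite (deriveE _ df).
have := is_diff_comp (is_diff_inl (t : R^o) (s : R^o)) (differentiableP df).
by move=> /is_diff_is_derive.
Qed.

(** Lets [h z.1] be frozen at [h t]: along the direction [(0, 1)] the first coordinate is constant,
    so the two maps agree on the line without having to agree near the point. *)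
Lemma derive_line_congr (F F' : normedModType R) (f g : F -> F') (z v : F) :
  (forall d : R, f (d *: v + z) = g (d *: v + z)) -> 'D_v f z = 'D_v g z.
Proof.
move=> fg; have fz : f z = g z by have := fg 0; rewrite scale0r add0r.
rewrite /derive fz; apply: (congr1 (fun q : R -> F' => lim (q h @[h --> 0^']))).
by apply/funext => d /=; rewrite fg.
Qed.

Lemma derive_Ad_slice2 (h : R -> H) (Y : R2 -> E) (t s : R) :
  differentiable Y ((t, s) : R2) ->
  'D_((0, 1) : R2) (fun z : R2 => Ad (h z.1)^i (Y z) : E) (t, s) =
  Ad (h t)^i ('D_((0, 1) : R2) Y (t, s)).
Proof.
move=> dY; have D := is_diff_lin_comp (@Ad_continuous _ _ _ (h t)^i : continuous (AdL (h
  t)^i))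
  (differentiableP dY).
apply: etrans _ (etrans (is_diff_derive ((0, 1) : R2) D) _); last first.
  by rewrite (deriveE _ dY).
apply: derive_line_congr => d /=.
by rewrite scaler0 add0r.
Qed.

End AdCurves.

(** * The horizontality condition in L(H) and the variation of the holonomy *)

Section HorizontalLift.
Context {R : realType} {nG nH nP : nat} {G : lie_group R nG} {H : lie_group R nH}.
Variables (alpha : G -> H -> H) (tau : H -> G) (cm : crossed_module alpha tau).
Variables (P : manifold R nP) (A : P -> 'rV[R]_nP -> 'rV[R]_nG).
Local Notation "g ** h" := (lgM g h) (at level 40, left associativity).
Local Notation "g ^i" := (lgV g) (at level 3, format "g ^i").
Local Notation e := (lg1 H).
Local Notation psi := (chartV e).
Local Notation o := (chart (lg1 H) (lg1 H)).
Let E := 'rV[R]_nH.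
Let R2 := (R^o * R^o)%type.

(** [sd_Ad_inH_eq0] strips the outer adjoint action and keeps the [L(H)] component, in which
    [dalpha_tau] turns every [Ad(g^-1)] into [Ad(h^-1)]. *)
Lemma Omega_eq0 (C0 : P -> 'rV[R]_nP -> 'rV[R]_nG) (C1 CL1 CR1 : P -> 'rV[R]_nP -> E)
    (B0 : P -> 'rV[R]_nP -> 'rV[R]_nP -> 'rV[R]_nG) (B1 : P -> 'rV[R]_nP -> 'rV[R]_nP -> E)
    (t0 t1 : R) (h : R -> H) (c : R -> P) (x : H) (v : R -> 'rV[R]_nP) (X : E) :
  (forall p v, CL1 p v = - C1 p v) -> (forall p v, CR1 p v = - C1 p v) ->
  Omega alpha tau A (fun p v => (CL1 p v, C0 p v)) (fun p v => (CR1 p v, C0 p v))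
    (fun p v w => (B1 p v w, B0 p v w)) t0 t1 h c x v X = 0 ->
  rtranslate x X = Ad (h t1)^i (C1 (c t1) (v t1)) - C1 (c t0) (v t0) -
    \row_i \int[@lebesgue_measure R]_(t in `[t0, t1])
      Ad (h t)^i (B1 (c t) (v t) (velocity c t)) ord0 i.
Proof.
move=> hL hR /sd_Ad_inH_eq0 - /(_ _ cm).
rewrite /= (sd_Ad_inG_fst cm) -(cm_tauV cm) (dalpha_tau cm) /= hL hR.
set I1 := \row_i _; set I2 := \row_i _ => H0.
have I12 : I1 = I2.
  apply/rowP => i; rewrite !mxE; apply: eq_Rintegral => t _.
  by rewrite (sd_Ad_inG_fst cm) -(cm_tauV cm) (dalpha_tau cm).
move: H0; rewrite I12 add0r opprK -[Ad _ (- _)]/(AdL _ (- _)) linearN /=.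
set a := Ad _ _; set b := C1 _ _; move=> /eqP.
rewrite addrC addr_eq0 => /eqP ->.
by rewrite !opprD opprK.
Qed.

Variables (C1 : P -> 'rV[R]_nP -> E) (hC1 : form1 C1).
Variable B1 : P -> 'rV[R]_nP -> 'rV[R]_nP -> E.
Hypothesis B1E : forall (U : set P) (v w : P -> 'rV[R]_nP), open U ->
  smooth_field U v -> smooth_field U w -> forall p, U p ->
  B1 p (v p) (w p) =
    - (ext_deriv C1 v w p + 2^-1 *: form_bracket H C1 p (v p) (w p)).

Lemma lie_bracketC (X Y : E) : lie_bracket H X Y = - lie_bracket H Y X.
Proof. by rewrite !lie_bracketE opprB. Qed.

(** The vectors enter [B1] in the order [d_s], [d_t], but the pulled back exterior derivative in the
    order [d_t], [d_s]. The swap absorbs the minus sign in the formula for [B1], and the [2] in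
    [form_bracket] cancels the half. *)
Lemma curvature_pull (L : R2 -> P) (U : set R2) (z : R2) :
  open U -> smooth_on (prod_charted (vect R^o) (vect R^o)) P U L -> U z ->
  B1 (L z) (velocity (fun r => L (z.1, r)) z.2) (velocity (fun r => L (r, z.2)) z.1) =
  'D_((1, 0) : R2) (pull2 C1 L) z - 'D_((0, 1) : R2) (pull1 C1 L) z +
  lie_bracket H (pull1 C1 L z) (pull2 C1 L z).
Proof.
move=> oU sL Uz; have K := pull_ext_deriv hC1 oU sL Uz.
rewrite [X in _ = X + _]K.
set v := velocity _ z.1; set w := velocity _ z.2.
have B := B1E (open_dom (L z)) (coord_field_smooth (p := L z) w) (coord_field_smooth (p
  := L z) v)
  (dom_self (L z)).
have cv : coord_field (L z) v (L z) = v by exact: coord_vec_self.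
have cw : coord_field (L z) w (L z) = w by exact: coord_vec_self.
(* The hypothesis on [B1] speaks of values of fields; these two steps replace the values at [L z] by
   the vectors themselves. *)
have B' := eq_ind _ (fun w' => B1 (L z) w' _ =
  - (_ + 2^-1 *: form_bracket H C1 (L z) w' _)) B _ cw.
have {B B'} B := eq_ind _ (fun v' => B1 (L z) w v' =
  - (_ + 2^-1 *: form_bracket H C1 (L z) w v')) B' _ cv.
apply: etrans B _.
rewrite /form_bracket scalerA mulVf ?pnatr_eq0// scale1r.
have aux (X Y a b : E) : X = - Y -> - (X + lie_bracket H a b) = Y + lie_bracket H b a.
  by move=> ->; rewrite opprD opprK -lie_bracketC.
apply: aux; apply: etrans (ext_deriv_coord hC1 (L z) w v) _.
apply: etrans _ (esym (congr1 -%R (ext_deriv_coord hC1 (L z) v w))).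
by rewrite opprB.
Qed.

(** [J' + N'] is the integrand with [B1], where [N] is [Ad(h_s^-1)] applied to [pull2]; hence [J t1]
    is the integral minus the increment of [N]. At [t0] the solution is the unit and at [t1] it is
    the holonomy, so the values of [N] are the end-point terms of [Omega]. *)
Lemma holonomy_variation (L : R2 -> P) (U : set R2) (t0 t1 s : R) (I : set R)
    (h : R -> R -> H) :
  open U -> smooth_on (prod_charted (vect R^o) (vect R^o)) P U L ->
  t0 < t1 -> I s -> (forall t r, t0 <= t <= t1 -> I r -> U (t, r)) ->
  (forall r, I r -> is_h_solution C1 t0 t1 (fun t => L (t, r)) (h r)) ->
  exists K : R -> E, [/\ K 0 = o,
    is_derive (0 : R) 1 K
      (\row_i \int[@lebesgue_measure R]_(t in `[t0, t1])
         Ad (h s t)^i (B1 (L (t, s)) (velocity (fun r => L (t, r)) s)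
                                    (velocity (fun r => L (r, s)) t)) ord0 i
       - Ad (h s t1)^i (pull2 C1 L (t1, s)) + pull2 C1 L (t0, s)) &
    \forall d \near (0 : R), I (s + d) -> (h s t1)^i ** h (s + d) t1 = psi (K d)].
Proof.
move=> oU sL t01 Is IU hsol.
have [sp1 sp2] := pull_smooth hC1 oU sL.
(* The sign makes [Y1 (t, r)] the logarithmic derivative of [h r] at [t]. *)
pose Y1 (z : R2) : E := - pull1 C1 L z; pose Y2 : R2 -> E := pull2 C1 L.
have sY1 : Cinf U Y1.
  move=> k; have S := Ck_scale oU (@Ck_cst _ _ _ k U (-1 : R^o)) (sp1 k).
  by apply: Ck_ext oU _ S => z _; rewrite scaleN1r.
have sh r t : I r -> t0 <= t <= t1 -> smooth_at (vect R^o) H (h r) t.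
  move=> Ir tt; have [[W [oW tW] sW] _ _] := hsol r Ir.
  by apply: sW; apply: tW; rewrite /= in_itv.
have rl r t : I r -> t0 <= t <= t1 -> rlog (h r) t (Y1 (t, r)).
  move=> Ir tt; have := rlog_velocity (sh r t Ir tt).
  by have [_ _ ->] := hsol r Ir.
have h1 r : I r -> h r t0 = e by move=> Ir; have [] := hsol r Ir.
pose f1 (z : R2) : E := Ad (h s z.1)^i (Y1 z).
pose f2 (z : R2) : E := Ad (h s z.1)^i (Y2 z).
have reg1 t (tt : t0 <= t <= t1) := Ad_family_regular ((0, 1) : R2) (erefl f1) oU
  (IU t s tt Is) sY1 (sh s t Is tt).
have reg2 t (tt : t0 <= t <= t1) := Ad_family_regular ((1, 0) : R2) (erefl f2) oU
  (IU t s tt Is) sp2 (sh s t Is tt).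
pose b1 (t : R) : E := 'D_((0, 1) : R2) f1 (t, s).
pose b2 (t : R) : E := 'D_((1, 0) : R2) f2 (t, s).
have cb1 t : t0 <= t <= t1 -> {for t, continuous b1} by move=> /reg1[].
have cb2 t : t0 <= t <= t1 -> {for t, continuous b2} by move=> /reg2[].
have [F dF] := continuous_primitive_rV t01 cb1.
pose J (t : R) : E := F t - F t0.
have dJ t : t0 <= t <= t1 -> is_derive t 1 J (b1 t).
  move=> tt; have := is_deriveB (dF t tt) (is_derive_cst (F t0) t 1).
  by rewrite subr0.
have J0 : J t0 = 0 by rewrite /J subrr.
pose N (t : R) : E := f2 (t, s).
have dN t : t0 <= t <= t1 -> is_derive t 1 N (b2 t).
  by move=> /reg2[df _ _]; apply: is_derive_slice1; exact: nbhs_singleton df.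
have b2E t : t0 <= t <= t1 -> b2 t =
    Ad (h s t)^i ('D_((1, 0) : R2) Y2 (t, s) - lie_bracket H (Y1 (t, s)) (Y2 (t, s))).
  move=> tt; have d2 : differentiable Y2 ((t, s) : R2).
    exact: Ck_diff (sp2 1%N) (IU t s tt Is).
  have D := rlog_Ad_curve (rl s t Is tt) (is_derive_slice1 d2).
  have [_ v1] := dN t tt; have [_ v2] := D.
  exact: (etrans (esym v1) v2).
have b1E t : t0 <= t <= t1 -> b1 t = Ad (h s t)^i (- 'D_((0, 1) : R2) (pull1 C1 L) (t, s)).
  move=> tt; have d1 : differentiable Y1 ((t, s) : R2).
    exact: Ck_diff (sY1 1%N) (IU t s tt Is).
  have d1' : differentiable (pull1 C1 L) ((t, s) : R2).
    exact: Ck_diff (sp1 1%N) (IU t s tt Is).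
  apply: etrans (derive_Ad_slice2 (h s) d1) _; apply: congr1.
  exact: (deriveN (@diff_derivable _ _ _ _ _ ((0, 1) : R2) d1')).
pose beta (t : R) : E := Ad (h s t)^i (B1 (L (t, s)) (velocity (fun r => L (t, r)) s)
  (velocity (fun r => L (r, s)) t)).
(* The bracket in the curvature is the one produced by differentiating [Ad (h s t)^-1] in [t]; the
   sign of [Y1] makes them match. *)
have betaE t : t0 <= t <= t1 -> beta t = b1 t + b2 t.
  move=> tt; have Uts := IU t s tt Is.
  have K := curvature_pull oU sL Uts.
  have aux (a b c d : E) : Ad (h s t)^i (a - b + lie_bracket H c d) =
      Ad (h s t)^i (- b) + Ad (h s t)^i (a - lie_bracket H (- c) d).
    rewrite lie_bracketNl opprK [a - b]addrC -addrA.
    exact: (linearD (AdL (h s t)^i) (- b) (a + lie_bracket H c d)).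
  exact: (etrans (congr1 (Ad (h s t)^i) K) (etrans (aux _ _ _ _)
    (esym (congr2 (fun a b : E => a + b) (b1E t tt) (b2E t tt))))).
have intE : \row_i \int[@lebesgue_measure R]_(t in `[t0, t1]) beta t ord0 i =
    J t1 + N t1 - N t0.
  transitivity (\row_i \int[@lebesgue_measure R]_(t in `[t0, t1])
    (fun t => b1 t + b2 t) t ord0 i).
    apply/rowP => i; rewrite !mxE; apply: eq_Rintegral => t.
    by rewrite inE /= in_itv /= => /betaE ->.
  have c12 t : t0 <= t <= t1 -> {for t, continuous (fun t => b1 t + b2 t)}.
    by move=> tt; apply: continuousD; [exact: cb1|exact: cb2].
  have d12 t : t0 <= t <= t1 -> is_derive t 1 (fun t => J t + N t) (b1 t + b2 t).
    by move=> tt; have := is_deriveD (dJ t tt) (dN t tt).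
  by apply: etrans (FTC2_rV t01 c12 d12) _; rewrite J0 add0r.
have fE : f1 = (fun z : R2 => Ad (h s z.1)^i (Y1 (z.1, z.2))).
  by apply/funext => -[a b].
have regv t : t0 <= t <= t1 -> (\forall z \near ((t, s) : R2), differentiable f1 z) /\
    {for ((t, s) : R2), continuous (fun z => 'D_((0, 1) : R2) f1 z)}.
  by move=> /reg1[].
have [K [K0 dK HK]] := @log_curve_parameter_derivative _ _ H t0 t1 s I h (fun t r => Y1 (t, r)) J f1
  fE t01 Is h1 (fun r t Ir tt => rl r t Ir tt) regv J0 dJ.
exists K; split=> //.
have N0 : N t0 = pull2 C1 L (t0, s) by rewrite /N /f2 /= h1// lgV1 Ad1.
have -> : \row_i \int[@lebesgue_measure R]_(t in `[t0, t1])
         Ad (h s t)^i (B1 (L (t, s)) (velocity (fun r => L (t, r)) s)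
                                    (velocity (fun r => L (r, s)) t)) ord0 i
       - Ad (h s t1)^i (pull2 C1 L (t1, s)) + pull2 C1 L (t0, s) = J t1.
  rewrite -N0; apply: etrans (congr1 (fun a : E => a - N t1 + N t0) intE) _.
  by rewrite addrAC subrK addrK.
exact: dK.
Qed.

End HorizontalLift.

(** * Cancellation of derivatives in a product of two curves *)

Section Horizontal.
Context {R : realType} {n : nat} {H : lie_group R n}.
Local Notation "g ** h" := (lgM g h) (at level 40, left associativity).
Local Notation "g ^i" := (lgV g) (at level 3, format "g ^i").
Local Notation e := (lg1 H).
Local Notation phi := (chart e).
Local Notation psi := (chartV e).
Local Notation o := (chart (lg1 H) (lg1 H)).
Let E := 'rV[R]_n.
Let okH := ok_manifold H.

Lemma rlog_shift (x : R -> H) (s : R) (X : E) : rlog x s X ->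
  tangent (fun d => x (s + d) ** (x s)^i) 0 X.
Proof.
move=> [c1 e1 d1].
have dsh : is_derive (0 : R) 1 (fun d : R => s + d) (1 : R).
  have := is_deriveD (is_derive_cst s (0 : R) 1) (is_derive_id (0 : R) 1).
  by rewrite add0r.
have csh : {for (0 : R), continuous (fun d : R => s + d)}.
  by apply: differentiable_continuous; apply/derivable1_diffP; case: dsh.
split; [|by rewrite addr0|].
  have c1' : {for s + 0, continuous (fun r => x r ** (x s)^i)} by rewrite addr0.
  exact: (continuous_comp csh c1').
have d1' : is_derive (s + 0) 1 (fun r => phi (x r ** (x s)^i) : E) X by rewrite addr0.
have := is_derive_comp dsh (is_derive_is_diff d1').
by rewrite scale1r.
Qed.

Lemma tangent_chartV (K : R -> E) (X : E) : K 0 = o -> is_derive (0 : R) 1 K X ->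
  tangent (fun d => psi (K d)) 0 X.
Proof.
move=> K0 dK.
have cK : {for (0 : R), continuous K}.
  by apply: differentiable_continuous; apply/derivable1_diffP; case: dK.
have cpsi : {for K 0, continuous (psi : E -> H)} by rewrite K0; exact: ok_chartV_cont.
split; [exact: (continuous_comp cK cpsi)|by rewrite K0 psi_o|].
apply: near_eq_is_derive dK.
have N : nbhs (K 0) [set y : E | phi (psi y) = y] by rewrite K0; exact: (ok_chartVK okH e).
have NK : \forall d \near (0 : R), phi (psi (K d)) = K d by exact: (cK _ N).
by apply: filterS NK => d ->.
Qed.

(* [y (s + d) x (s + d) (y s x s)^-1] is the conjugate by [y s] of the product of
   [(y s)^-1 y (s + d)] and [x (s + d) (x s)^-1], whose derivatives cancel. *)
Lemma mul_zero_derivative (x y : R -> H) (s : R) (X : E) (K : R -> E)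
    (Q : R -> Prop) :
  rlog x s X -> K 0 = o -> is_derive (0 : R) 1 K (- X) ->
  (\forall d \near (0 : R), Q d -> (y s)^i ** y (s + d) = psi (K d)) ->
  exists K' : R -> E, [/\ K' 0 = o, is_derive (0 : R) 1 K' 0 &
    \forall d \near (0 : R), Q d ->
      (y (s + d) ** x (s + d)) ** (y s ** x s)^i = psi (K' d)].
Proof.
move=> Rx K0 dK HK.
have T := tangent_conj (y s) (tangent_mul (tangent_chartV K0 dK) (rlog_shift Rx)).
rewrite addNr -[Ad (y s) 0]/(AdL (y s) 0) linear0 in T.
have [cT eT dT] := T.
exists (fun d => phi (y s ** (psi (K d) ** (x (s + d) ** (x s)^i)) ** (y s)^i) : E).
split; [by rewrite eT|exact: dT|].
have N := tangent_near T.
near=> d => Qd.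
have Nd : psi (phi (y s ** (psi (K d) ** (x (s + d) ** (x s)^i)) ** (y s)^i)) =
    y s ** (psi (K d) ** (x (s + d) ** (x s)^i)) ** (y s)^i by exact: (near N d).
have Hd : (y s)^i ** y (s + d) = psi (K d) by move: Qd; exact: (near HK d).
by rewrite Nd -Hd !lgMA lgMV lg1M lgVMM !lgMA.
Unshelve. all: by end_near. Qed.

End Horizontal.

Theorem proposition8p1 (R : realType) (nG nH nP nM : nat)
  (G : lie_group R nG) (H : lie_group R nH)
  (alpha : G -> H -> H) (tau : H -> G)
  (cm : crossed_module alpha tau)
  (P : manifold R nP) (M : manifold R nM) (pi : P -> M) (act : P -> G -> P)
  (pb : principal_bundle pi act)
  (A : P -> 'rV[R]_nP -> 'rV[R]_nG) (hA : connection act A)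
  (C0 : P -> 'rV[R]_nP -> 'rV[R]_nG)
  (C1 C1L C1R : P -> 'rV[R]_nP -> 'rV[R]_nH)
  (B0 : P -> 'rV[R]_nP -> 'rV[R]_nP -> 'rV[R]_nG)
  (B1 : P -> 'rV[R]_nP -> 'rV[R]_nP -> 'rV[R]_nH)
  (hC0 : [/\ form1 C0, equivariant1 act (@Ad R nG G) C0 & horizontal1 pi C0])
  (hC1 : [/\ form1 C1, equivariant1 act (dalpha alpha) C1 & horizontal1 pi C1])
  (hB0 : [/\ form2 B0, equivariant2 act (@Ad R nG G) B0 & horizontal2 pi B0])
  (hB1 : [/\ form2 B1, equivariant2 act (dalpha alpha) B1 & horizontal2 pi B1])
  (hC1L : forall p v, C1L p v = - C1 p v)
  (hC1R : forall p v, C1R p v = - C1 p v)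
  (hB1C1 : forall (U : set P) (v w : P -> 'rV[R]_nP), open U ->
     smooth_field U v -> smooth_field U w -> forall p, U p ->
     B1 p (v p) (w p) =
       - (ext_deriv C1 v w p + 2^-1 *: form_bracket H C1 p (v p) (w p)))
  (t0 t1 s0 s1 : R) (ht : t0 < t1) (hs : s0 < s1)
  (hsol : (R -> P) -> R -> H)
  (hsolP : forall c, horizontal_path A t0 t1 c -> is_h_solution C1 t0 t1 c (hsol c))
  (Gam : R -> R -> P) (x : R -> H)
  (hdec : dec_path pi A t0 t1 s0 s1 Gam x)
  (hhor : forall s, s0 <= s <= s1 ->
     Omega alpha tau A
       (fun p v => (C1L p v, C0 p v)) (fun p v => (C1R p v, C0 p v))
       (fun p v w => (B1 p v w, B0 p v w))
       t0 t1 (hsol (fun t => Gam t s))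
       (fun t => Gam t s) (x s)
       (fun t => velocity (fun s' => Gam t s') s) (velocity x s) = 0)
  (hx0 : x s0 = lgV (hsol (fun t => Gam t s0) t1)) :
  forall s, s0 <= s <= s1 -> x s = lgV (hsol (fun t => Gam t s) t1).
Proof.
have [fC1 _ _] := hC1.
have [[U [oU IU] sL] horG sx _] := hdec.
pose y (s : R) : H := hsol (fun t => Gam t s) t1.
pose I : set R := [set s | s0 <= s <= s1].
have hs01 s : s0 <= s <= s1 -> exists K : R -> 'rV[R]_nH,
    [/\ K 0 = chart (lg1 H) (lg1 H), is_derive (0 : R) 1 K 0 &
    \forall d \near (0 : R), s0 <= s + d <= s1 ->
      lgM (lgM (y (s + d)) (x (s + d))) (lgV (lgM (y s) (x s))) =
      chartV (lg1 H) (K d)].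
  move=> sI.
  have UI t r : t0 <= t <= t1 -> I r -> U (t, r).
    by move=> tt Ir; apply: IU; split; rewrite /= in_itv.
  have solI r : I r -> is_h_solution C1 t0 t1 (fun t => Gam t r) (hsol (fun t => Gam t r)).
    by move=> Ir; apply: hsolP; exact: horG.
  have [K [K0 dK HK]] := @holonomy_variation _ _ _ H P C1 fC1 B1 hB1C1
    (fun z => Gam z.1 z.2) U t0 t1 s I (fun r => hsol (fun t => Gam t r))
    oU sL ht sI UI solI.
  have Rx : rlog x s (rtranslate (x s) (velocity x s)).
    apply: rlog_velocity; have [W [oW tW] sW] := sx.
    by apply: sW; apply: tW; rewrite /= in_itv.
  have O := Omega_eq0 cm hC1L hC1R (hhor s sI).
  apply: (mul_zero_derivative Rx K0 _ HK).
  (* Minus the logarithmic derivative of [x] given by [O] is, term by term, the derivative [dK] of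
     the holonomy. *)
  rewrite O opprB opprD opprK addrA.
  exact: dK.
have const := group_const hs01.
move=> s sI; have := const s sI.
rewrite hx0 -/(y s0) lgMV => yx.
exact: lgV_uniq.
Qed.
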